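(* Let $G$ be a simple graph on $n$ nodes with degeneracy $d$, and let $H$ be any simple pattern graph on $k$ nodes (not necessarily connected). Then one can compute $\hom(H,G)$, $\mathrm{sub}(H,G)$ and $\mathrm{ind}(H,G)$ in time $f(d,k)\cdot \tilde{O}(n^{\lfloor k/4\rfloor+2})$, for some computable function $f$.
   Context: The degeneracy of $G$ is the smallest $d$ such that $G$ admits an acyclic orientation in which every node has out-degree at most $d$. A homomorphism from $H$ to $G$ is a map $\phi:V_H\to V_G$ such that $\{u,u'\}\in E_H$ implies $\{\phi(u),\phi(u')\}\in E_G$; $\hom(H,G)$ is the number of such maps. A copy of $H$ in $G$ is a subgraph $F\subseteq G$ isomorphic to $H$; it is induced if moreover $F$ equals the subgraph of $G$ induced by $V_F$. $\mathrm{sub}(H,G)$ and $\mathrm{ind}(H,G)$ denote the number of copies and of induced copies of $H$ in $G$. Conventions: $k=O(1)$, asymptotic notation hides $\mathrm{poly}(k)$ factors, and $\tilde O(\cdot)$ additionally hides $\mathrm{polylog}(ndk)$ factors. *)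

(* Defs.v *)
From mathcomp Require Import all_boot.

Set Implicit Arguments.
Unset Strict Implicit.
Unset Printing Implicit Defensive.

(** * Graphs *)

Record sgraph (n : nat) := SGraph {
  adj : rel 'I_n;
  adj_sym : symmetric adj;
  adj_irr : irreflexive adj }.

Definition edges n (G : sgraph n) : {set {set 'I_n}} :=
  [set [set p.1; p.2] | p : 'I_n * 'I_n & adj G p.1 p.2].

(** * Degeneracy *)

Definition arc n (o : {set 'I_n * 'I_n}) : rel 'I_n :=
  fun u v => (u, v) \in o.

Definition orientation n (G : sgraph n) (o : {set 'I_n * 'I_n}) : bool :=
  [forall u, forall v,
     (adj G u v == arc o u v || arc o v u) && ~~ (arc o u v && arc o v u)].

Definition acyclic n (e : rel 'I_n) : bool :=
  [forall u, forall v, e u v ==> ~~ connect e v u].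

Lemma acyclicP n (e : rel 'I_n) :
  reflect (forall p : seq 'I_n, cycle e p -> p = [::]) (acyclic e).
Proof.
apply: (iffP forallP) => [He [//|u p] /= | He u].
- case: p => [|v p] /=.
    rewrite andbT => euu.
    by move/forallP: (He u) => /(_ u); rewrite euu connect0.
  case/andP=> euv; rewrite rcons_path => /andP[vp lu].
  move/forallP: (He u) => /(_ v); rewrite euv /=; case/negP.
  by apply/connectP; exists (rcons p u); rewrite ?rcons_path ?vp ?last_rcons.
- apply/forallP => v; apply/implyP => euv; apply/negP.
  case/connectP => p vp lu.
  case: (lastP p) vp lu => [_ /= uv | q x].
    by have := He [:: u]; rewrite /= {2}uv euv => /(_ isT).
  rewrite last_rcons => vq ux; have := He [:: u, v & q].
  by rewrite /= euv ux vq => /(_ isT).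
Qed.

Definition acyclic_orientation_le n (G : sgraph n) (d : nat) : bool :=
  [exists o : {set 'I_n * 'I_n},
     [&& orientation G o, acyclic (arc o)
       & [forall u, #|[set v | arc o u v]| <= d]]].

Lemma acyclic_orientation_ex n (G : sgraph n) :
  exists d, acyclic_orientation_le G d.
Proof.
exists n; apply/existsP.
exists [set p : 'I_n * 'I_n | adj G p.1 p.2 & p.1 < p.2].
apply/and3P; split.
- apply/forallP => u; apply/forallP => v; rewrite /arc !inE /= (adj_sym G v u).
  have [->|] := eqVneq u v; first by rewrite adj_irr.
  by rewrite -val_eqE /=; case: (adj G u v); case: ltngtP.
- apply/forallP => u; apply/forallP => v; apply/implyP; rewrite {1}/arc inE /=.
  case/andP=> _ ltuv; apply/negP => /connectP [p + lu].
  have le_last w q : path (arc [set p : 'I_n * 'I_n | adj G p.1 p.2 & p.1 < p.2])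
      w q -> w <= last w q.
    elim: q w => //= x q IH w /andP[]; rewrite {1}/arc inE /= => /andP[_ wx] /IH.
    exact/leq_trans/ltnW.
  by move/le_last; rewrite -lu leqNgt ltuv.
- by apply/forallP => u; rewrite -[X in _ <= X]card_ord max_card.
Qed.

Definition degeneracy n (G : sgraph n) : nat := ex_minn (acyclic_orientation_ex G).

(** * Homomorphisms, copies and induced copies *)

Definition hom k n (H : sgraph k) (G : sgraph n) : nat :=
  #|[set phi : {ffun 'I_k -> 'I_n} |
      [forall u, forall v, adj H u v ==> adj G (phi u) (phi v)]]|.

(* A pair F of type [subgraph n] is a vertex set F.1 and an edge set F.2. *)
Definition subgraph n : finType := ({set 'I_n} * {set {set 'I_n}})%type.

Definition is_subgraph n (F : subgraph n) (G : sgraph n) : bool :=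
  (F.2 \subset edges G) && [forall e in F.2, e \subset F.1].

Definition isomorphic k n (H : sgraph k) (F : subgraph n) : bool :=
  [exists phi : {ffun 'I_k -> 'I_n},
     [&& injectiveb phi, phi @: [set: 'I_k] == F.1
       & [forall u, forall v, adj H u v == ([set phi u; phi v] \in F.2)]]].

Definition copy k n (H : sgraph k) (G : sgraph n) (F : subgraph n) : bool :=
  is_subgraph F G && isomorphic H F.

Definition induced n (G : sgraph n) (F : subgraph n) : bool :=
  F.2 == [set e in edges G | e \subset F.1].

Definition sub k n (H : sgraph k) (G : sgraph n) : nat :=
  #|[set F : subgraph n | copy H G F]|.

Definition ind k n (H : sgraph k) (G : sgraph n) : nat :=
  #|[set F : subgraph n | copy H G F & induced G F]|.

(** * Random access machines with bit cost

    Programs are while-programs over a random access memory [mem] and a fixed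
    number of registers [reg].  All cells hold natural numbers of unbounded
    size, and every access is charged by the bit length of the address and of
    the value.  The charge for a binary operation is the product of the bit
    lengths of its operands, which is the cost of the schoolbook algorithm for
    multiplication and division and an upper bound, up to a constant factor,
    for the others. *)

Inductive binop := Add | Sub | Mul | Div | Mod | Lt | Eq.

Inductive expr :=
| Const of nat
| Reg of nat
| Deref of expr
| Op of binop & expr & expr.

Inductive cmd :=
| Skip
| Assign of nat & expr
| Store of expr & expr
| Seq of cmd & cmd
| If of expr & cmd & cmd
| While of expr & cmd.

Record state := State { reg : nat -> nat; mem : nat -> nat }.

Definition upd (g : nat -> nat) (a x : nat) : nat -> nat :=
  fun b => if b == a then x else g b.

Definition bits (x : nat) : nat := (trunc_log 2 x).+1.

Definition eval_op (o : binop) : nat -> nat -> nat :=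
  match o with
  | Add => addn
  | Sub => subn
  | Mul => muln
  | Div => divn
  | Mod => modn
  | Lt => fun x y => x < y
  | Eq => fun x y => x == y
  end.

Fixpoint eval (s : state) (e : expr) : nat :=
  match e with
  | Const x => x
  | Reg r => reg s r
  | Deref a => mem s (eval s a)
  | Op o e1 e2 => eval_op o (eval s e1) (eval s e2)
  end.

Fixpoint cost (s : state) (e : expr) : nat :=
  match e with
  | Const x => bits x
  | Reg r => bits (reg s r)
  | Deref a => cost s a + bits (eval s a) + bits (mem s (eval s a))
  | Op o e1 e2 => cost s e1 + cost s e2 + bits (eval s e1) * bits (eval s e2)
  end.

(* [exec p s t s']: started in state s, program p halts in state s' after
   time t. *)
Inductive exec : cmd -> state -> nat -> state -> Prop :=
| ExecSkip s : exec Skip s 1 s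
| ExecAssign r e s :
    exec (Assign r e) s
      (cost s e + bits (eval s e)) (State (upd (reg s) r (eval s e)) (mem s))
| ExecStore a e s :
    exec (Store a e) s
      (cost s a + cost s e + bits (eval s a) + bits (eval s e))
      (State (reg s) (upd (mem s) (eval s a) (eval s e)))
| ExecSeq p q s1 t1 s2 t2 s3 :
    exec p s1 t1 s2 -> exec q s2 t2 s3 -> exec (Seq p q) s1 (t1 + t2) s3
| ExecIf e p q s t s' :
    exec (if eval s e != 0 then p else q) s t s' ->
    exec (If e p q) s (cost s e + t) s'
| ExecWhileEnd e p s :
    eval s e = 0 -> exec (While e p) s (cost s e) s
| ExecWhile e p s1 t1 s2 t2 s3 :
    eval s1 e != 0 ->
    exec p s1 t1 s2 -> exec (While e p) s2 t2 s3 ->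
    exec (While e p) s1 (cost s1 e + t1 + t2) s3.

(* The input occupies the first memory cells; everything else is zero. *)
Definition init (input : seq nat) : state :=
  State (fun=> 0) (fun a => nth 0 input a).

(* The output is read off register 0. *)
Definition outputs_in_time (p : cmd) (input : seq nat) (out T : nat) : Prop :=
  exists t s, [/\ exec p (init input) t s, reg s 0 = out & t <= T].

Definition computable2 (f : nat -> nat -> nat) : Prop :=
  exists p : cmd, forall x y, exists T, outputs_in_time p [:: x; y] (f x y) T.

Definition neighbors n (G : sgraph n) (u : 'I_n) : seq nat :=
  [seq val v | v <- enum 'I_n & adj G u v].

(* The number of nodes, followed by the adjacency list of every node, each
   prefixed with its length. *)
Definition encode n (G : sgraph n) : seq nat :=
  n :: flatten [seq size (neighbors G u) :: neighbors G u | u <- enum 'I_n].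

(** * Asymptotic notation

    [tildeO c n d k T] is a bound of the form c * poly(k) * polylog(ndk) * T
    with one constant c for all coefficients and exponents.  The shifts only
    serve to keep poly(k) and log(ndk) positive when n, d or k is 0. *)
Definition tildeO (c n d k T : nat) : nat :=
  c * k.+1 ^ c * trunc_log 2 (2 * n.+1 * d.+1 * k.+1) ^ c * T.

(* Main.v *)
(** Removing vertices of minimum degree one by one orients G with out-degrees
    at most D <= d; let F 1, ..., F D be the partial functions that list the
    out-neighbours.  Choosing for every pair u, v of vertices of H one of the
    conditions F l (phi u) = phi v, F l (phi v) = phi u, phi u = phi v, or no
    condition at all, writes the number of homomorphisms, of injective ones and
    of induced embeddings as a signed sum, over at most (2D+2)^(k^2) choices, of
    numbers of solutions phi of a system of functional equations; copies are
    embeddings up to automorphisms of H.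

    A solution of a system is determined by its values on one representative of
    every source component.  Consider the bipartite graph that joins the
    representatives to the other vertices they reach.  Fixing the value of a
    representative determines its neighbours, so that fixing a vertex of degree
    at least 3, or one on a cycle when all degrees are at most 2, disposes of at
    least four vertices.  Hence, after fixing at most k/4 vertices, the
    remaining constraints form a forest, along which the solutions are summed
    in time quadratic in n.  The program runs over all n^(k/4) assignments to
    the fixed vertices.

    The programs are compiled from a language of array programs whose loop
    bounds are known when a loop is entered, so that the running time is a
    monomial read off the text.  Arithmetic is modulo a number W larger than
    all results, which makes negative coefficients available. *)

From mathcomp Require Import all_boot all_algebra zify ring.
Require Import Defs.

Set Implicit Arguments.
Unset Strict Implicit.
Unset Printing Implicit Defensive.

Import GRing.Theory.

(** The factor f may depend on d and k but not on n. So every loop is charged to one of three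
    budgets: a power of [bigpow d k] for label matrices, strategies and loops over H, a power of n +
    1, and the number n^(k/4) of assignments. The summand 2 in the exponent comes from the pairs of
    values of a vertex and its parent in the summation over the forest. As time depending only on d
    and k is free, no good strategy is computed: all codes are tried, and the combinatorics only has
    to show that a valid one exists.

    Two representatives that reach a common vertex w have to force the same value on it. Keeping w
    as a variable turns this into two conditions, each on one representative and w, so that all
    conditions are binary and lie on the edges of a bipartite graph. Fixing a w does not determine
    its neighbours; it disposes of them because a representative of degree at most 2 that loses a
    neighbour becomes a leaf.

    The modulus is polynomial in n for fixed k, so large numbers cost only polylogarithmic
    factors. *)

Section BitLength.

(** * Bit lengths of values and costs of expressions *)

Lemma bits_gt0 x : 0 < bits x. Proof. by []. Qed.

Lemma ltn_bits x : x < 2 ^ bits x.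
Proof. exact: trunc_log_ltn. Qed.

Lemma bits_leq x m : 0 < m -> x < 2 ^ m -> bits x <= m.
Proof.
case: x => [|x] m0 lt_xm; first by rewrite /bits trunc_log0.
rewrite /bits -(ltn_exp2l _ _ (isT : 1 < 2)).
by apply: leq_ltn_trans lt_xm; apply: trunc_logP.
Qed.

Lemma leq_bits x y : x <= y -> bits x <= bits y.
Proof. by move=> le_xy; apply: bits_leq => //; apply: leq_ltn_trans (ltn_bits y). Qed.

(** The critical cases are sums and products. For sums, bit lengths are positive and 2^p + 2^q <=
    2^(p+q) for positive p and q. *)
Lemma bits_op o x y : bits (eval_op o x y) <= bits x + bits y.
Proof.
have hM p q : 0 < p -> 0 < q -> 2 ^ p + 2 ^ q <= 2 ^ (p + q).
  move=> p0 q0; rewrite expnD.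
  have := leq_pexp2l (isT : 0 < 2) p0; have := leq_pexp2l (isT : 0 < 2) q0.
  nia.
have hx := ltn_bits x; have hy := ltn_bits y.
have h2 : 2 ^ 1 <= 2 ^ (bits x + bits y) by apply: leq_pexp2l.
have hxy : 2 ^ bits x <= 2 ^ (bits x + bits y) by apply: leq_pexp2l => //; lia.
apply: bits_leq => //; case: o => /=.
- by have := hM _ _ (bits_gt0 x) (bits_gt0 y); lia.
- by lia.
- by rewrite expnD; apply: ltn_mul.
- by have := leq_div x y; lia.
- by have := leq_mod x y; lia.
- by case: (x < y) => //=; lia.
- by case: (x == y) => //=; lia.
Qed.

Fixpoint leaves (e : expr) : nat :=
  match e with
  | Const _ | Reg _ => 1
  | Deref a => leaves a
  | Op _ e1 e2 => leaves e1 + leaves e2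
  end.

(** Memory accesses are excluded because bounds on registers say nothing about the cell that is
    read. *)
Fixpoint small_expr (W : nat) (s : state) (e : expr) : bool :=
  match e with
  | Const x => x <= W
  | Reg r => reg s r <= W
  | Deref _ => false
  | Op _ e1 e2 => small_expr W s e1 && small_expr W s e2
  end.

(** Bit lengths at most add up under an operation, so a subterm with l leaves has a value of at most
    [l * bits W] bits. The charges for all operations then sum to at most the square of this for the
    whole term. *)
Lemma small_expr_cost W s e : small_expr W s e ->
  (bits (eval s e) <= leaves e * bits W) && (cost s e <= leaves e ^ 2 * bits W ^ 2).
Proof.
elim: e => [x|r|//|o e1 IH1 e2 IH2] /=.
- by move=> /leq_bits; have := bits_gt0 W; nia.
- by move=> /leq_bits; have := bits_gt0 W; nia.
case/andP=> /IH1/andP[b1 c1] /IH2/andP[b2 c2]; apply/andP; split.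
  by apply: leq_trans (bits_op _ _ _) _; nia.
have bb : bits (eval s e1) * bits (eval s e2) <=
          (leaves e1 * bits W) * (leaves e2 * bits W) by apply: leq_mul.
nia.
Qed.

Lemma bitsW_sq W : bits W <= bits W ^ 2.
Proof. by have := bits_gt0 W; nia. Qed.

Lemma assign_small W e st : small_expr W st e -> eval st e <= W -> leaves e <= 3 ->
  cost st e + bits (eval st e) <= 10 * bits W ^ 2.
Proof.
move=> /small_expr_cost/andP[_ c] /leq_bits b l3.
have := bitsW_sq W; have : leaves e ^ 2 <= 9 by nia.
nia.
Qed.

End BitLength.

(** The body has to advance the counter itself, as [P j.+1] forces. The test has two leaves bounded
    by W, hence its cost [4 * bits W ^ 2], paid M + 1 times. *)
Lemma exec_loop (i m M W T : nat) body (P : nat -> state -> Prop) :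
  M <= W ->
  (forall j st, j <= M -> P j st -> reg st i = j /\ reg st m = M) ->
  (forall j st, j < M -> P j st ->
     exists t st', [/\ exec body st t st', t <= T & P j.+1 st']) ->
  forall st, P 0 st ->
    exists t st', [/\ exec (While (Op Lt (Reg i) (Reg m)) body) st t st',
      t <= M * (T + 4 * bits W ^ 2) + 4 * bits W ^ 2 & P M st'].
Proof.
move=> leMW Preg Pbody st P0.
have condc j st' : j <= M -> P j st' ->
    cost st' (Op Lt (Reg i) (Reg m)) <= 4 * bits W ^ 2 /\
    eval st' (Op Lt (Reg i) (Reg m)) = (j < M).
  move=> lejM /(Preg _ _ lejM)[ri rm]; split; last by rewrite /= ri rm.
  have /small_expr_cost/andP[_] : small_expr W st' (Op Lt (Reg i) (Reg m)).
    by rewrite /= ri rm leMW (leq_trans lejM leMW).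
  by [].
suff main r j st1 : r + j = M -> P j st1 ->
    exists t st', [/\ exec (While (Op Lt (Reg i) (Reg m)) body) st1 t st',
      t <= r * (T + 4 * bits W ^ 2) + 4 * bits W ^ 2 & P M st'].
  by apply: (main M 0) => //; rewrite addn0.
elim: r j st1 => [|r IH] j st1 rj Pj.
  rewrite add0n in rj; subst j.
  have [c e] := condc _ _ (leqnn _) Pj.
  exists (cost st1 (Op Lt (Reg i) (Reg m))), st1; split=> //.
  by apply: ExecWhileEnd; rewrite e ltnn.
have ltjM : j < M by lia.
have [c e] := condc _ _ (ltnW ltjM) Pj.
have [t1 [st2 [ex1 le1 Pj1]]] := Pbody _ _ ltjM Pj.
have [|t2 [st3 [ex2 le2 PM]]] := IH j.+1 st2 _ Pj1; first by lia.
exists (cost st1 (Op Lt (Reg i) (Reg m)) + t1 + t2), st3; split=> //.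
  by apply: ExecWhile ex1 ex2; rewrite e ltjM.
by rewrite mulSn; lia.
Qed.

(** * A language of array programs whose loop bounds are fixed numbers *)

Section Syntax.

Variable var : Type.

(* The two variables bound by [Fold p e0 f] are the accumulator and the index. *)
Inductive exp : Type :=
| Cst of nat
| Var of var
| Par of nat
| Inp of exp
| Arr of nat & exp & exp & exp
| Bin of binop & exp & exp
| Ite of exp & exp & exp
| Fold of nat & exp & (var -> var -> exp).

Inductive stm : Type :=
| Sto of nat & exp & exp & exp & exp
| Then of stm & stm
| For of nat & (var -> stm).

End Syntax.

Arguments Cst {var}.
Arguments Par {var}.

Definition arrays := nat -> nat -> nat -> nat -> nat.

Definition upd3 (f : nat -> nat -> nat -> nat) i j l x :=
  fun i' j' l' => if [&& i' == i, j' == j & l' == l] then x else f i' j' l'.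

Definition upda (s : arrays) a i j l x : arrays :=
  fun a' => if a' == a then upd3 (s a') i j l x else s a'.

(** Sums and products are reduced at once, so that every value stays below W; the other operations
    cannot leave this range. Subtraction is truncated, and -1 is represented by W - 1. *)
Definition den_op W (o : binop) (x y : nat) : nat :=
  match o with
  | Add => (x + y) %% W
  | Mul => (x * y) %% W
  | _ => eval_op o x y
  end.

Fixpoint den W (par inp : nat -> nat) (e : exp nat) (s : arrays) : nat :=
  match e with
  | Cst c => c
  | Var x => x
  | Par i => par i
  | Inp e => inp (den W par inp e s)
  | Arr a i j l =>
      s a (den W par inp i s) (den W par inp j s) (den W par inp l s)
  | Bin o e1 e2 => den_op W o (den W par inp e1 s) (den W par inp e2 s)
  | Ite c e1 e2 =>
      if den W par inp c s != 0 then den W par inp e1 s else den W par inp e2 s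
  | Fold p e0 f =>
      foldl (fun acc i => den W par inp (f acc i) s) (den W par inp e0 s) (iota 0 (par p))
  end.

Fixpoint run W (par inp : nat -> nat) (p : stm nat) (s : arrays) : arrays :=
  match p with
  | Sto a i j l e => upda s a (den W par inp i s) (den W par inp j s)
      (den W par inp l s) (den W par inp e s)
  | Then p q => run W par inp q (run W par inp p s)
  | For b f => foldl (fun s i => run W par inp (f i) s) s (iota 0 (par b))
  end.

Section Steps.

Variable par : nat -> nat.

(** Bodies of loops are measured at the dummy arguments 0. The programs are polymorphic in the type
    of variables, so the count cannot depend on the arguments; [wfe_steps] proves this for related
    instances. The extra summands pay for tests and counters. *)
Fixpoint steps_exp (e : exp nat) : nat :=
  match e with
  | Cst _ | Var _ | Par _ => 1
  | Inp e => (steps_exp e).+1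
  | Arr _ i j l => (steps_exp i + steps_exp j + steps_exp l).+1
  | Bin _ e1 e2 => (steps_exp e1 + steps_exp e2).+1
  | Ite c e1 e2 => (steps_exp c + steps_exp e1 + steps_exp e2).+2
  | Fold p e0 f => (steps_exp e0 + par p * (steps_exp (f 0 0)).+3).+2
  end.

Fixpoint steps (p : stm nat) : nat :=
  match p with
  | Sto _ i j l e =>
      (steps_exp i + steps_exp j + steps_exp l + steps_exp e).+1
  | Then p q => steps p + steps q
  | For b f => (par b * (steps (f 0)).+2).+2
  end.

End Steps.

(** * Compilation to the machine *)

(* Register 0 holds the output and register [i.+1] the number [par i]; among
   these, [par 0] is the modulus and [par 1] the first address behind the
   input.  Variables live in registers from 17 on. *)
Definition rparam := 16.
Definition narr := 32.

Section Compile.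

Definition wexpr o x y :=
  match o with
  | Add => Op Mod (Op Add (Reg x) (Reg y)) (Reg 1)
  | Mul => Op Mod (Op Mul (Reg x) (Reg y)) (Reg 1)
  | _ => Op o (Reg x) (Reg y)
  end.

Definition addr_expr a (i j l : expr) :=
  Op Add (Reg 2) (Op Add (Const a) (Op Mul (Const narr)
    (Op Add i (Op Mul (Reg 1) (Op Add j (Op Mul (Reg 1) l)))))).

(** The arrays are interleaved behind the input, with the four indices as digits in mixed radix. The
    layout is sparse, but only the length of an address is charged, and it stays within
    [8 * bits W]. *)
Definition addr base W a i j l := base + (a + narr * (i + W * (j + W * l))).

(** Register r receives the value and only registers from r on are overwritten, as on a stack. Both
    branches of a conditional are evaluated, so that one bound serves for both outcomes. An access
    behind the input is multiplied by 0, because the arrays live there. *)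
Fixpoint comp_exp (r : nat) (e : exp nat) : cmd :=
  match e with
  | Cst c => Assign r (Const c)
  | Var x => Assign r (Reg x)
  | Par i => Assign r (Reg i.+1)
  | Inp e =>
      Seq (comp_exp r e)
          (Assign r (Op Mul (Op Lt (Reg r) (Reg 2)) (Deref (Reg r))))
  | Arr a i j l =>
      Seq (comp_exp r i) (Seq (comp_exp r.+1 j) (Seq (comp_exp r.+2 l)
        (Assign r (Deref (addr_expr a (Reg r) (Reg r.+1) (Reg r.+2))))))
  | Bin o e1 e2 =>
      Seq (comp_exp r e1) (Seq (comp_exp r.+1 e2) (Assign r (wexpr o r r.+1)))
  | Ite c e1 e2 =>
      Seq (comp_exp r c) (Seq (comp_exp r.+1 e1) (Seq (comp_exp r.+2 e2)
        (If (Reg r) (Assign r (Reg r.+1)) (Assign r (Reg r.+2)))))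
  | Fold p e0 f =>
      Seq (comp_exp r e0) (Seq (Assign r.+1 (Const 0))
        (While (Op Lt (Reg r.+1) (Reg p.+1))
          (Seq (comp_exp r.+2 (f r r.+1)) (Seq (Assign r (Reg r.+2))
            (Assign r.+1 (Op Add (Reg r.+1) (Const 1)))))))
  end.

Fixpoint comp (r : nat) (p : stm nat) : cmd :=
  match p with
  | Sto a i j l e =>
      Seq (comp_exp r i) (Seq (comp_exp r.+1 j) (Seq (comp_exp r.+2 l)
        (Seq (comp_exp r.+3 e)
          (Store (addr_expr a (Reg r) (Reg r.+1) (Reg r.+2)) (Reg r.+3)))))
  | Then p q => Seq (comp r p) (comp r q)
  | For b f =>
      Seq (Assign r (Const 0))
        (While (Op Lt (Reg r) (Reg b.+1))
          (Seq (comp r.+1 (f r)) (Assign r (Op Add (Reg r) (Const 1)))))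
  end.

Definition var_ctx := seq (nat * nat).

(* Two instances of the same higher-order term, one over registers and one
   over values; the context pairs the register and the value of a variable. *)
Inductive wfe : var_ctx -> exp nat -> exp nat -> Prop :=
| WfCst G c : c < narr -> wfe G (Cst c) (Cst c)
| WfVar G r v : List.In (r, v) G -> wfe G (Var r) (Var v)
| WfPar G i : 1 < i < rparam -> wfe G (Par i) (Par i)
| WfInp G e1 e2 : wfe G e1 e2 -> wfe G (Inp e1) (Inp e2)
| WfArr G a i1 i2 j1 j2 l1 l2 : a < narr -> wfe G i1 i2 -> wfe G j1 j2 ->
    wfe G l1 l2 -> wfe G (Arr a i1 j1 l1) (Arr a i2 j2 l2)
| WfBin G o e1 e2 f1 f2 : wfe G e1 e2 -> wfe G f1 f2 ->
    wfe G (Bin o e1 f1) (Bin o e2 f2)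
| WfIte G c1 c2 e1 e2 f1 f2 : wfe G c1 c2 -> wfe G e1 e2 -> wfe G f1 f2 ->
    wfe G (Ite c1 e1 f1) (Ite c2 e2 f2)
| WfFold G p e1 e2 f1 f2 : 1 < p < rparam -> wfe G e1 e2 ->
    (forall r v r' v', wfe [:: (r, v), (r', v') & G] (f1 r r') (f2 v v')) ->
    wfe G (Fold p e1 f1) (Fold p e2 f2).

Inductive wf : var_ctx -> stm nat -> stm nat -> Prop :=
| WfSto G a i1 i2 j1 j2 l1 l2 e1 e2 : a < narr -> wfe G i1 i2 -> wfe G j1 j2 ->
    wfe G l1 l2 -> wfe G e1 e2 -> wf G (Sto a i1 j1 l1 e1) (Sto a i2 j2 l2 e2)
| WfThen G p1 p2 q1 q2 : wf G p1 p2 -> wf G q1 q2 ->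
    wf G (Then p1 q1) (Then p2 q2)
| WfFor G b f1 f2 : 1 < b < rparam ->
    (forall r v, wf ((r, v) :: G) (f1 r) (f2 v)) -> wf G (For b f1) (For b f2).

Variables (W base : nat) (par inp : nat -> nat).
Hypotheses (par0 : par 0 = W) (par1 : par 1 = base).
Hypothesis parW : forall i, 1 < i < rparam -> par i < W.
Hypothesis inpW : forall i, inp i < W.
Hypothesis inp_out : forall i, base <= i -> inp i = 0.
Hypotheses (W_ge : narr <= W) (base_le : base <= W).

Definition bounded (s : arrays) :=
  forall a i j l, a < narr -> i < W -> j < W -> l < W -> s a i j l < W.

Definition agree (s : arrays) (st : state) :=
  [/\ forall i, i < rparam -> reg st i.+1 = par i,
      forall i, i < base -> mem st i = inp i
    & forall a i j l, a < narr -> i < W -> j < W -> l < W ->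
        mem st (addr base W a i j l) = s a i j l].

Lemma wfe_steps G e1 e2 : wfe G e1 e2 -> steps_exp par e1 = steps_exp par e2.
Proof.
elim=> //= {G e1 e2}.
- by move=> G e1 e2 _ ->.
- by move=> G a i1 i2 j1 j2 l1 l2 _ _ -> _ -> _ ->.
- by move=> G o e1 e2 f1 f2 _ -> _ ->.
- by move=> G c1 c2 e1 e2 f1 f2 _ -> _ -> _ ->.
- by move=> G p e1 e2 f1 f2 _ _ -> _ IH; rewrite (IH 0 0 0 0).
Qed.

Lemma wf_steps G p q : wf G p q -> steps par p = steps par q.
Proof.
elim=> //= {G p q}.
- move=> G a i1 i2 j1 j2 l1 l2 e1 e2 _ w1 w2 w3 w4.
  by rewrite (wfe_steps w1) (wfe_steps w2) (wfe_steps w3) (wfe_steps w4).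
- by move=> G p1 p2 q1 q2 _ -> _ ->.
- by move=> G b f1 f2 _ _ IH; rewrite (IH 0 0).
Qed.

(** The dearest elementary step is an array access: the address expression has 8 leaves and costs up
    to [64 * bits W ^ 2]. The constant 100 leaves room for the access itself. *)
Definition unit_cost := 100 * bits W ^ 2.

(** Digits in mixed radix are unique, so stores to distinct cells do not interfere. *)
Lemma addr_inj a i j l a' i' j' l' : a < narr -> i < W -> j < W ->
  a' < narr -> i' < W -> j' < W ->
  addr base W a i j l = addr base W a' i' j' l' ->
  [/\ a = a', i = i', j = j' & l = l'].
Proof.
move=> ha hi hj ha' hi' hj' /addnI eqa.
have split0 m x y x' y' : x < m -> x' < m -> x + m * y = x' + m * y' ->
    x = x' /\ y = y'.
  move=> hx hx' E.
  have ex : x = x'.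
    by rewrite -(modn_small hx) -(modn_small hx') -(modnMDl y) -(modnMDl y' x')
      ![_ * m]mulnC ![_ * _ + _]addnC E.
  split=> //; apply/eqP; rewrite -(eqn_pmul2l (leq_ltn_trans (leq0n _) hx)).
  by apply/eqP; move: E; rewrite ex => /addnI.
have [-> E1] := split0 _ _ _ _ _ ha ha' eqa.
have [-> E2] := split0 _ _ _ _ _ hi hi' E1.
by have [-> ->] := split0 _ _ _ _ _ hj hj' E2.
Qed.

Lemma addr_expr_cost st a i j l : a < narr -> reg st 1 = W -> reg st 2 = base ->
  reg st i < W -> reg st j < W -> reg st l < W ->
  let e := addr_expr a (Reg i) (Reg j) (Reg l) in
  [/\ eval st e = addr base W a (reg st i) (reg st j) (reg st l),
      bits (eval st e) <= 8 * bits W & cost st e <= 64 * bits W ^ 2].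
Proof.
move=> ha r1 r2 hi hj hl e.
have /small_expr_cost/andP[] : small_expr W st e.
  by rewrite /= r1 r2 base_le leqnn (ltnW hi) (ltnW hj) (ltnW hl) W_ge (ltnW (leq_trans ha W_ge)).
by move=> b c; split=> //; rewrite /= r1 r2.
Qed.

Definition keeps r (st st' : state) :=
  (forall x, x < r -> reg st' x = reg st x) /\ mem st' = mem st.

Lemma keeps_trans r r' st1 st2 st3 : r <= r' ->
  keeps r st1 st2 -> keeps r' st2 st3 -> keeps r st1 st3.
Proof.
move=> le_rr' [k1 m1] [k2 m2]; split; last by rewrite m2.
by move=> x ltx; rewrite k2 ?k1 //; apply: leq_trans le_rr'.
Qed.

Lemma keeps_weak r r' st1 st2 : r' <= r -> keeps r st1 st2 -> keeps r' st1 st2.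
Proof. by move=> le [k m]; split=> // x ltx; apply: k; apply: leq_trans le. Qed.

Lemma keeps_assign r r' st v : r <= r' ->
  keeps r st (State (upd (reg st) r' v) (mem st)).
Proof. by move=> le_rr'; split=> //= x ltx; rewrite /upd ifN //; lia. Qed.

Lemma agree_keeps r s st st' : rparam < r -> keeps r st st' -> agree s st -> agree s st'.
Proof.
move=> lt_r [k m] [h1 h2 h3]; split=> [i lti||]; rewrite ?m //.
by rewrite k ?h1 //; rewrite /rparam in lti lt_r *; lia.
Qed.

Definition ctx_ok (G : var_ctx) r (st : state) :=
  forall x v, List.In (x, v) G -> [/\ x < r, reg st x = v & v < W].

Lemma ctx_keeps G r r' st st' : r <= r' -> keeps r st st' -> ctx_ok G r st ->
  ctx_ok G r' st'.
Proof.
move=> le_rr' [k _] hG x v /hG [ltx e ltv]; split=> //; last by rewrite k.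
exact: leq_trans le_rr'.
Qed.

Lemma ctx_cons G r r' st v : r < r' -> reg st r = v -> v < W -> ctx_ok G r' st ->
  ctx_ok ((r, v) :: G) r' st.
Proof. by move=> ltr e ltv hG x w /= [[<- <-]|/hG]. Qed.

Lemma wexpr_cost o st x y vx vy : reg st 1 = W -> reg st x = vx -> reg st y = vy ->
  vx < W -> vy < W ->
  [/\ eval st (wexpr o x y) = den_op W o vx vy, den_op W o vx vy < W
    & cost st (wexpr o x y) + bits (den_op W o vx vy) <= unit_cost].
Proof.
move=> r1 rx ry ltx lty.
have W0 : 1 < W by apply: leq_trans W_ge.
have ev : eval st (wexpr o x y) = den_op W o vx vy.
  by case: o => /=; rewrite ?r1 rx ry.
have ltd : den_op W o vx vy < W.
  have hd := leq_div vx vy; have hm := leq_mod vx vy.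
  have hb (b : bool) : b < W by case: b; rewrite ?(ltnW W0).
  by case: (o) => /=; rewrite ?ltn_mod ?hb; lia.
split=> //.
have sm : small_expr W st (wexpr o x y).
  by case: o {ev ltd} => /=; rewrite ?r1 rx ry (ltnW ltx) (ltnW lty) //= leqnn.
have l3 : leaves (wexpr o x y) <= 3 by case: (o).
have := assign_small sm _ l3; rewrite ev => /(_ (ltnW ltd)).
by rewrite /unit_cost; lia.
Qed.

(** Induction on the relation between the register instance and the value instance. Subterms are
    evaluated into successive registers above those the context refers to, so that earlier values
    survive. *)
Lemma comp_expP G er ev : wfe G er ev -> forall r s st,
  rparam < r -> ctx_ok G r st -> agree s st -> bounded s ->
  exists t st', [/\ exec (comp_exp r er) st t st',
    t <= steps_exp par ev * unit_cost, reg st' r = den W par inp ev s,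
    den W par inp ev s < W & keeps r st st'].
Proof.
have bW := bitsW_sq W.
have assignP r e v st : small_expr W st e -> eval st e = v -> v <= W ->
    leaves e <= 3 ->
    exists t st', [/\ exec (Assign r e) st t st', t <= unit_cost, reg st' r = v &
      keeps r st st' /\ forall x, x != r -> reg st' x = reg st x].
  move=> sm eev lev l3; exists (cost st e + bits (eval st e)).
  exists (State (upd (reg st) r v) (mem st)); split.
  - by rewrite -eev; apply: ExecAssign.
  - by have := assign_small sm _ l3; rewrite eev => /(_ lev); rewrite /unit_cost; lia.
  - by rewrite /= /upd eqxx.
  - by split; [apply: keeps_assign | move=> x xr; rewrite /= /upd (negPf xr)].
elim=> {G er ev} [G c ltc|G x v xG|G i hi|G e1 e2 w IH|G a i1 i2 j1 j2 l1 l2 lta wi IHi wj IHj wl IHl|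
  G o e1 e2 f1 f2 we IHe w2 IHf|G c1 c2 e1 e2 f1 f2 wc IHc we IHe wf IHf|
  G p e1 e2 f1 f2 hp we IHe wf IHf] r s st lt_r hG ag bd /=.
- have [|//||//|t [st' [ex tc rv [kp _]]]] := assignP r (Const c) c st.
  + by rewrite /=; apply: leq_trans (ltnW ltc) W_ge.
  + by apply: leq_trans (ltnW ltc) W_ge.
  exists t, st'; split=> //; first by lia.
  exact: leq_trans ltc W_ge.
- have [xr rx ltv] := hG _ _ xG.
  have [||||t [st' [ex tc rv [kp _]]]] := assignP r (Reg x) v st => //=; try by rewrite rx ltnW.
    by rewrite ltnW.
  by exists t, st'; split=> //; lia.
- have [h1 _ _] := ag; have /andP[i1 i2] := hi.
  have ltv := parW hi.
  have [||||t [st' [ex tc rv [kp _]]]] := assignP r (Reg i.+1) (par i) st => //=.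
  + by rewrite h1 // ltnW.
  + by rewrite h1.
  + by rewrite ltnW.
  by exists t, st'; split=> //; lia.
- have [t1 [st1 [ex1 tc1 rv1 ltv1 kp1]]] := IH r s st lt_r hG ag bd.
  set x := den W par inp e2 s in rv1 ltv1 *.
  have [h1 h2 h3] := agree_keeps lt_r kp1 ag.
  have r2 : reg st1 2 = base by rewrite h1 // par1.
  (* A masked access is still charged for the cell it reads. Behind the input this is an array cell,
     found by dividing the offset by [narr], and its content is below W. *)
  have memW : mem st1 x < W.
    case: (ltnP x base) => [ltx|lex]; first by rewrite h2.
    have W0 : 0 < W by apply: leq_trans W_ge.
    have -> : x = addr base W ((x - base) %% narr) ((x - base) %/ narr) 0 0.
      rewrite /addr !muln0 !addn0 [narr * _]mulnC addnC [_ %% _ + _]addnC.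
      by rewrite -divn_eq; lia.
    have ltq : (x - base) %/ narr < W.
      by apply: leq_ltn_trans (leq_div _ _) _; apply: leq_ltn_trans ltv1; apply: leq_subr.
    by rewrite h3 ?ltn_mod //; apply: bd; rewrite ?ltn_mod.
  set e := Op Mul _ _.
  have ee : eval st1 e = inp x.
    rewrite /= rv1 -/x r2; case: (ltnP x base) => [ltx|lex]; first by rewrite h2 // mul1n.
    by rewrite mul0n inp_out.
  exists (t1 + (cost st1 e + bits (eval st1 e))), (State (upd (reg st1) r (inp x)) (mem st1)).
  split=> //.
  + by apply: ExecSeq ex1 _; rewrite -ee; apply: ExecAssign.
  + rewrite mulSn; suff: cost st1 e + bits (eval st1 e) <= unit_cost by lia.
    rewrite ee /= rv1 -/x r2.
    have b1 := leq_bits (ltnW ltv1); have b2 := leq_bits base_le.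
    have b3 := leq_bits (ltnW memW); have b4 := leq_bits (ltnW (inpW x)).
    have b5 : bits (x < base) <= 1 by case: (_ < _).
    rewrite -/x in b1; rewrite /unit_cost.
    have : bits x * bits base <= bits W * bits W by apply: leq_mul.
    have : bits (x < base) * bits (mem st1 x) <= 1 * bits W by apply: leq_mul.
    nia.
  + by rewrite /= /upd eqxx.
  + exact: keeps_trans (leqnn r) kp1 (keeps_assign _ _ (leqnn r)).
- have [t1 [st1 [ex1 tc1 rv1 ltv1 kp1]]] := IHi r s st lt_r hG ag bd.
  have ag1 := agree_keeps lt_r kp1 ag.
  have [|t2 [st2 [ex2 tc2 rv2 ltv2 kp2]]] := IHj r.+1 s st1 (ltnW lt_r) _ ag1 bd.
    by apply: ctx_keeps kp1 hG.
  have kp12 := keeps_trans (leqnSn r) kp1 kp2.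
  have ag2 := agree_keeps lt_r kp12 ag.
  have [|t3 [st3 [ex3 tc3 rv3 ltv3 kp3]]] := IHl r.+2 s st2 (ltnW (ltnW lt_r)) _ ag2 bd.
    by apply: ctx_keeps kp12 hG; lia.
  have kp13 := keeps_trans (leqW (leqnSn r)) kp12 kp3.
  have [h1 h2 h3] := agree_keeps lt_r kp13 ag.
  have q1 : reg st3 r = den W par inp i2 s.
    by rewrite (proj1 kp3) ?(proj1 kp2) //; lia.
  have q2 : reg st3 r.+1 = den W par inp j2 s by rewrite (proj1 kp3).
  have [ea ba ca] := @addr_expr_cost st3 a r r.+1 r.+2 lta (etrans (h1 0 isT) par0)
     (etrans (h1 1 isT) par1) (eq_ind_r (fun z => z < W) ltv1 q1) (eq_ind_r (fun z => z < W) ltv2 q2)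
     (eq_ind_r (fun z => z < W) ltv3 rv3).
  set e := Deref _.
  have ee : eval st3 e = s a (den W par inp i2 s) (den W par inp j2 s) (den W par inp l2 s).
    have -> : eval st3 e = mem st3 (eval st3 (addr_expr a (Reg r) (Reg r.+1) (Reg r.+2))) by [].
    by rewrite ea q1 q2 rv3 h3.
  have ltw := bd _ _ _ _ lta ltv1 ltv2 ltv3.
  exists (t1 + (t2 + (t3 + (cost st3 e + bits (eval st3 e))))).
  exists (State (upd (reg st3) r (eval st3 e)) (mem st3)); split.
  + by apply: ExecSeq ex1 _; apply: ExecSeq ex2 _; apply: ExecSeq ex3 _; apply: ExecAssign.
  + have : cost st3 e + bits (eval st3 e) <= unit_cost.
      have -> : cost st3 e = cost st3 (addr_expr a (Reg r) (Reg r.+1) (Reg r.+2)) +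
         bits (eval st3 (addr_expr a (Reg r) (Reg r.+1) (Reg r.+2))) + bits (eval st3 e) by [].
      by have := leq_bits (ltnW ltw); rewrite -ee /unit_cost; lia.
    by rewrite mulSn !mulnDl; lia.
  + by rewrite /= /upd eqxx.
  + by [].
  + exact: keeps_trans (leqnn r) kp13 (keeps_assign _ _ (leqnn r)).
- have [t1 [st1 [ex1 tc1 rv1 ltv1 kp1]]] := IHe r s st lt_r hG ag bd.
  have ag1 := agree_keeps lt_r kp1 ag.
  have [|t2 [st2 [ex2 tc2 rv2 ltv2 kp2]]] := IHf r.+1 s st1 (ltnW lt_r) _ ag1 bd.
    by apply: ctx_keeps kp1 hG.
  have kp12 := keeps_trans (leqnSn r) kp1 kp2.
  have [h1 _ _] := agree_keeps lt_r kp12 ag.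
  have q1 : reg st2 r = den W par inp e2 s by rewrite (proj1 kp2).
  have [ew ltw cw] := wexpr_cost o (etrans (h1 0 isT) par0) q1 rv2 ltv1 ltv2.
  exists (t1 + (t2 + (cost st2 (wexpr o r r.+1) + bits (eval st2 (wexpr o r r.+1))))).
  exists (State (upd (reg st2) r (eval st2 (wexpr o r r.+1))) (mem st2)); split=> //.
  + by apply: ExecSeq ex1 _; apply: ExecSeq ex2 _; apply: ExecAssign.
  + by rewrite ew mulSn !mulnDl; lia.
  + by rewrite /= /upd eqxx.
  + exact: keeps_trans (leqnn r) kp12 (keeps_assign _ _ (leqnn r)).
- have [t1 [st1 [ex1 tc1 rv1 ltv1 kp1]]] := IHc r s st lt_r hG ag bd.
  have ag1 := agree_keeps lt_r kp1 ag.
  have [|t2 [st2 [ex2 tc2 rv2 ltv2 kp2]]] := IHe r.+1 s st1 (ltnW lt_r) _ ag1 bd.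
    by apply: ctx_keeps kp1 hG.
  have kp12 := keeps_trans (leqnSn r) kp1 kp2.
  have ag2 := agree_keeps lt_r kp12 ag.
  have [|t3 [st3 [ex3 tc3 rv3 ltv3 kp3]]] := IHf r.+2 s st2 (ltnW (ltnW lt_r)) _ ag2 bd.
    by apply: ctx_keeps kp12 hG; lia.
  have kp13 := keeps_trans (leqW (leqnSn r)) kp12 kp3.
  have q1 : reg st3 r = den W par inp c2 s.
    by rewrite (proj1 kp3) ?(proj1 kp2) //; lia.
  have q2 : reg st3 r.+1 = den W par inp e2 s by rewrite (proj1 kp3).
  set v := if _ then _ else _.
  have ltv : v < W by rewrite /v; case: ifP.
  have [t4 [st4 [ex4 tc4 rv4 kp4]]] : exists t st', [/\ exec (if eval st3 (Reg r) != 0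
      then Assign r (Reg r.+1) else Assign r (Reg r.+2)) st3 t st', t <= unit_cost,
      reg st' r = v & keeps r st3 st'].
    have -> : eval st3 (Reg r) = den W par inp c2 s by [].
    rewrite /v; case: (den W par inp c2 s != 0).
      have [|||//|t [st' [? ? ? [? _]]]] :=
        assignP r (Reg r.+1) (den W par inp e2 s) st3; last by exists t, st'.
      + by rewrite /= q2 ltnW.
      + exact: q2.
      + exact: ltnW.
    have [|||//|t [st' [? ? ? [? _]]]] :=
      assignP r (Reg r.+2) (den W par inp f2 s) st3; last by exists t, st'.
    + by rewrite /= rv3 ltnW.
    + exact: rv3.
    + exact: ltnW.
  exists (t1 + (t2 + (t3 + (cost st3 (Reg r) + t4)))), st4; split=> //.
  + by apply: ExecSeq ex1 _; apply: ExecSeq ex2 _; apply: ExecSeq ex3 _; apply: ExecIf.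
  + have : cost st3 (Reg r) <= unit_cost.
      by rewrite /= q1 /unit_cost; have := leq_bits (ltnW ltv1); lia.
    by rewrite !mulSn !mulnDl; lia.
  + exact: keeps_trans (leqnn r) kp13 kp4.
have [t1 [st1 [ex1 tc1 rv1 ltv1 kp1]]] := IHe r s st lt_r hG ag bd.
have ag1 := agree_keeps lt_r kp1 ag.
have [||||t2 [st2 [ex2 tc2 rv2 [kp2 kx2]]]] := assignP r.+1 (Const 0) 0 st1 => //.
have kp12 := keeps_trans (leqnSn r) kp1 kp2.
(* Every instance of the body has the step count of the dummy instance, since both agree with one
   register instance. *)
have hb (r' v r'' v' : nat) : steps_exp par (f2 v v') = steps_exp par (f2 0 0).
  by rewrite -(wfe_steps (wf r' v r'' v')) -(wfe_steps (wf r' 0 r'' 0)).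
pose F acc i := den W par inp (f2 acc i) s.
pose P j st' := [/\ reg st' r = foldl F (den W par inp e2 s) (iota 0 j),
  foldl F (den W par inp e2 s) (iota 0 j) < W, reg st' r.+1 = j & keeps r st st'].
have ltpW := parW hp; have /andP[p1 p2] := hp.
have [|||t3 [st3 [ex3 tc3 [P1 P2 P3 P4]]]] := @exec_loop r.+1 p.+1 (par p) W
  ((steps_exp par (f2 0 0)).+2 * unit_cost)
  (Seq (comp_exp r.+2 (f1 r r.+1)) (Seq (Assign r (Reg r.+2))
            (Assign r.+1 (Op Add (Reg r.+1) (Const 1))))) P (ltnW ltpW) _ _ st2.
- move=> j st' lej [P1 P2 P3 P4]; split=> //.
  by have [h1 _ _] := agree_keeps lt_r P4 ag; rewrite h1.
- move=> j st' ltj [P1 P2 P3 P4].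
  have ag' := agree_keeps lt_r P4 ag.
  have [|t4 [st4 [ex4 tc4 rv4 ltv4 kp4]]] := IHf r (foldl F (den W par inp e2 s) (iota 0 j)) r.+1 j
    r.+2 s st' (ltnW (ltnW lt_r)) _ ag' bd.
    apply: ctx_cons => //; apply: ctx_cons => //; first by apply: ltn_trans ltpW.
    by apply: ctx_keeps P4 hG; lia.
  have [|//|t5 [st5 [ex5 tc5 rv5 [kp5 kx5]]]] :=
    assignP r (Reg r.+2) _ st4 _ rv4 (ltnW ltv4).
    by rewrite /= rv4 ltnW.
  have r51 : reg st5 r.+1 = j by rewrite kx5 ?(proj1 kp4) //; lia.
  have ltjW : j < W by apply: ltn_trans ltpW.
  have [|||//|t6 [st6 [ex6 tc6 rv6 [kp6 kx6]]]] :=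
    assignP r.+1 (Op Add (Reg r.+1) (Const 1)) j.+1 st5.
  + by rewrite /= r51 ltnW //=; apply: leq_trans W_ge.
  + by rewrite /= r51 addn1.
  + exact: ltjW.
  exists (t4 + (t5 + t6)), st6; split.
  + by apply: ExecSeq ex4 _; apply: ExecSeq ex5 _.
  + by move: tc4; rewrite (hb 0 _ 0) !mulSn; lia.
  have ei : iota 0 j.+1 = rcons (iota 0 j) j by rewrite -cats1 -addn1 iotaD.
  split=> //; rewrite ?ei ?foldl_rcons //.
    by rewrite (proj1 kp6) // rv5.
  apply: keeps_trans (leqnn r) P4 _.
  apply: keeps_trans (leqnn r) (keeps_weak (leqW (leqnSn r)) kp4) _.
  exact: keeps_trans (leqnSn r) kp5 kp6.
- by split=> //=; rewrite ?rv2 // (proj1 kp2) // rv1.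
exists (t1 + (t2 + t3)), st3; split=> //.
- by apply: ExecSeq ex1 _; apply: ExecSeq ex2 _.
have : 4 * bits W ^ 2 <= unit_cost by rewrite /unit_cost; lia.
move: tc3; set a := steps_exp par (f2 0 0); set U := unit_cost; move=> tc3 u4.
have : par p * (a.+2 * U + 4 * bits W ^ 2) <= par p * (a.+3 * U).
  by rewrite leq_mul2l [a.+3 * _]mulSn addnC leq_add2r u4 orbT.
by rewrite !mulSn mulnDl -mulnA; lia.
Qed.

Lemma agree_store s st a i j l v : a < narr -> i < W -> j < W -> l < W ->
  agree s st ->
  agree (upda s a i j l v) (State (reg st) (upd (mem st) (addr base W a i j l) v)).
Proof.
move=> lta lti ltj ltl [h1 h2 h3]; split=> //= [x ltx|a' i' j' l' lta' lti' ltj' ltl'].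
  by rewrite /upd ifN ?h2 // /addr; lia.
rewrite /upd /upda /upd3; case: eqVneq => [E|NE].
  by have [-> -> -> ->] := addr_inj lta' lti' ltj' lta lti ltj E; rewrite !eqxx.
rewrite h3 //; case: eqP => // ea; case: ifP => // /and3P[/eqP ei /eqP ej /eqP el].
by rewrite ea ei ej el eqxx in NE.
Qed.

Lemma bounded_upda s a i j l v : v < W -> bounded s -> bounded (upda s a i j l v).
Proof.
move=> ltv bd a' i' j' l' ? ? ? ?; rewrite /upda /upd3.
by case: (_ == a); [case: ifP => // _|]; apply: bd.
Qed.

Lemma compP G pr pv : wf G pr pv -> forall r s st,
  rparam < r -> ctx_ok G r st -> agree s st -> bounded s ->
  exists t st', [/\ exec (comp r pr) st t st', t <= steps par pv * unit_cost,
    forall x, x < r -> reg st' x = reg st x,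
    agree (run W par inp pv s) st' & bounded (run W par inp pv s)].
Proof.
elim=> {G pr pv} [G a i1 i2 j1 j2 l1 l2 e1 e2 lta wi wj wl we|
  G p1 p2 q1 q2 wp IHp wq IHq|G b f1 f2 hb wf IHf] r s st lt_r hG ag bd /=.
- have [t1 [st1 [ex1 tc1 rv1 ltv1 kp1]]] := comp_expP wi lt_r hG ag bd.
  have ag1 := agree_keeps lt_r kp1 ag.
  have [t2 [st2 [ex2 tc2 rv2 ltv2 kp2]]] := comp_expP wj (leqW lt_r)
    (ctx_keeps (leqnSn r) kp1 hG) ag1 bd.
  have kp12 := keeps_trans (leqnSn r) kp1 kp2.
  have ag2 := agree_keeps lt_r kp12 ag.
  have [t3 [st3 [ex3 tc3 rv3 ltv3 kp3]]] := comp_expP wl (leqW (leqW lt_r))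
    (ctx_keeps (leqW (leqnSn r)) kp12 hG) ag2 bd.
  have kp13 := keeps_trans (leqW (leqnSn r)) kp12 kp3.
  have ag3 := agree_keeps lt_r kp13 ag.
  have [t4 [st4 [ex4 tc4 rv4 ltv4 kp4]]] := comp_expP we (leqW (leqW (leqW lt_r)))
    (ctx_keeps (leqW (leqW (leqnSn r))) kp13 hG) ag3 bd.
  have kp14 := keeps_trans (leqW (leqW (leqnSn r))) kp13 kp4.
  have ag4 := agree_keeps lt_r kp14 ag; have [h1 h2 h3] := ag4.
  have q1 : reg st4 r = den W par inp i2 s.
    by rewrite (proj1 kp4) ?(proj1 kp3) ?(proj1 kp2) //; lia.
  have q2 : reg st4 r.+1 = den W par inp j2 s.
    by rewrite (proj1 kp4) ?(proj1 kp3) //; lia.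
  have q3 : reg st4 r.+2 = den W par inp l2 s by rewrite (proj1 kp4).
  have [ea ba ca] := @addr_expr_cost st4 a r r.+1 r.+2 lta (etrans (h1 0 isT) par0)
     (etrans (h1 1 isT) par1) (eq_ind_r (fun z => z < W) ltv1 q1)
     (eq_ind_r (fun z => z < W) ltv2 q2) (eq_ind_r (fun z => z < W) ltv3 q3).
  set e := addr_expr _ _ _ _ in ea ba ca *.
  exists (t1 + (t2 + (t3 + (t4 +
    (cost st4 e + cost st4 (Reg r.+3) + bits (eval st4 e) + bits (eval st4 (Reg r.+3))))))).
  exists (State (reg st4) (upd (mem st4) (eval st4 e) (eval st4 (Reg r.+3)))).
  split.
  + by apply: ExecSeq ex1 _; apply: ExecSeq ex2 _; apply: ExecSeq ex3 _;
      apply: ExecSeq ex4 _; apply: ExecStore.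
  + have bW := bitsW_sq W.
    have : cost st4 e + cost st4 (Reg r.+3) + bits (eval st4 e) + bits (eval st4 (Reg r.+3))
        <= unit_cost.
      by rewrite [cost _ (Reg _)]/= [eval st4 (Reg _)]/= rv4 /unit_cost;
        have := leq_bits (ltnW ltv4); lia.
    by rewrite mulSn !mulnDl; lia.
  + by move=> x ltx /=; rewrite (proj1 kp14).
  + by rewrite ea q1 q2 q3 /= rv4; apply: agree_store.
  + exact: bounded_upda.
- have [t1 [st1 [ex1 tc1 k1 ag1 bd1]]] := IHp r s st lt_r hG ag bd.
  have [|t2 [st2 [ex2 tc2 k2 ag2 bd2]]] := IHq r _ st1 lt_r _ ag1 bd1.
    by move=> x v /hG[h1 h2 h3]; split=> //; rewrite k1.
  exists (t1 + t2), st2; split=> //; [exact: ExecSeq ex2 | by rewrite mulnDl; lia |].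
  by move=> x ltx; rewrite k2 ?k1.
have bW := bitsW_sq W.
pose F s' i := run W par inp (f2 i) s'.
pose st1 := State (upd (reg st) r 0) (mem st).
have kp1 : keeps r st st1 by apply: keeps_assign.
have fb v : steps par (f2 v) = steps par (f2 0).
  by rewrite -(wf_steps (wf 0 v)) -(wf_steps (wf 0 0)).
pose P j st' := [/\ forall x, x < r -> reg st' x = reg st x, reg st' r = j,
  agree (foldl F s (iota 0 j)) st' & bounded (foldl F s (iota 0 j))].
have ltbW := parW hb; have /andP[b1 b2] := hb.
have [|||t3 [st3 [ex3 tc3 [P1 P2 P3 P4]]]] := @exec_loop r b.+1 (par b) W
  ((steps par (f2 0)).+1 * unit_cost)
  (Seq (comp r.+1 (f1 r)) (Assign r (Op Add (Reg r) (Const 1)))) P (ltnW ltbW) _ _ st1.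
- by move=> j st' lej [P1 P2 [h1 _ _] P4]; rewrite h1.
- move=> j st' ltj [P1 P2 P3 P4].
  have ltjW := ltn_trans ltj ltbW.
  have [|t4 [st4 [ex4 tc4 k4 ag4 bd4]]] := IHf r j r.+1 _ st' (ltnW lt_r) _ P3 P4.
    apply: ctx_cons => // x v /hG[h1 h2 h3]; split=> //; first exact: ltnW.
    by rewrite P1.
  have r4 : reg st4 r = j by rewrite k4.
  set e := Op Add (Reg r) (Const 1).
  have se : small_expr W st4 e.
    by rewrite /= r4 ltnW //=; apply: leq_trans W_ge.
  have ee : eval st4 e = j.+1 by rewrite /= r4 addn1.
  exists (t4 + (cost st4 e + bits (eval st4 e))), (State (upd (reg st4) r (eval st4 e)) (mem st4)).
  split.
  + by apply: ExecSeq ex4 _; apply: ExecAssign.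
  + have := assign_small se _ isT; rewrite ee => /(_ ltjW).
    by move: tc4; rewrite fb !mulSn /unit_cost; lia.
  have ei : iota 0 j.+1 = rcons (iota 0 j) j by rewrite -cats1 -addn1 iotaD.
  split.
  + by move=> x ltx; rewrite /= /upd ifN ?k4 ?P1 //; lia.
  + by rewrite ee /= /upd eqxx.
  + rewrite ei foldl_rcons; apply: (agree_keeps lt_r _ ag4).
    exact: keeps_assign (leqnn r).
  + by rewrite ei foldl_rcons.
- split=> //=; first by move=> x ltx; rewrite /upd ifN //; lia.
    by rewrite /upd eqxx.
  exact: agree_keeps kp1 ag.
exists (cost st (Const 0) + bits 0 + t3), st3; split=> //.
- by apply: ExecSeq ex3; apply: (ExecAssign r (Const 0)).
have : 4 * bits W ^ 2 + 2 <= unit_cost by rewrite /unit_cost; have := bits_gt0 W; lia.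
have -> : cost st (Const 0) + bits 0 = 2 by [].
move: tc3; set a := steps par (f2 0); set U := unit_cost; move=> tc3 u4.
have : par b * (a.+1 * U + 4 * bits W ^ 2) <= par b * (a.+2 * U).
  by rewrite leq_mul2l [a.+2 * _]mulSn addnC leq_add2r; lia.
by rewrite !mulSn -mulnA; lia.
Qed.

End Compile.

(** * Running time bounds read off the program text *)

Section StaticCost.

(* [(c, (x, y, z))] stands for the bound [c * K ^ x * N ^ y * P ^ z]. *)
Definition monom := (nat * (nat * nat * nat))%type.

Definition madd (m1 m2 : monom) : monom :=
  let: (c1, (x1, y1, z1)) := m1 in let: (c2, (x2, y2, z2)) := m2 in
  (c1 + c2, (maxn x1 x2, maxn y1 y2, maxn z1 z2)).

Definition mcst c : monom := (c, (0, 0, 0)).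

Inductive size_class := SizeK | SizeN | SizeP.

Variable cls : nat -> size_class.

Definition mloop p (m : monom) : monom :=
  let: (c, (x, y, z)) := m in
  (c, match cls p with
      | SizeK => (x.+1, y, z) | SizeN => (x, y.+1, z) | SizeP => (x, y, z.+1)
      end).

Fixpoint mexp (e : exp nat) : monom :=
  match e with
  | Cst _ | Var _ | Par _ => mcst 1
  | Inp e => madd (mcst 1) (mexp e)
  | Arr _ i j l => madd (mcst 1) (madd (mexp i) (madd (mexp j) (mexp l)))
  | Bin _ e1 e2 => madd (mcst 1) (madd (mexp e1) (mexp e2))
  | Ite c e1 e2 => madd (mcst 2) (madd (mexp c) (madd (mexp e1) (mexp e2)))
  | Fold p e0 f => madd (mcst 2) (madd (mexp e0) (mloop p (madd (mcst 3) (mexp (f 0 0)))))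
  end.

Fixpoint mstm (p : stm nat) : monom :=
  match p with
  | Sto _ i j l e =>
      madd (mcst 1) (madd (mexp i) (madd (mexp j) (madd (mexp l) (mexp e))))
  | Then p q => madd (mstm p) (mstm q)
  | For b f => madd (mcst 2) (mloop b (madd (mcst 2) (mstm (f 0))))
  end.

Variable ok : pred nat.

Fixpoint exp_loops (e : exp nat) : bool :=
  match e with
  | Cst _ | Var _ | Par _ => true
  | Inp e => exp_loops e
  | Arr _ i j l => [&& exp_loops i, exp_loops j & exp_loops l]
  | Bin _ e1 e2 => exp_loops e1 && exp_loops e2
  | Ite c e1 e2 => [&& exp_loops c, exp_loops e1 & exp_loops e2]
  | Fold p e0 f => [&& ok p, exp_loops e0 & exp_loops (f 0 0)]
  end.

Fixpoint stm_loops (p : stm nat) : bool :=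
  match p with
  | Sto _ i j l e => [&& exp_loops i, exp_loops j, exp_loops l & exp_loops e]
  | Then p q => stm_loops p && stm_loops q
  | For b f => ok b && stm_loops (f 0)
  end.

Variables (par : nat -> nat) (K N P : nat).
Hypotheses (K0 : 0 < K) (N0 : 0 < N) (P0 : 0 < P).

Definition mval (m : monom) : nat :=
  let: (c, (x, y, z)) := m in c * (K ^ x * N ^ y * P ^ z).

Hypothesis parP : forall i, ok i ->
  par i <= match cls i with SizeK => K | SizeN => N | SizeP => P end.

Lemma mval_cst c : mval (mcst c) = c.
Proof. by rewrite /mval /= !expn0 !muln1. Qed.

(** Taking the larger exponent of each base is sound because K, N and P are positive. *)
Lemma mval_add m1 m2 : mval m1 + mval m2 <= mval (madd m1 m2).
Proof.
case: m1 => c1 [[x1 y1] z1]; case: m2 => c2 [[x2 y2] z2]; rewrite /mval /= mulnDl.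
by apply: leq_add; apply: leq_mul => //; apply: leq_mul; [apply: leq_mul| |apply: leq_mul|];
  apply: leq_pexp2l; rewrite ?leq_maxl ?leq_maxr.
Qed.

Lemma mval_loop p m : ok p -> par p * mval m <= mval (mloop p m).
Proof.
move=> /parP; case: m => c [[x y] z]; rewrite /mval /mloop.
by case: (cls p) => /leq_mul /(_ (leqnn (c * (K ^ x * N ^ y * P ^ z)))) /leq_trans -> //;
  rewrite expnS; nia.
Qed.

Lemma leq_mval_add m1 m2 a b : a <= mval m1 -> b <= mval m2 -> a + b <= mval (madd m1 m2).
Proof. by move=> la lb; apply: leq_trans (mval_add _ _); apply: leq_add. Qed.

Lemma leq_mval_loop p m a : ok p -> a <= mval m -> par p * a <= mval (mloop p m).
Proof. by move=> okp la; apply: leq_trans (mval_loop _ okp); rewrite leq_mul2l la orbT. Qed.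

Lemma leq_mval_cst c a m : a <= mval m -> a + c <= mval (madd (mcst c) m).
Proof. by move=> la; rewrite addnC; apply: leq_mval_add => //; rewrite mval_cst. Qed.

Lemma steps_exp_mval e : exp_loops e -> steps_exp par e <= mval (mexp e).
Proof.
elim: e => [c|x|i|e IH|a i IHi j IHj l IHl|o e1 IH1 e2 IH2|c IHc e1 IH1 e2 IH2|p e0 IH0 f IHf];
  cbn [steps_exp mexp exp_loops].
- by rewrite mval_cst.
- by rewrite mval_cst.
- by rewrite mval_cst.
- by move=> /IH le_e; rewrite -addn1; apply: leq_mval_cst.
- case/and3P=> /IHi le_i /IHj le_j /IHl le_l; rewrite -addn1; apply: leq_mval_cst.
  by rewrite -addnA; apply: leq_mval_add => //; apply: leq_mval_add.
- by case/andP=> /IH1 le1 /IH2 le2; rewrite -addn1; apply: leq_mval_cst; apply: leq_mval_add.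
- case/and3P=> /IHc le_c /IH1 le1 /IH2 le2; rewrite -addn2; apply: leq_mval_cst.
  by rewrite -addnA; apply: leq_mval_add => //; apply: leq_mval_add.
- case/and3P=> okp /IH0 le0 /IHf lef; rewrite -addn2; apply: leq_mval_cst.
  by apply: leq_mval_add => //; apply: leq_mval_loop => //; rewrite -addn3; apply: leq_mval_cst.
Qed.

Lemma steps_mval p : stm_loops p -> steps par p <= mval (mstm p).
Proof.
elim: p => [a i j l e|p IHp q IHq|b f IHf]; cbn [steps mstm stm_loops].
- case/and4P=> oki okj okl oke; rewrite -addn1; apply: leq_mval_cst; rewrite -!addnA.
  by repeat apply: leq_mval_add; exact: steps_exp_mval.
- by case/andP=> /IHp lep /IHq leq; apply: leq_mval_add.
- case/andP=> okb /IHf lef; rewrite -addn2; apply: leq_mval_cst; apply: leq_mval_loop => //.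
  by rewrite -addn2; apply: leq_mval_cst.
Qed.

Lemma mval_le (c' x' y' z' : nat) (m : monom) :
  [&& m.1 <= c', m.2.1.1 <= x', m.2.1.2 <= y' & m.2.2 <= z'] ->
  mval m <= c' * (K ^ x' * N ^ y' * P ^ z').
Proof.
case: m => c [[x y] z] /= /and4P[? ? ? ?]; rewrite /mval.
by apply: leq_mul => //; apply: leq_mul; [apply: leq_mul|]; apply: leq_pexp2l.
Qed.

End StaticCost.

Declare Scope exp_scope.
Delimit Scope exp_scope with exp.
Bind Scope exp_scope with exp.

(** * The counting program *)

Section Combinators.

Variable var : Type.
Local Notation ex := (exp var).

Definition Not (a : ex) : ex := Bin Eq a (Cst 0).
(** On truth values this is implication, and it is used as such below. *)
Definition Le (a b : ex) : ex := Not (Bin Sub a b).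
(** For truth values, 1 - a < b holds only if both are 1. *)
Definition And (a b : ex) : ex := Bin Lt (Bin Sub (Cst 1) a) b.
Definition Or (a b : ex) : ex := Le (Not a) b.
Definition Nz (a : ex) : ex := Bin Lt (Cst 0) a.
Definition Sum p (f : ex -> ex) : ex :=
  Fold p (Cst 0) (fun acc i => Bin Add (Var acc) (f (Var i))).
Definition Prod p (f : ex -> ex) : ex :=
  Fold p (Cst 1) (fun acc i => Bin Mul (Var acc) (f (Var i))).
Definition All p (f : ex -> ex) : ex :=
  Fold p (Cst 1) (fun acc i => And (Var acc) (f (Var i))).
Definition Exi p (f : ex -> ex) : ex := Not (All p (fun i => Not (f i))).
Definition Loop p (f : ex -> stm var) : stm var := For p (fun i => f (Var i)).
Definition Arr0 a : ex := Arr a (Cst 0) (Cst 0) (Cst 0).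
Definition Arr1 a i : ex := Arr a i (Cst 0) (Cst 0).
Definition Arr2 a i j : ex := Arr a i j (Cst 0).
Definition Sto0 a (e : ex) := Sto a (Cst 0) (Cst 0) (Cst 0) e.
Definition Sto1 a i (e : ex) := Sto a i (Cst 0) (Cst 0) e.
Definition Sto2 a i j (e : ex) := Sto a i j (Cst 0) e.

End Combinators.

Arguments Arr0 {var}.

Notation "a + b" := (Bin Add a b) : exp_scope.
Notation "a - b" := (Bin Sub a b) : exp_scope.
Notation "a * b" := (Bin Mul a b) : exp_scope.
Notation "a < b" := (Bin Lt a b) : exp_scope.
Notation "a <= b" := (Le a b) : exp_scope.
Notation "a == b" := (Bin Eq a b) : exp_scope.
Notation "a && b" := (And a b) : exp_scope.
Notation "a || b" := (Or a b) : exp_scope.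
Notation "p ;; q" := (Then p q) (at level 100, right associativity).

(* The loops are bounded by these parameters.  [pG] is the address of the
   encoding of G, [pM] is W - 1 and stands for -1.  With D + 1 functions, the
   identity included, [pA] is the number of labels of a pair of vertices,
   [pCL] that of label matrices, [pCS] that of strategies and [pP] bounds the
   number of assignments to the fixed vertices of a strategy. *)
Definition pK := 2.
Definition pN := 3.
Definition pG := 4.
Definition pM := 5.
Definition pN1 := 6.
Definition pK1 := 7.
Definition pKK := 8.
Definition p5K := 9.
Definition pD1 := 10.
Definition pA := 11.
Definition pCL := 12.
Definition pCS := 13.
Definition pP := 14.
Definition pKPK := 15.

(* A cell of [aOUT], [aVAL] or [aDV] holds a vertex of G plus one, with 0 for
   "undefined"; cells of [aPSI] hold such a number plus one, with 0 for "not yet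
   reached". *)
Definition aPT := 0.
Definition aHA := 1.
Definition aGA := 2.
Definition aDEG := 3.
Definition aPOS := 4.
Definition aBEST := 5.
Definition aIDX := 6.
Definition aOUT := 7.
Definition aD := 8.
Definition aPAR := 9.
Definition aE := 10.
Definition aL := 11.
Definition aPSI := 12.
Definition aGOOD := 13.
Definition aFX := 14.
Definition aDT := 15.
Definition aPR := 16.
Definition aRK := 17.
Definition aSR := 18.
Definition aVAL := 19.
Definition aDV := 20.
Definition aWT := 21.
Definition aTOT := 22.
Definition aCNT := 23.
Definition aRES := 24.
Definition aACC := 25.
Definition aANS := 26.
Definition aOK := 27.

Section Program.

Variable var : Type.
Local Notation ex := (exp var).
Local Open Scope exp_scope.

Local Notation "0" := (Cst 0) : exp_scope.
Local Notation "1" := (Cst 1) : exp_scope.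

(** The place value is the product of the bases below [idx]. As loop bounds are parameters, the
    product runs over all indices and takes the factor 1 from [idx] on. *)
Definition Digit m (base : ex -> ex) (code idx : ex) : ex :=
  Bin Mod (Bin Div code (Prod m (fun i => Ite (i < idx) (base i) 1))) (base idx).

(** Cell u of [aPT] is the address of the length of row u. That length is no parameter, so every row
    is scanned for m steps, and a step past its end leaves the entry it happens to hit unchanged. *)
Definition read_graph (ptr : ex) m a : stm var :=
  Sto1 aPT 0 (ptr + 1);;
  Loop m (fun u => Sto1 aPT (u + 1) (Arr1 aPT u + (1 + Inp (Arr1 aPT u))));;
  Loop m (fun u => Loop m (fun j =>
    let v := Inp (Arr1 aPT u + (1 + j)) in
    Sto2 a u v (Arr2 a u v || (j < Inp (Arr1 aPT u))))).

(** The accumulator is a vertex plus one, with 0 as long as no remaining vertex has been met. *)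
Definition best_vertex : ex :=
  Fold pN 0 (fun acc u =>
    Ite (Not (Arr1 aPOS (Var u)) &&
         (Not (Var acc) || (Arr1 aDEG (Var u) < Arr1 aDEG (Var acc - 1))))
        (Var u + 1) (Var acc)).

(** [aPOS] holds the time of removal, counted from 1, and 0 for a vertex that remains. *)
Definition peel : stm var :=
  Loop pN (fun u => Sto1 aDEG u (Sum pN (fun v => Arr2 aGA u v)));;
  Loop pN (fun i =>
    Sto0 aBEST best_vertex;;
    Sto1 aPOS (Arr0 aBEST - 1) (i + 1);;
    Loop pN (fun v => Sto1 aDEG v (Arr1 aDEG v - Arr2 aGA (Arr0 aBEST - 1) v))).

Definition earlier (u v : ex) : ex :=
  Arr2 aGA u v && (Arr1 aPOS u < Arr1 aPOS v).

(** [aIDX] at (u, v) counts the out-neighbours of u below v, so that the arc from u to v gets this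
    count plus one as its index. A non-arc writes into row 0 of [aOUT], which stands for no
    function. Row D + 1 is the identity and expresses phi u = phi v. *)
Definition orient : stm var :=
  Loop pN (fun u => Loop pN (fun v =>
    Sto2 aIDX u (v + 1) (Arr2 aIDX u v + earlier u v)));;
  Sto0 aD (Fold pN 0 (fun acc u =>
    Ite (Var acc < Arr2 aIDX (Var u) (Par pN)) (Arr2 aIDX (Var u) (Par pN)) (Var acc)));;
  Loop pN (fun u => Loop pN (fun v =>
    Sto2 aOUT (Ite (earlier u v) (Arr2 aIDX u v + 1) 0) (u + 1) (v + 1)));;
  Loop pN (fun u => Sto2 aOUT (Arr0 aD + 1) (u + 1) (u + 1)).

Definition set_par i (e : ex) : stm var := Sto1 aPAR (Cst i) e.

Definition phase1 : stm var :=
  read_graph 0 pK aHA;; read_graph (Par pG) pN aGA;; peel;; orient;;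
  set_par pN1 (Par pN + 1);;
  set_par pK1 (Par pK + 1);;
  set_par pKK (Par pK * Par pK);;
  set_par p5K (Cst 5 * Par pK);;
  set_par pD1 (Arr0 aD + 1);;
  set_par pA (Cst 2 * (Arr0 aD + 1)).

(** A loop bound must be a parameter when its loop starts, so [pKK] and [p5K], computed in the stage
    before, have to be loaded first. In [pP] the factor n occurs once for every i with 4 (i + 1) <=
    k, that is k/4 times, and not at all if n = 0. *)
Definition phase2 : stm var :=
  set_par pCL (Prod pKK (fun _ => Par pA));;
  set_par pCS (Prod p5K (fun _ => Par pK1));;
  set_par pP (Prod pK (fun i => Ite (Nz (Par pN) && (Cst 4 * (i + 1) <= Par pK)) (Par pN) 1));;
  set_par pKPK (Prod pK (fun _ => Par pK)).

Definition load_labels (c : ex) : stm var :=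
  Loop pK (fun u => Loop pK (fun v =>
    Sto2 aE u v (Digit pKK (fun=> Par pA) c (u * Par pK + v))));;
  Loop pK (fun u => Loop pK (fun v =>
    Sto2 aL u v (Ite (u < v)
      (Ite (Arr2 aE u v <= Par pD1) (Arr2 aE u v) 0)
      (Ite (v < u) (Arr2 aE v u - Par pD1) 0)))).

Definition psi s x v : ex := Arr aPSI s x v.

Definition psi_next s x u v : ex := Arr2 aOUT (Arr2 aL u v) (psi s x u - 1) + 1.

(** Relaxation as for shortest paths: in each of k rounds every arc is tried once, which suffices
    since a path without repeated vertices has fewer than k arcs. [aGOOD] then records that no
    forced value is undefined and that all arcs leaving reached vertices are satisfied. *)
Definition propagate (s x : ex) : stm var :=
  Loop pK (fun v => Sto aPSI s x v (Ite (v == s) (x + 1) 0));;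
  Loop pK (fun _ => Loop pK (fun u => Loop pK (fun v =>
    Sto aPSI s x v
      (Ite ((Nz (Arr2 aL u v) && Nz (psi s x u)) && Not (psi s x v))
         (psi_next s x u v) (psi s x v)))));;
  Sto2 aGOOD s x (All pK (fun u => All pK (fun v =>
    Not (psi s x v == 1) &&
    ((Nz (Arr2 aL u v) && Nz (psi s x u)) <= (psi s x v == psi_next s x u v))))).

(** A code consists of 5k digits in base k + 1, in five blocks: fixed vertices, determining
    vertices, parents, ranks and representatives. The digit k stands for the absence of a
    determining vertex or of a parent. *)
Definition load_strategy (c : ex) : stm var :=
  let k := Par pK in
  let dig i := Digit p5K (fun=> Par pK1) c i in
  Loop pK (fun v => Sto1 aFX v (dig v == 1));;
  Loop pK (fun v => Sto1 aDT v (dig (k + v)));;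
  Loop pK (fun v => Sto1 aPR v (dig (k + (k + v))));;
  Loop pK (fun v => Sto1 aRK v (dig (k + (k + (k + v)))));;
  Loop pK (fun v => Sto1 aSR v (dig (k + (k + (k + (k + v)))) == 1)).

Definition bedge_ex (s v : ex) : ex :=
  Arr1 aSR s && (Not (Arr1 aSR v) && Nz (psi s 0 v)).

Definition known_ex (v : ex) : ex := Arr1 aFX v || (Arr1 aDT v < Par pK).

Definition valid_strategy : ex :=
  let k := Par pK in
  (Cst 4 * Sum pK (fun v => Arr1 aFX v) <= k) &&
  (All pK (fun v => Exi pK (fun s => Arr1 aSR s && Nz (psi s 0 v))) &&
  (All pK (fun s => All pK (fun t =>
     (Arr1 aSR s && (Arr1 aSR t && Nz (psi s 0 t))) <= (s == t))) &&
  (All pK (fun v => (Arr1 aDT v < k) <=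
     (Not (Arr1 aFX v) && (Arr1 aFX (Arr1 aDT v) && bedge_ex (Arr1 aDT v) v))) &&
  (All pK (fun v => (Arr1 aPR v < k) <= (Arr1 aRK v < Arr1 aRK (Arr1 aPR v))) &&
   All pK (fun s => All pK (fun v =>
     bedge_ex s v <= ((known_ex s || known_ex v) ||
                   ((Arr1 aPR s == v) || (Arr1 aPR v == s))))))))).

Definition radix_ex (v : ex) : ex := Ite (Arr1 aFX v) (Par pN) 1.

Definition load_values (a : ex) : stm var :=
  Loop pK (fun v => Sto1 aVAL v
    (Ite (Arr1 aFX v) (Digit pK radix_ex a v + 1) 0));;
  Loop pK (fun v => Sto1 aDV v (Ite (Arr1 aDT v < Par pK)
    (psi (Arr1 aDT v) (Arr1 aVAL (Arr1 aDT v)) v - 1) (Arr1 aVAL v))).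

(** An edge with a known end restricts only its other end, so its condition becomes part of a
    weight. Only edges between unknown vertices remain, and in a valid strategy these join a vertex
    to its parent. *)
Definition init_weight (v y : ex) : ex :=
  Nz y && ((known_ex v <= (y == Arr1 aDV v)) &&
  ((Arr1 aSR v <= Arr2 aGOOD v y) &&
   All pK (fun u =>
     ((known_ex u && bedge_ex u v) <= (psi u (Arr1 aDV u) v == y + 1)) &&
     ((known_ex u && bedge_ex v u) <= (psi v y u - 1 == Arr1 aDV u))))).

Definition edge_ok_ex (v x p y : ex) : ex :=
  (bedge_ex v p <= (psi v x p == y + 1)) && (bedge_ex p v <= (psi p y v == x + 1)).

(** Vertices are eliminated in the order of their ranks: the sum over the values of v is multiplied
    into the weights of the parent or, at a root, into the total. A root has the parent index k,
    whose row of [aWT] belongs to no vertex. The two nested loops over values make the cost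
    quadratic in n. *)
Definition tree_sum : stm var :=
  Loop pK (fun v => Loop pN1 (fun y => Sto2 aWT v y (init_weight v y)));;
  Sto0 aTOT 1;;
  Loop pK1 (fun r => Loop pK (fun v =>
    Loop pN1 (fun y => Sto2 aWT (Arr1 aPR v) y
      (Ite (Arr1 aRK v == r)
        (Arr2 aWT (Arr1 aPR v) y *
          Sum pN1 (fun x => Arr2 aWT v x * edge_ok_ex v x (Arr1 aPR v) y))
        (Arr2 aWT (Arr1 aPR v) y)));;
    Sto0 aTOT (Ite ((Arr1 aRK v == r) && (Arr1 aPR v == Par pK))
      (Arr0 aTOT * Sum pN1 (fun x => Arr2 aWT v x)) (Arr0 aTOT)))).

(* All strategies are tried; the valid ones agree on the result. *)
Definition try_strategy (c : ex) : stm var :=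
  load_strategy c;;
  Sto0 aOK valid_strategy;;
  Sto0 aCNT 0;;
  Loop pP (fun a =>
    load_values a;;
    tree_sum;;
    Sto0 aCNT (Arr0 aCNT +
      Ite (a < Prod pK radix_ex) (Arr0 aTOT) 0));;
  Sto0 aRES (Ite (Arr0 aOK) (Arr0 aCNT) (Arr0 aRES)).

(* [mode] is 0 for homomorphisms, 1 for copies and 2 for induced copies. *)
Definition weight mode : ex :=
  Prod pK (fun u => Prod pK (fun v =>
    let e := Arr2 aE u v in
    Ite (u < v)
      (Ite (Arr2 aHA u v) (Nz e && Not (e == Par pD1))
        (Ite (Nz e)
          (Ite (e == Par pD1) (if mode is 0%N then 0 else Par pM)
             (if mode is 2 then Par pM else 0)) 1))
      (Not e))).

Definition count_maps mode : stm var :=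
  Loop pCL (fun c =>
    load_labels c;;
    Loop pK (fun s => Loop pN1 (fun x => propagate s x));;
    Loop pCS (fun c' => try_strategy c');;
    Sto0 aACC (Arr0 aACC + weight mode * Arr0 aRES)).

(** All k^k maps are tried. The first condition is injectivity, written as an equivalence of truth
    values. *)
Definition automorphisms : ex :=
  Sum pKPK (fun c => All pK (fun u => All pK (fun v =>
    let phi := Digit pK (fun=> Par pK) c in
    ((u == v) == (phi u == phi v)) &&
    (Arr2 aHA u v == Arr2 aHA (phi u) (phi v))))).

Definition phase3 mode : stm var :=
  count_maps mode;;
  Sto0 aANS (if mode is 0%N then Arr0 aACC else Bin Div (Arr0 aACC) automorphisms).

End Program.

Ltac wf_auto :=
  repeat (cbv beta zeta;
    match goal with
    | |- is_true _ => exact isT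
    | |- List.In _ _ => cbn [List.In]; intuition congruence
    | |- forall _, _ => intro
    | |- wfe _ ?e _ => let e' := eval hnf in e in change e with e'; constructor
    | |- wf _ ?e _ => let e' := eval hnf in e in change e with e'; constructor
    end).

Lemma wf_phase1 : wf [::] (phase1 nat) (phase1 nat).
Proof. wf_auto. Qed.

Lemma wf_phase2 : wf [::] (phase2 nat) (phase2 nat).
Proof. wf_auto. Qed.

Lemma wf_phase3 mode : mode < 3 -> wf [::] (phase3 nat mode) (phase3 nat mode).
Proof. case: mode => [|[|[|//]]] _; wf_auto. Qed.

(** Among the loop bounds only [pN] and [pN1] are linear in n and only [pP] is a power of n with an
    exponent growing with k; the others are bounded in terms of d and k. *)
Definition par_class i :=
  if i \in [:: pN; pN1] then SizeN else if i == pP then SizeP else SizeK.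

(** * Elimination strategies for bipartite graphs *)

Section Strategy.

Variables (T : finType) (S : pred T) (B : rel T).
Hypothesis bip : forall s v, B s v -> S s && ~~ S v.

Definition nbr : rel T := fun u w => B u w || B w u.

(* [X] is the set of fixed vertices, [dt v] a fixed vertex that determines
   [v], and the remaining edges of [B] join a vertex to its parent. *)
Variant strategy (A : {set T}) (m : nat) : Prop :=
  Strategy (X : {set T}) (dt pr : T -> option T) (rk : T -> nat) of
    X \subset A
  & #|X| <= m
  & (forall v, v \in A -> rk v < #|A|)
  & (forall v s, v \in A -> dt v = Some s -> [&& v \notin X, s \in X & B s v])
  & (forall v p, v \in A -> pr v = Some p -> (p \in A) && (rk v < rk p))
  & (forall s v, s \in A -> v \in A -> B s v ->
      [|| (s \in X) || (dt s != None), (v \in X) || (dt v != None),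
          pr s == Some v | pr v == Some s]).

Lemma B_irr v : B v v = false.
Proof. by apply/negP => /bip; case: (S v). Qed.

Lemma nbr_irr v : nbr v v = false.
Proof. by rewrite /nbr B_irr. Qed.

Lemma nbr_sym u v : nbr u v = nbr v u.
Proof. by rewrite /nbr orbC. Qed.

Lemma strategy_mono (A : {set T}) m m' : m <= m' -> strategy A m -> strategy A m'.
Proof.
move=> le_m [X dt pr rk h1 h2 h3 h4 h5 h6]; exists X dt pr rk => //.
exact: leq_trans le_m.
Qed.

Lemma strategy_set0 : strategy set0 0.
Proof.
exists set0 (fun=> None) (fun=> None) (fun=> 0); rewrite ?sub0set ?cards0 //;
  by move=> v; rewrite ?inE.
Qed.

(** A leaf can be eliminated before all other vertices: it gets rank 0 and its only neighbour, if
    any, as parent, while the other ranks go up by one. *)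
Lemma strategy_leaf (A : {set T}) v m : v \in A -> #|[set w in A | nbr v w]| <= 1 ->
  strategy (A :\ v) m -> strategy A m.
Proof.
move=> vA cardN [X dt pr rk h1 h2 h3 h4 h5 h6].
have cA : #|A| = #|A :\ v|.+1 by rewrite (cardsD1 v) vA.
have vX : v \notin X.
  by apply/negP => /(subsetP h1); rewrite !inE eqxx.
have nbv w : w \in A -> nbr v w -> [pick w in A | nbr v w] = Some w.
  move=> wA vw; case: pickP => [x /andP[xA vx]|/(_ w)]; last by rewrite wA vw.
  congr Some; apply: (card_le1_eqP cardN); by rewrite inE ?xA ?wA.
have inA u : u != v -> u \in A -> u \in A :\ v by rewrite !inE => -> ->.
exists X (fun u => if u == v then None else dt u)
  (fun u => if u == v then [pick w in A | nbr v w] else pr u)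
  (fun u => if u == v then 0 else (rk u).+1) => //.
- by apply: subset_trans h1 _; apply: subD1set.
- by move=> u uA; case: ifPn => [_|uv]; rewrite cA // ltnS; apply: h3; apply: inA.
- move=> u s uA; case: ifPn => // uv; apply: h4; exact: inA.
- move=> u p uA; case: (eqVneq u v) => [Euv|uv].
    case: pickP => // x /andP[xA vx] [<-]; rewrite xA /=.
    by case: eqP vx => // ->; rewrite nbr_irr.
  move=> /(h5 _ _ (inA _ uv uA)); rewrite !inE => /andP[/andP[/negPf-> ->]] /=.
  by rewrite ltnS.
- move=> s w sA wA sw.
  case: (eqVneq s v) => [E|sv].
    have vw : nbr v w by rewrite -E /nbr sw.
    by rewrite (nbv w wA vw) eqxx !orbT.
  case: (eqVneq w v) => [E|wv]; last exact: h6 (inA _ sv sA) (inA _ wv wA) sw.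
  have vs : nbr v s by rewrite -E /nbr sw orbT.
  by rewrite (nbv s sA vs) eqxx !orbT.
Qed.

(** A fixed source determines all its neighbours, so it and they may be dropped together at the
    price of one fixed vertex. *)
Lemma strategy_source (A : {set T}) s m : s \in A ->
  strategy (A :\: (s |: [set v | B s v])) m -> strategy A m.+1.
Proof.
move=> sA [X dt pr rk h1 h2 h3 h4 h5 h6]; set A' := _ :\: _ in h1 h3 h4 h5 h6.
have inA' u : u \in A -> u != s -> ~~ B s u -> u \in A'.
  by move=> uA us su; rewrite !inE uA negb_or us su.
have A'A : A' \subset A by apply: subsetDl.
have XA' u : u \in X -> [/\ u \in A, u != s & ~~ B s u].
  by move/(subsetP h1); rewrite !inE negb_or => /andP[/andP[]].
have cA : #|A'| <= #|A| by apply: subset_leq_card.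
have A0 : 0 < #|A| by apply/card_gt0P; exists s.
exists (s |: X) (fun u => if B s u then Some s else if u == s then None else dt u)
  (fun u => if (u == s) || B s u then None else pr u)
  (fun u => if (u == s) || B s u then 0 else rk u).
- rewrite subUset sub1set sA; exact: subset_trans h1 A'A.
- by rewrite cardsU1; case: (s \notin X) => //=; rewrite ?add0n ?add1n; lia.
- move=> u uA; case: ifPn => //; rewrite negb_or => /andP[us su].
  by apply: leq_trans cA; apply: h3; apply: inA'.
- move=> u t uA; case: ifPn => [su [<-]|su].
    rewrite su !inE eqxx negb_or andbT !andbT; apply/andP; split.
      by apply/eqP => E; rewrite E B_irr in su.
    by apply/negP => /XA'[_ _]; rewrite su.
  case: ifPn => // us /(h4 _ _ (inA' _ uA us su)) /and3P[uX tX ->].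
  by rewrite !inE negb_or us uX tX orbT.
- move=> u p uA; case: (boolP ((u == s) || B s u)) => //; rewrite negb_or => /andP[us su].
  case/(h5 _ _ (inA' _ uA us su))/andP; rewrite !inE !negb_or.
  by case/andP=> /andP[/negPf-> /negPf->] ->.
- move=> t w tA wA tw.
  have kn u : u \in A -> (u == s) || B s u ->
      (u \in s |: X) || ((if B s u then Some s else if u == s then None else dt u) != None).
    by move=> uA /orP[/eqP->|->]; rewrite ?inE ?eqxx ?orbT.
  case: (boolP ((t == s) || B s t)) => [ts|]; first by rewrite kn.
  case: (boolP ((w == s) || B s w)) => [ws|]; first by rewrite (kn w) ?orbT.
  rewrite !negb_or => /andP[ws sw] /andP[ts st].
  have := h6 _ _ (inA' _ tA ts st) (inA' _ wA ws sw) tw.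
  by rewrite (negPf st) (negPf ts) (negPf sw) (negPf ws) !inE (negPf ts) (negPf ws).
Qed.

(** Fixing a vertex takes care of all its edges, whether or not it determines its neighbours. *)
Lemma strategy_node (A : {set T}) v m : v \in A -> strategy (A :\ v) m -> strategy A m.+1.
Proof.
move=> vA [X dt pr rk h1 h2 h3 h4 h5 h6].
have cA : #|A| = #|A :\ v|.+1 by rewrite (cardsD1 v) vA.
have inA u : u != v -> u \in A -> u \in A :\ v by rewrite !inE => -> ->.
exists (v |: X) (fun u => if u == v then None else dt u)
  (fun u => if u == v then None else pr u) (fun u => if u == v then 0 else rk u).
- by rewrite subUset sub1set vA; apply: subset_trans h1 _; apply: subD1set.
- by rewrite cardsU1; case: (v \notin X) => //=; rewrite ?add0n ?add1n; lia.
- by move=> u uA; case: ifPn => [_|uv]; rewrite cA // ltnS ltnW // h3 ?inA.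
- move=> u t uA; case: ifPn => // uv /(h4 _ _ (inA _ uv uA)) /and3P[uX tX ->].
  by rewrite !inE negb_or uv uX tX orbT.
- move=> u p uA; case: (eqVneq u v) => // uv /(h5 _ _ (inA _ uv uA)).
  by rewrite !inE => /andP[/andP[/negPf-> ->]].
- move=> s w sA wA sw; rewrite !inE.
  case: (eqVneq s v) => [//|sv]; case: (eqVneq w v) => [|wv]; first by rewrite !orbT.
  by have := h6 _ _ (inA _ sv sA) (inA _ wv wA) sw.
Qed.

Definition stuck (C : {set T}) := [forall u in C, 1 < #|[set w in C | nbr u w]|].

(** Leaves cost no fixed vertex, so they can be stripped until all degrees are at least 2. *)
Lemma core_ex (A : {set T}) :
  exists C : {set T}, [/\ C \subset A, stuck C & forall m, strategy C m -> strategy A m].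
Proof.
have [n] := ubnP #|A|; elim: n A => // n IH A ltA.
case: (boolP (stuck A)) => [st|nst]; first by exists A; split.
case: (pickP [pred u | (u \in A) && (#|[set w in A | nbr u w]| <= 1)]) => [u /andP[uA cu]|no].
  have [|C [CA sC ext]] := IH (A :\ u).
    by move: ltA; rewrite (cardsD1 u) uA add1n ltnS.
  exists C; split=> // [|m /ext]; last exact: strategy_leaf.
  by apply: subset_trans CA _; apply: subD1set.
exfalso; move: nst; rewrite /stuck negb_forall => /existsP[u].
by rewrite negb_imply -leqNgt => uu; have := no u; rewrite /= uu.
Qed.

(* A vertex of degree at most 2 in [C] that loses a neighbour leaves every
   stuck subset. *)
Lemma stuck_drop (C D : {set T}) u w : D \subset C -> stuck D ->
  u \in C -> w \in C -> nbr u w -> w \notin D ->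
  #|[set x in C | nbr u x]| <= 2 -> u \notin D.
Proof.
move=> DC /forallP sD uC wC uw wD cu; apply/negP => uD.
have := sD u; rewrite uD /= => lt1.
have : [set x in D | nbr u x] \subset [set x in C | nbr u x] :\ w.
  apply/subsetP => x; rewrite !inE => /andP[xD ->].
  rewrite (subsetP DC) // !andbT; by apply/eqP => E; rewrite E (negPf wD) in xD.
move/subset_leq_card; have := cardsD1 w [set x in C | nbr u x].
by rewrite inE wC uw /= add1n; lia.
Qed.

Lemma card_drop (C D Q : {set T}) q : D \subset C -> Q \subset C -> [disjoint Q & D] ->
  q <= #|Q| -> #|D| + q <= #|C|.
Proof.
move=> DC QC dis lq; apply: leq_trans (leq_add (leqnn _) lq) _.
have -> : #|D| + #|Q| = #|D :|: Q|.
  by rewrite cardsU setIC (disjoint_setI0 dis) cards0 subn0.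
by apply: subset_leq_card; rewrite subUset DC.
Qed.

(** A source of degree at least 3 goes together with the neighbours it determines. Otherwise all
    sources have degree 2, and fixing another vertex v turns the sources next to it into leaves. If
    v has degree at least 3 this is enough; if all degrees are 2, the second neighbour of such a
    source falls as well. *)
Lemma stuck_reduce (C : {set T}) : stuck C -> C != set0 ->
  exists2 D : {set T}, #|D| + 4 <= #|C| & forall m, strategy D m -> strategy C m.+1.
Proof.
move=> sC C0; have deg2 u : u \in C -> 1 < #|[set w in C | nbr u w]|.
  by move=> uC; have := forallP sC u; rewrite uC.
case: (pickP [pred s | [&& s \in C, S s & 2 < #|[set w in C | nbr s w]|]]) => [s /and3P[sS Ss deg]|src].
  exists (C :\: (s |: [set v | B s v])); last by move=> m; apply: strategy_source.
  have eqN : [set w in C | nbr s w] = C :&: [set v | B s v].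
    apply/setP => w; rewrite !inE /nbr; case: (B w s) / boolP => [/bip|]; last by rewrite orbF.
    by rewrite Ss andbF.
  rewrite eqN in deg.
  apply: (@card_drop _ _ (s |: (C :&: [set v | B s v]))).
  - exact: subsetDl.
  - by rewrite subUset sub1set sS subsetIl.
  - rewrite -setI_eq0; apply/eqP/setP => x; rewrite !inE.
    by case: (x == s); case: (B s x); case: (x \in C).
  - by rewrite cardsU1 !inE B_irr andbF.
have degS s : s \in C -> S s -> #|[set w in C | nbr s w]| <= 2.
  by move=> h1 h2; have := src s; rewrite /= h1 h2 /= => /negbT; rewrite -leqNgt.
have reduce v (Q : {set T}) : v \in C -> Q \subset C -> 3 < #|Q| ->
    (forall D : {set T}, D \subset C :\ v -> stuck D -> [disjoint Q & D]) ->
    exists2 D : {set T}, #|D| + 4 <= #|C| & forall m, strategy D m -> strategy C m.+1.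
  move=> vC QC cQ dis; have [D [DC sD ext]] := core_ex (C :\ v).
  exists D; last by move=> m /ext; apply: strategy_node.
  apply: card_drop (dis _ DC sD) cQ => //.
  by apply: subset_trans DC _; apply: subD1set.
pose P := [pred v | [&& v \in C, ~~ S v & 2 < #|[set w in C | nbr v w]|]].
have nbS v w : ~~ S v -> nbr v w -> S w.
  by move=> nS /orP[/bip/andP[]|/bip/andP[]//]; rewrite (negPf nS).
have nbN v w : S v -> nbr v w -> ~~ S w.
  by move=> nS /orP[/bip/andP[]//|/bip/andP[]]; rewrite nS.
(* Sources have degree at most 2 by now, so each one next to the deleted v drops out of every stuck
   subset. *)
have lose v (D : {set T}) : v \in C -> ~~ S v -> D \subset C :\ v -> stuck D ->
    forall w, w \in C -> nbr v w -> w \notin D.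
  move=> vC nS DC sD w wC vw; have DC' : D \subset C by apply: subset_trans DC (subD1set _ _).
  apply: (stuck_drop DC' sD wC vC) (degS _ wC (nbS _ _ nS vw)); first by rewrite nbr_sym.
  by apply/negP => /(subsetP DC); rewrite !inE eqxx.
case: (pickP P) => [v /and3P[vC nS deg]|nd].
  apply: (reduce v (v |: [set w in C | nbr v w]) vC).
  - rewrite subUset sub1set vC /=; apply/subsetP => w; by rewrite inE => /andP[].
  - by rewrite cardsU1 !inE nbr_irr andbF.
  - move=> D DC sD; rewrite -setI_eq0; apply/eqP/setP => x; rewrite !inE.
    apply/negP => /andP[/orP[/eqP->|/andP[xC vx]] xD].
      by have := subsetP DC _ xD; rewrite !inE eqxx.
    by have := lose v D vC nS DC sD x xC vx; rewrite xD.
(* Neighbours lie on opposite sides, so a nonempty stuck set has vertices on both. *)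
have [v vC nS] : exists2 v, v \in C & ~~ S v.
  case: (pickP [pred v | (v \in C) && ~~ S v]) => [v /andP[]|none]; first by exists v.
  exfalso; have [u uC] := set0Pn _ C0.
  have Su : S u by have := none u; rewrite /= uC => /negbFE.
  have /card_gt0P[w] := ltnW (deg2 u uC); rewrite inE => /andP[wC uw].
  by have := none w; rewrite /= wC (nbN _ _ Su uw).
have degN u : u \in C -> ~~ S u -> #|[set w in C | nbr u w]| <= 2.
  by move=> h1 h2; have := nd u; rewrite /= h1 h2 /= => /negbT; rewrite -leqNgt.
have [s1 [s2 [s1C s2C vs1 [vs2 s12]]]] :
    exists s1 s2, [/\ s1 \in C, s2 \in C, nbr v s1 & nbr v s2 /\ s1 != s2].
  case: (pickP [pred x | x \in [set w in C | nbr v w]]) => [s1 |no]; last first.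
    by exfalso; have /card_gt0P[w] := ltnW (deg2 v vC); have := no w; rewrite /= => ->.
  rewrite !inE => /andP[s1C vs1]; exists s1.
  case: (pickP [pred x | x \in ([set w in C | nbr v w] :\ s1)]) => [s2 |no].
    by rewrite !inE => /and3P[ne s2C vs2]; exists s2; split=> //; rewrite eq_sym.
  exfalso; have := deg2 v vC; rewrite (cardsD1 s1) inE s1C vs1 add1n ltnS => /card_gt0P[w].
  by have := no w; rewrite /= => ->.
(* The vertex v' drops out too, as it has degree at most 2 and loses s1. With v, s1 and s2 this
   makes four vertices. *)
have [v' v'C [s1v' v'v]] : exists2 v', v' \in C & nbr s1 v' /\ v' != v.
  case: (pickP [pred x | x \in ([set w in C | nbr s1 w] :\ v)]) => [w |no].
    by rewrite !inE => /and3P[ne wC s1w]; exists w.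
  exfalso; have := deg2 s1 s1C; rewrite (cardsD1 v) inE vC nbr_sym vs1 add1n ltnS => /card_gt0P[w].
  by have := no w; rewrite /= => ->.
have S1 := nbS _ _ nS vs1; have S2 := nbS _ _ nS vs2; have nS' := nbN _ _ S1 s1v'.
have neS x y : S x -> ~~ S y -> x != y by move=> Sx nSy; apply/eqP => E; rewrite -E Sx in nSy.
apply: (reduce v [set v; v'; s1; s2] vC).
- by rewrite !subUset !sub1set vC v'C s1C s2C.
- rewrite (_ : [set v; v'; s1; s2] = s2 |: (s1 |: (v' |: [set v]))); last first.
    by apply/setP => x; rewrite !inE; case: (x == v); case: (x == v'); case: (x == s1); case: (x == s2).
  rewrite !cardsU1 cards1 !inE v'v (negPf (neS _ _ S1 nS')) (negPf (neS _ _ S1 nS)).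
  by rewrite eq_sym (negPf s12) (negPf (neS _ _ S2 nS')) (negPf (neS _ _ S2 nS)).
- move=> D DC sD; have DC' : D \subset C by apply: subset_trans DC (subD1set _ _).
  have h1 := lose v D vC nS DC sD s1 s1C vs1; have h2 := lose v D vC nS DC sD s2 s2C vs2.
  have h3 : v' \notin D.
    apply: (stuck_drop DC' sD v'C s1C) (degN _ v'C nS') => //; by rewrite nbr_sym.
  rewrite -setI_eq0; apply/eqP/setP => x; rewrite !inE; apply/negP => /andP[+ xD].
  case/orP=> [/orP[/orP[]|]|] /eqP E; subst x.
  + by have := subsetP DC _ xD; rewrite !inE eqxx.
  + by rewrite xD in h3.
  + by rewrite xD in h1.
  + by rewrite xD in h2.
Qed.

Lemma strategy_ex (A : {set T}) : strategy A (#|A| %/ 4).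
Proof.
have [n] := ubnP #|A|; elim: n A => // n IH A ltA.
have [C [CA sC ext]] := core_ex A.
have cCA := subset_leq_card CA.
apply: ext; apply: (@strategy_mono _ (#|C| %/ 4)); first exact: leq_div2r.
case: (eqVneq C set0) => [->|C0]; first by rewrite cards0; apply: strategy_set0.
have [D cD ext] := stuck_reduce sC C0.
have lt4 : (#|D| %/ 4).+1 <= #|C| %/ 4.
  by rewrite -addn1 -(@divnDr _ 4 4) //; apply: leq_div2r.
apply: (strategy_mono lt4); apply: ext; apply: IH; lia.
Qed.

End Strategy.

(** * Summation by elimination along a forest *)

Section Elimination.

Local Open Scope ring_scope.

Variables (R : comNzRingType) (T V : finType) (x0 : V).
Variables (Rel : T -> T -> V -> V -> R) (par : T -> option T).

Definition link (phi : T -> V) v : R :=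
  if par v is Some p then Rel v p (phi v) (phi p) else 1.

(* The eliminated vertices [Q] are pinned to [x0]. *)
Definition forest_sum (Q : {set T}) (w : T -> V -> R) : R :=
  \sum_(phi : {ffun T -> V} | [forall u in Q, phi u == x0])
    \prod_(v | v \notin Q) (w v (phi v) * link phi v).

Lemma forest_sum_full w : forest_sum [set: T] w = 1.
Proof.
rewrite /forest_sum (big_pred1 [ffun=> x0]) => [|phi].
  by rewrite big_pred0 // => v; rewrite inE.
apply/forallP/eqP => [h|-> v]; last by rewrite ffunE eqxx implybT.
by apply/ffunP => v; rewrite ffunE; apply/eqP; have := h v; rewrite inE.
Qed.

Lemma forest_sum0 w :
  forest_sum set0 w = \sum_(phi : {ffun T -> V}) \prod_v (w v (phi v) * link phi v).
Proof.
apply: eq_big => [phi|phi _]; first by apply/forallP => v; rewrite inE.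
by apply: eq_bigl => v; rewrite inE.
Qed.

Definition fupd (phi : {ffun T -> V}) v x : {ffun T -> V} :=
  [ffun u => if u == v then x else phi u].

(** An assignment that is free at v amounts to one pinned at v together with a value, which [fupd]
    puts back. *)
Lemma sum_pinned (Q : {set T}) v (F : {ffun T -> V} -> R) : v \notin Q ->
  \sum_(phi : {ffun T -> V} | [forall u in Q, phi u == x0]) F phi =
  \sum_(phi : {ffun T -> V} | [forall u in v |: Q, phi u == x0]) \sum_x F (fupd phi v x).
Proof.
move=> vQ; rewrite pair_big_dep /=.
rewrite (reindex_onto (fun p : {ffun T -> V} * V => fupd p.1 v p.2)
   (fun phi => (fupd phi v x0, phi v))) /=; last first.
  by move=> phi _; apply/ffunP => u; rewrite !ffunE /=; case: eqP => [->|].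
apply: eq_bigl => -[phi x] /=; rewrite andbT ffunE eqxx xpair_eqE eqxx andbT.
apply/andP/forallP => [[/forallP h /eqP E] u|h].
  apply/implyP; rewrite !inE => /orP[/eqP->|uQ]; first by rewrite -E !ffunE eqxx.
  have := h u; rewrite uQ ffunE /=; case: (eqVneq u v) => // Euv.
  by rewrite Euv (negPf vQ) in uQ.
have E : fupd (fupd phi v x) v x0 = phi.
  apply/ffunP => u; rewrite !ffunE; case: eqP => [->|//].
  by have := h v; rewrite !inE eqxx /= => /eqP.
split; last by rewrite E.
apply/forallP => u; apply/implyP => uQ; rewrite ffunE.
have := h u; rewrite !inE uQ orbT /=; case: (eqVneq u v) => // Euv.
by rewrite Euv (negPf vQ) in uQ.
Qed.

(** All children of v are in Q, so phi v occurs only in the weight of v and in the link to its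
    parent. Summing over it gives a function of the value of the parent, absorbed into the new
    weights, or a constant at a root. *)
Lemma forest_sum_step (Q : {set T}) v (w w' : T -> V -> R) (c : R) : v \notin Q ->
  (forall u, par u = Some v -> u \in Q) ->
  match par v with
  | Some p => [/\ p \notin Q, p != v, c = 1,
      forall y, w' p y = w p y * \sum_x w v x * Rel v p x y
      & forall u y, u != p -> u != v -> w' u y = w u y]
  | None => c = \sum_x w v x /\ forall u y, u != v -> w' u y = w u y
  end ->
  forest_sum Q w = c * forest_sum (v |: Q) w'.
Proof.
move=> vQ hpar hv; rewrite /forest_sum (sum_pinned _ vQ) big_distrr /=.
apply: eq_bigr => phi _.
pose rest := \prod_(u | u \notin v |: Q) (w u (phi u) * link phi u).
have split_prod x : \prod_(u | u \notin Q) (w u (fupd phi v x u) * link (fupd phi v x) u)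
   = w v x * link (fupd phi v x) v * rest.
  rewrite (bigD1 v) //= ffunE eqxx; congr (_ * _).
  apply: eq_big => [u|u /andP[uQ uv]]; first by rewrite !inE negb_or andbC.
  rewrite ffunE (negPf uv) /link; case E: (par u) => [p|//].
  rewrite !ffunE (negPf uv); case: eqP => // pv; rewrite pv in E.
  by rewrite (hpar _ E) in uQ.
rewrite (eq_bigr _ (fun x _ => split_prod x)) -big_distrl /=.
move: hv; rewrite /link; case E: (par v) => [p|] => [[pQ pv -> hp hw]|[-> hw]].
  have restE (f : T -> R) : \prod_(u | u \notin v |: Q) f u =
      f p * \prod_(u | (u \notin v |: Q) && (u != p)) f u.
    by apply: bigD1; rewrite !inE negb_or pv.
  rewrite mul1r /rest !restE hp.
  have -> : \sum_x w v x * (if Some p is Some p' then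
      Rel v p' (fupd phi v x v) (fupd phi v x p') else 1) =
      \sum_x w v x * Rel v p x (phi p).
    by apply: eq_bigr => x _; rewrite !ffunE eqxx (negPf pv).
  rewrite [in RHS](eq_bigr (fun u => w u (phi u) * link phi u)) => [|u].
    by rewrite /link; ring.
  by rewrite !inE negb_or => /andP[/andP[uv uQ] up]; rewrite hw.
congr (_ * _); first by apply: eq_bigr => x _; rewrite mulr1.
by apply: eq_bigr => u; rewrite !inE negb_or => /andP[uv uQ]; rewrite hw.
Qed.

End Elimination.

(** * Copies and injective homomorphisms *)

Section Copies.

Variables (k n : nat) (H : sgraph k) (G : sgraph n).
Implicit Types (phi : {ffun 'I_k -> 'I_n}) (F : subgraph n).

Definition is_hom phi : bool := [forall u, forall v, adj H u v ==> adj G (phi u) (phi v)].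

Definition aut : nat :=
  #|[set s : {ffun 'I_k -> 'I_k} | injectiveb s &
     [forall u, forall v, adj H u v == adj H (s u) (s v)]]|.

Definition image_graph phi : subgraph n :=
  (phi @: [set: 'I_k], [set [set phi p.1; phi p.2] | p : 'I_k * 'I_k & adj H p.1 p.2]).

Lemma set2_inj (T : finType) (a b c d : T) : [set a; b] = [set c; d] ->
  (a = c /\ b = d) \/ (a = d /\ b = c).
Proof.
move=> E; have : a \in [set c; d] by rewrite -E set21.
have : b \in [set c; d] by rewrite -E set22.
have : c \in [set a; b] by rewrite E set21.
have : d \in [set a; b] by rewrite E set22.
by rewrite !inE => /orP[] /eqP ? /orP[] /eqP ? /orP[] /eqP ? /orP[] /eqP ?; subst; auto.
Qed.

Lemma edge_setE a b : ([set a; b] \in edges G) = adj G a b.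
Proof.
apply/imsetP/idP => [[[c d]]|ab]; last by exists (a, b); rewrite ?inE.
by rewrite inE /= => cd /set2_inj[] [-> ->]; rewrite // adj_sym.
Qed.

Lemma image_edgeE phi u v : injective phi ->
  ([set phi u; phi v] \in (image_graph phi).2) = adj H u v.
Proof.
move=> inj; apply/imsetP/idP => [[[c d]]|uv]; last by exists (u, v); rewrite ?inE.
by rewrite inE /= => cd /set2_inj[] [/inj-> /inj->]; rewrite // adj_sym.
Qed.

Lemma image_graph_copy phi : injective phi -> is_hom phi -> copy H G (image_graph phi).
Proof.
move=> inj /forallP hm; apply/andP; split.
  apply/andP; split; first apply/subsetP; last apply/forall_inP.
    move=> e /imsetP[[u v]]; rewrite inE /= => uv ->; rewrite edge_setE.
    by have /forallP/(_ v)/implyP := hm u; apply.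
  move=> e /imsetP[[u v]]; rewrite inE /= => uv ->.
  by rewrite subUset !sub1set !imset_f.
apply/existsP; exists phi; apply/and3P; split=> //; first exact/injectiveP.
by apply/forallP => u; apply/forallP => v; rewrite image_edgeE.
Qed.

Lemma copy_image_graph F : copy H G F ->
  exists phi, [/\ injective phi, is_hom phi & image_graph phi = F].
Proof.
case/andP=> /andP[/subsetP sE /forall_inP sV] /existsP[phi /and3P[/injectiveP inj /eqP im]].
move/forallP => hE; have hadj u v : adj H u v = ([set phi u; phi v] \in F.2).
  by apply/eqP; have /forallP := hE u; apply.
exists phi; split=> //.
  apply/forallP => u; apply/forallP => v; apply/implyP.
  by rewrite hadj => /sE; rewrite edge_setE.
rewrite /image_graph im [RHS]surjective_pairing; congr (_, _).
apply/setP => e; apply/imsetP/idP => [[[u v]]|eF].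
  by rewrite inE /= hadj => uv ->.
have /imsetP[[a b]] := sE _ eF; rewrite inE /= => ab E.
have := sV _ eF; rewrite E subUset !sub1set -im.
case/andP=> /imsetP[u _ Eu] /imsetP[v _ Ev].
by exists (u, v); rewrite ?inE /= ?hadj -?Eu -?Ev -?E.
Qed.

(** Embeddings with the same image graph differ by an automorphism of H, obtained by inverting phi
    on its image. *)
Lemma card_image_fiber phi : injective phi -> is_hom phi ->
  #|[set psi : {ffun 'I_k -> 'I_n} |
     [&& injectiveb psi, is_hom psi & image_graph psi == image_graph phi]]| = aut.
Proof.
move=> inj hm; rewrite /aut.
have injc : injective (fun s : {ffun 'I_k -> 'I_k} => [ffun u => phi (s u)]).
  by move=> s t /ffunP E; apply/ffunP => u; apply: inj; have := E u; rewrite !ffunE.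
rewrite -[RHS](card_imset _ injc); apply: eq_card => psi; rewrite !inE.
apply/idP/imsetP => [/and3P[/injectiveP pinj phm /eqP E]|[s]].
  have im u : psi u \in codom phi.
    have : psi u \in (image_graph phi).1 by rewrite -E imset_f.
    by case/imsetP=> w _ ->; apply: codom_f.
  exists [ffun u => iinv (im u)]; last by apply/ffunP => u; rewrite !ffunE f_iinv.
  rewrite !inE; apply/andP; split.
    apply/injectiveP => u v; rewrite !ffunE => Euv; apply: pinj.
    by rewrite -(f_iinv (im u)) -(f_iinv (im v)) Euv.
  apply/forallP => u; apply/forallP => v; rewrite !ffunE.
  by rewrite -(image_edgeE u v pinj) E -(image_edgeE _ _ inj) !f_iinv.
rewrite inE => /andP[/injectiveP sinj /forallP sadj] ->.
have adjs u v : adj H u v = adj H (s u) (s v) by apply/eqP; have /forallP := sadj u; apply.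
have [t st ts] : bijective s by apply: injF_bij.
apply/and3P; split.
- by apply/injectiveP => u v; rewrite !ffunE => /inj/sinj.
- apply/forallP => u; apply/forallP => v; apply/implyP; rewrite adjs !ffunE => a.
  by move: hm => /forallP/(_ (s u))/forallP/(_ (s v))/implyP; apply.
apply/eqP; congr (_, _); apply/setP => x; apply/imsetP/imsetP.
- by case=> u _ ->; exists (s u); rewrite ?ffunE.
- by case=> u _ ->; exists (t u); rewrite ?ffunE ?ts.
- case=> -[u v]; rewrite inE /= => uv ->; exists (s u, s v); rewrite ?inE /= -?adjs //.
  by rewrite !ffunE.
- case=> -[u v]; rewrite inE /= => uv ->; exists (t u, t v); rewrite ?inE /=.
    by rewrite adjs !ts.
  by rewrite !ffunE !ts.
Qed.

(** Every copy is the image graph of exactly [aut H] embeddings. The predicate I lets one proof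
    serve for copies and for induced copies. *)
Lemma card_copies (I : pred (subgraph n)) :
  #|[set phi : {ffun 'I_k -> 'I_n} |
     [&& injectiveb phi, is_hom phi & I (image_graph phi)]]| =
  #|[set F | copy H G F & I F]| * aut.
Proof.
rewrite -sum1_card (partition_big image_graph (fun F => F \in [set F | copy H G F & I F])) /=.
  rewrite -sum_nat_const; apply: eq_bigr => F; rewrite inE => /andP[cF IF].
  have [phi [inj hm E]] := copy_image_graph cF.
  rewrite -(card_image_fiber inj hm) -sum1_card; apply: eq_bigl => psi.
  rewrite !inE E; case: eqP => [->|]; last by rewrite !andbF.
  by rewrite IF !andbT.
move=> phi; rewrite !inE => /and3P[/injectiveP inj hm ->].
by rewrite image_graph_copy.
Qed.

Definition inj_hom : nat := #|[set phi : {ffun 'I_k -> 'I_n} | injectiveb phi & is_hom phi]|.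

Definition ind_hom : nat :=
  #|[set phi : {ffun 'I_k -> 'I_n} | injectiveb phi &
     [forall u, forall v, adj H u v == adj G (phi u) (phi v)]]|.

Lemma inj_homE : inj_hom = sub H G * aut.
Proof.
rewrite /sub (_ : [set F | copy H G F] = [set F | copy H G F & xpredT F]).
  by rewrite -card_copies; apply: eq_card => phi; rewrite !inE andbT.
by apply/setP => F; rewrite !inE andbT.
Qed.

(** For an injective homomorphism, reflecting adjacency means that the image graph has all edges of
    G inside its vertex set. *)
Lemma ind_homE : ind_hom = ind H G * aut.
Proof.
rewrite -card_copies; apply: eq_card => phi; rewrite !inE.
case: injectiveP => //= inj; apply/forallP/andP => [h|[hm /eqP E] u].
  have hadj u v : adj H u v = adj G (phi u) (phi v).
    by apply/eqP; have /forallP := h u; apply.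
  split; first by apply/forallP => u; apply/forallP => v; rewrite hadj implybb.
  apply/eqP/setP => e; rewrite inE; apply/idP/andP => [|[]].
    case/imsetP=> -[u v]; rewrite inE /= => uv ->.
    by rewrite edge_setE -hadj uv subUset !sub1set !imset_f.
  case/imsetP=> -[a b]; rewrite inE /= => ab ->; rewrite subUset !sub1set.
  case/andP=> /imsetP[u _ Eu] /imsetP[v _ Ev]; rewrite Eu Ev in ab *.
  by rewrite image_edgeE // hadj.
apply/forallP => v; rewrite -(image_edgeE u v inj) E inE edge_setE.
by rewrite subUset !sub1set !imset_f //; case: (adj G _ _).

Qed.

Lemma aut_gt0 : 0 < aut.
Proof.
apply/card_gt0P; exists [ffun u => u]; rewrite inE; apply/andP; split.
  by apply/injectiveP => u v; rewrite !ffunE.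
by apply/forallP => u; apply/forallP => v; rewrite !ffunE.
Qed.

End Copies.

(** * Expansion into systems of functional equations *)

Section Expansion.

Local Open Scope ring_scope.

Variables (R : comNzRingType) (k n D : nat) (H : sgraph k) (G : sgraph n).
(* [F l] for [1 <= l <= D] lists the out-neighbours in an orientation of [G],
   vertices being shifted by one to leave 0 for "undefined". *)
Variables (F : nat -> nat -> nat) (oarc : rel 'I_n).
Hypothesis adjE : forall x y, (adj G x y : nat) = (oarc x y + oarc y x)%N.
Hypothesis FE : forall x y : 'I_n,
  (\sum_(1 <= l < D.+1) (F l x.+1 == y.+1))%N = oarc x y.
Hypothesis F_id : forall x : 'I_n, F D.+1 x.+1 = x.+1.

(** For u < v the label 0 is no condition, 1 to D a function applied to phi u, D + 1 equality, and D
    + 1 + l the function l applied to phi v. The last kind is stored at the reversed pair, so that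
    every condition is an arc from argument to value. *)
Definition arc_label (E : nat -> nat -> nat) (u v : nat) : nat :=
  (if u < v then if E u v <= D.+1 then E u v else 0
   else if v < u then E v u - D.+1 else 0)%N.

Definition sat (L : nat -> nat -> nat) (phi : 'I_k -> 'I_n) : bool :=
  [forall u : 'I_k, forall v : 'I_k,
     (L u v != 0%N) ==> (F (L u v) (phi u).+1 == (phi v).+1)].

Definition eq_coef mode : R := if mode is 0%N then 0 else -1.
Definition adj_coef mode : R := if mode is 2%N then -1 else 0.

(** A pair adjacent in H takes the labels of arcs of G with weight 1; any other pair expands 1 -
    [equal] - [adjacent] as far as the mode demands. Digits of pairs with u >= v carry no choice and
    must be 0, so that each choice is counted for one code only. *)
Definition digit_weight mode (u v : 'I_k) (e : nat) : R :=
  if (u < v)%N then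
    if adj H u v then ((e != 0) && (e != D.+1))%N%:R
    else if e != 0%N then (if e == D.+1 then eq_coef mode else adj_coef mode) else 1
  else (e == 0%N)%:R.

Definition count mode : nat :=
  match mode with 0 => hom H G | 1 => inj_hom H G | _ => ind_hom H G end%N.

Lemma prod_bool (I : finType) (b : I -> bool) :
  \prod_i ((b i)%:R : R) = [forall i, b i]%:R.
Proof.
case: forallP => [h|/forallP]; first by rewrite big1 // => i _; rewrite h.
rewrite negb_forall => /existsP[i /negPf bi].
by rewrite (bigD1 i) //= bi mul0r.
Qed.

Definition digit_ok (phi : 'I_k -> 'I_n) (u v : 'I_k) (e : nat) : bool :=
  [|| (v <= u)%N, e == 0%N |
     if (e <= D.+1)%N then F e (phi u).+1 == (phi v).+1
     else F (e - D.+1) (phi v).+1 == (phi u).+1].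

Lemma sat_arc_label (E : nat -> nat -> nat) phi :
  sat (arc_label E) phi = [forall p : 'I_k * 'I_k, digit_ok phi p.1 p.2 (E p.1 p.2)].
Proof.
apply/forallP/forallP => [h [u v]|h u]; rewrite /digit_ok /=.
  case: (leqP v u) => //= uv; case: eqP => //= /eqP e0; case: ifP => e1.
    by have /forallP/(_ v) := h u; rewrite /arc_label uv e1 e0.
  have /forallP/(_ u) := h v; rewrite /arc_label uv ltnNge (ltnW uv) /=.
  by rewrite subn_eq0 e1.
apply/forallP => v; apply/implyP; rewrite /arc_label.
case: (ltngtP u v) => [uv|uv|]; last by [].
  have := h (u, v); rewrite /digit_ok /= leqNgt uv /=.
  by case: ifP => // _ + /negPf e0; rewrite e0.
have := h (v, u); rewrite /digit_ok /= leqNgt uv /= subn_eq0.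
by case: (E v u) => //= e; case: ifP.
Qed.

Lemma sum_arc (x y : 'I_n) :
  \sum_(1 <= l < D.+1) ((F l x.+1 == y.+1)%:R : R) = (oarc x y)%:R.
Proof. by rewrite -FE natr_sum. Qed.

(** By [FE] and [adjE] an edge of G satisfies exactly one label in the two blocks 1, ..., D and D +
    2, ..., 2D + 1, and a non-edge none. Label D + 1 between them contributes the equality term. *)
Lemma pair_sum mode phi (u v : 'I_k) :
  \sum_(e < 2 * D.+1) digit_weight mode u v e * (digit_ok phi u v e)%:R =
  if (u < v)%N then
    if adj H u v then (adj G (phi u) (phi v))%:R
    else 1 + eq_coef mode * (phi u == phi v)%:R +
         adj_coef mode * (adj G (phi u) (phi v))%:R
  else 1 :> R.
Proof.
rewrite -(big_mkord xpredT (fun e => digit_weight mode u v e * (digit_ok phi u v e)%:R)).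
case: (ltnP u v) => [uv|vu]; last first.
  rewrite big_ltn ?muln_gt0 // big_nat big1 => [|e /andP[e0 _]]; last first.
    by rewrite /digit_weight ltnNge vu /= eqn0Ngt e0 mul0r.
  by rewrite /digit_weight /digit_ok ltnNge vu /= mulr1 addr0.
have hN : (D.+1 < 2 * D.+1)%N by lia.
rewrite big_ltn ?muln_gt0 // (@big_cat_nat _ _ _ D.+1) //=; last exact: ltnW.
rewrite [X in _ + (_ + X)]big_ltn //.
have -> : (2 * D.+1 = D + D.+2)%N by lia.
have -> : \sum_(D.+2 <= i < D + D.+2) digit_weight mode u v i * (digit_ok phi u v i)%:R =
   \sum_(1 <= i < D.+1) digit_weight mode u v (i + D.+1) * (digit_ok phi u v (i + D.+1))%:R.
  by rewrite -[D.+2]/(1 + D.+1)%N big_addn (_ : (D + (1 + D.+1) - D.+1 = D.+1)%N) //; lia.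
rewrite [in X in _ + (X + _)]big_nat [in X in _ + (_ + (_ + X))]big_nat.
have okl i : (1 <= i < D.+1)%N -> digit_ok phi u v i = (F i (phi u).+1 == (phi v).+1).
  by case/andP=> i0 iD; rewrite /digit_ok leqNgt uv eqn0Ngt i0 (ltnW iD).
have okr i : (1 <= i < D.+1)%N -> digit_ok phi u v (i + D.+1) = (F i (phi v).+1 == (phi u).+1).
  case/andP=> i0 iD; rewrite /digit_ok leqNgt uv addnS /= -addnS addnK.
  by rewrite leqNgt -addn1 addnC leq_add2r i0.
have ok0 : digit_ok phi u v 0 by rewrite /digit_ok orbT.
have okm : digit_ok phi u v D.+1 = (phi u == phi v).
  by rewrite /digit_ok leqNgt uv leqnn F_id eqSS.
rewrite ok0 okm /digit_weight uv /=.
case: ifP => _; rewrite ?mulr1 ?add0r ?eqxx ?andbF ?mul0r.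
  rewrite (eq_bigr (fun i => (F i (phi u).+1 == (phi v).+1)%:R)) => [|i hi]; last first.
    by rewrite okl //; case/andP: hi => i0 iD; rewrite -lt0n i0 ltn_eqF // mul1r.
  rewrite [X in _ + (_ + X)](eq_bigr (fun i => (F i (phi v).+1 == (phi u).+1)%:R)) => [|i hi]; last first.
    rewrite okr //; case/andP: hi => i0 iD; rewrite addn_eq0 andbF.
    by rewrite gtn_eqF ?mul1r // -[X in (X < _)%N]add0n ltn_add2r.
  by rewrite -!big_nat !sum_arc add0r adjE natrD.
rewrite (eq_bigr (fun i => adj_coef mode * (F i (phi u).+1 == (phi v).+1)%:R)) => [|i hi]; last first.
  by rewrite okl //; case/andP: hi => i0 iD; rewrite -lt0n i0 ltn_eqF.
rewrite [X in _ + (_ + (_ + X))](eq_bigr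
   (fun i => adj_coef mode * (F i (phi v).+1 == (phi u).+1)%:R)) => [|i hi]; last first.
  rewrite okr //; case/andP: hi => i0 iD; rewrite addn_eq0 andbF.
  by rewrite gtn_eqF // -[X in (X < _)%N]add0n ltn_add2r.
rewrite -!big_nat -!big_distrr /= !sum_arc adjE natrD.
ring.
Qed.

(** Equality and adjacency exclude each other, so 1 - [equal] - [adjacent] takes only the values 0
    and 1 and is the indicator of their failure. *)
Lemma count_factor mode (phi : {ffun 'I_k -> 'I_n}) : (mode < 3)%N ->
  \prod_(p : 'I_k * 'I_k)
    (if (p.1 < p.2)%N then
      if adj H p.1 p.2 then (adj G (phi p.1) (phi p.2))%:R
      else 1 + eq_coef mode * (phi p.1 == phi p.2)%:R +
           adj_coef mode * (adj G (phi p.1) (phi p.2))%:R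
     else 1 : R) =
  (match mode with
   | 0%N => is_hom H G phi
   | 1%N => injectiveb phi && is_hom H G phi
   | _ => injectiveb phi && [forall u, forall v, adj H u v == adj G (phi u) (phi v)]
   end)%:R.
Proof.
have neq_adj x y : adj G x y -> x != y by move=> a; apply/eqP => E; rewrite E adj_irr in a.
pose test mode (p : 'I_k * 'I_k) := (p.1 < p.2)%N ==>
  if adj H p.1 p.2 then adj G (phi p.1) (phi p.2)
  else ((mode == 0%N) || (phi p.1 != phi p.2)) &&
       ((mode != 2) || ~~ adj G (phi p.1) (phi p.2)).
move=> m3; rewrite (eq_bigr (fun p => (test mode p)%:R)) => [|[u v] _]; last first.
  rewrite /test /=; case: ifP => //= uv; case: ifP => // _.
  case: mode m3 => [|[|[|//]]] _ /=; rewrite ?mul0r ?addr0 ?andbT ?mulN1r //.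
    by case: eqP => _; rewrite ?subrr ?subr0.
  case: eqVneq => [->|ne]; first by rewrite adj_irr /= subr0 subrr.
  by rewrite subr0; case: (adj _ _ _); rewrite ?subrr ?subr0.
rewrite prod_bool; congr (_%:R).
have sym_test (P : 'I_k -> 'I_k -> bool) :
    (forall u v, P u v = P v u) -> (forall u, P u u) ->
    (forall u v : 'I_k, (u < v)%N -> P u v) -> forall u v, P u v.
  move=> sP rP lP u v; case: (ltngtP u v) => [|/lP|/val_inj->//]; first exact: lP.
  by rewrite sP.
have homE : (forall u v : 'I_k, (u < v)%N -> adj H u v -> adj G (phi u) (phi v)) ->
    is_hom H G phi.
  move=> h; apply/forallP => u; apply/forallP => v; move: u v; apply: sym_test => [u v|u|u v uv].
  - by rewrite (adj_sym H) (adj_sym G).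
  - by rewrite adj_irr.
  - by apply/implyP; apply: h.
have homP : is_hom H G phi -> forall u v, adj H u v -> adj G (phi u) (phi v).
  by move=> /forallP h u v; have /forallP/(_ v)/implyP := h u.
have injE : (forall u v : 'I_k, (u < v)%N -> phi u != phi v) -> injectiveb phi.
  move=> h; apply/injectiveP => u v /eqP; apply: contraTeq => ne.
  by case: (ltngtP u v) (h u v) (h v u) => [_ -> //|_ _|/val_inj E]; [rewrite eq_sym => ->|rewrite E eqxx in ne].
case: mode m3 @test => [|[|[|//]]] _ /=; congr (nat_of_bool _).
- apply/forallP/idP => [h|/homP h [u v]]; last by apply/implyP => _; case: ifP => //= /h.
  by apply: homE => u v uv a; have := h (u, v); rewrite /= uv a.
- apply/forallP/andP => [h|[/injectiveP inj /homP h] [u v]]; last first.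
    apply/implyP => /= uv; case: ifP => [/h //|_]; rewrite andbT; apply/eqP => /inj E.
    by rewrite E ltnn in uv.
  split; last by apply: homE => u v uv a; have := h (u, v); rewrite /= uv a.
  apply: injE => u v uv; have := h (u, v); rewrite /= uv.
  by case: ifP => [_ /neq_adj //|_ /andP[]].
- apply/forallP/andP => [h|[/injectiveP inj /forallP h] [u v]]; last first.
    have -> : adj H u v = adj G (phi u) (phi v) by apply/eqP; have /forallP := h u; apply.
    apply/implyP => /= uv; case: ifP => // a; apply/andP; split; rewrite ?a //.
    apply/eqP => /inj E.
    by rewrite E ltnn in uv.
  split.
    apply: injE => u v uv; have := h (u, v); rewrite /= uv.
    by case: ifP => [_ /neq_adj //|_ /andP[]].
  apply/forallP => u; apply/forallP => v; move: u v; apply: sym_test => [u v|u|u v uv].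
  - by rewrite (adj_sym H) (adj_sym G).
  - by rewrite !adj_irr.
  - by have := h (u, v); rewrite /= uv /=; case: ifP => [_ ->//|_ /andP[_ /negPf->]].
Qed.

(** The product over pairs of the sums over labels is multiplied out, and the sums over maps and
    over label matrices are exchanged. *)
Lemma count_expansion mode : (mode < 3)%N ->
  \sum_(E : {ffun 'I_k * 'I_k -> 'I_(2 * D.+1)})
    (\prod_(p : 'I_k * 'I_k) digit_weight mode p.1 p.2 (E p)) *
    (\sum_(phi : {ffun 'I_k -> 'I_n})
       [forall p : 'I_k * 'I_k, digit_ok phi p.1 p.2 (E p)]%:R) =
  (count mode)%:R.
Proof.
move=> m3; under eq_bigr => E _ do rewrite big_distrr /=.
rewrite exchange_big /=.
have -> : (count mode)%:R = \sum_(phi : {ffun 'I_k -> 'I_n})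
  (match mode with
   | 0%N => is_hom H G phi
   | 1%N => injectiveb phi && is_hom H G phi
   | _ => injectiveb phi && [forall u, forall v, adj H u v == adj G (phi u) (phi v)]
   end)%:R :> R.
  have ifb (b : bool) : (if b then 1 else 0)%N = b by case: b.
  rewrite -natr_sum; congr (_%:R).
  by case: mode m3 => [|[|[|//]]] _;
    rewrite /= ?/hom ?/inj_hom ?/ind_hom -sum1_card big_mkcond; apply: eq_bigr => phi _;
    rewrite inE; exact: ifb.
apply: eq_bigr => phi _; rewrite -count_factor //.
under [RHS]eq_bigr => p _ do rewrite -pair_sum.
rewrite bigA_distr_bigA /=; apply: eq_bigr => E _.
by rewrite big_split /= prod_bool.
Qed.

End Expansion.

(** * Mixed radix numeration *)

Section Radix.

Variable b : nat -> nat.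

Definition place i := \prod_(j < i) b j.
Definition digit i c := (c %/ place i) %% b i.

Lemma placeS i : place i.+1 = place i * b i.
Proof. by rewrite /place big_ord_recr. Qed.

Lemma place_dvd i m : i <= m -> place i %| place m.
Proof.
elim: m => [|m IH]; first by rewrite leqn0 => /eqP->.
rewrite leq_eqVlt => /orP[/eqP-> //|]; rewrite ltnS => /IH d.
by rewrite placeS dvdn_mulr.
Qed.

Lemma digit_low i m q r : i < m -> digit i (q * place m + r) = digit i r.
Proof.
move=> lt_im; rewrite /digit; have /dvdnP[d ->] := place_dvd lt_im.
rewrite placeS [place i * _]mulnC !mulnA.
have [->|P0] := posnP (place i); first by rewrite !muln0.
by rewrite divnMDl // modnMDl.
Qed.

(** Stated as a sum, so that it can replace the 1 contributed by an object that is compatible with a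
    single code. *)
Lemma digit_unique m (t : nat -> nat) : (forall i, i < m -> t i < b i) ->
  \sum_(c < place m) [forall i : 'I_m, digit i c == t i] = 1.
Proof.
elim: m => [|m IH] ht.
  by rewrite /place big_ord0 big_ord1; case: forallP => // -[] [].
have tb : t m < b m by apply: ht.
have ht' i : i < m -> t i < b i by move=> lt_im; apply: ht; apply: leq_trans lt_im _.
have M0 : 0 < place m.
  by rewrite /place prodn_gt0 // => i; apply: leq_ltn_trans (ht' i (ltn_ord i)).
rewrite placeS mulnC.
pose f (c : nat) : nat := [forall i : 'I_m.+1, digit i c == t i].
rewrite -(big_mkord xpredT f) mulnC.
(* A code is [q * place m + r], where q is the top digit and r carries the others. *)
have -> : \sum_(0 <= c < place m * b m) f c =
   \sum_(q < b m) \sum_(r < place m) f (q * place m + r).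
  rewrite mulnC; elim: (b m) => [|q IHq]; first by rewrite big_ord0 big_geq.
  rewrite big_ord_recr /= -IHq mulSn addnC (@big_cat_nat _ _ _ (q * place m)) //=; last first.
    exact: leq_addr.
  congr (_ + _); rewrite -{1}[q * place m]add0n big_addn addKn big_mkord.
  by apply: eq_bigr => r _; rewrite addnC.
have fE q r : q < b m -> r < place m ->
    f (q * place m + r) = (q == t m) && [forall i : 'I_m, digit i r == t i].
  move=> ltq ltr; rewrite /f; apply: (congr1 nat_of_bool).
  have dm : digit m (q * place m + r) = q.
    by rewrite /digit divnMDl // divn_small // addn0 modn_small.
  apply/forallP/andP => [h|[/eqP qt /forallP h] i].
    split; first by rewrite -{1}dm; have := h ord_max.
    by apply/forallP => i; have := h (widen_ord (leqnSn m) i); rewrite /= digit_low ?ltn_ord.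
  case: (ltnP i m) => im; first by rewrite digit_low //; apply: (h (Ordinal im)).
  have -> : i = m :> nat by apply/eqP; rewrite eqn_leq im -ltnS ltn_ord.
  by rewrite dm qt.
rewrite (bigD1 (Ordinal tb)) //= [X in _ + X]big1 => [|q qt]; last first.
  move: qt; rewrite -val_eqE /= => /negPf qt.
  by rewrite big1 // => r _; rewrite fE // qt.
rewrite addn0 -[RHS](IH ht'); apply: eq_bigr => r _.
by rewrite fE // eqxx.
Qed.

End Radix.

(** * Counting the solutions of a system along a strategy *)

Section Evaluation.

Variables (R : comNzRingType) (k n : nat).
Variables (L F : nat -> nat -> nat) (psi : nat -> nat -> nat -> nat).

Definition arc_rel : rel 'I_k := [rel u v : 'I_k | L u v != 0].

Definition solution (phi : 'I_k -> nat) : Prop :=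
  forall u v : 'I_k, L u v != 0 -> F (L u v) (phi u) = phi v.

(* [psi s x v] is 0 if [v] is out of reach from [s], and otherwise one more
   than the value of [v] that is forced by the value [x] of [s]. *)
Hypothesis psi_reach : forall (s v : 'I_k) x, x <= n ->
  (psi s x v != 0) = connect arc_rel s v.
Hypothesis psi_root : forall (s : 'I_k) x, x <= n -> psi s x s = x.+1.
Hypothesis psi_val : forall (phi : 'I_k -> nat) (s v : 'I_k), phi s <= n ->
  solution phi -> connect arc_rel s v -> psi s (phi s) v = (phi v).+1.

Variables (fx sr : nat -> bool) (dt pr rk : nat -> nat).

Definition bedge s v : bool := [&& sr s, ~~ sr v & psi s 0 v != 0].

Definition known v : bool := fx v || (dt v < k).

Definition good s x : bool :=
  [forall u : 'I_k, forall v : 'I_k, (psi s x v != 1) &&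
     (((L u v != 0) && (psi s x u != 0)) ==>
        (psi s x v == (F (L u v) (psi s x u).-1).+1))].

(** The second and third clauses say that the representatives reach everything and do not reach one
    another; the other clauses express an elimination strategy for [bedge]. *)
Definition valid : bool :=
  [&& 4 * (\sum_(v < k) fx v) <= k,
      [forall v : 'I_k, exists s : 'I_k, sr s && (psi s 0 v != 0)],
      [forall s : 'I_k, forall t : 'I_k, [&& sr s, sr t & psi s 0 t != 0] ==> (s == t)],
      [forall v : 'I_k, (dt v < k) ==> [&& ~~ fx v, fx (dt v) & bedge (dt v) v]],
      [forall v : 'I_k, (pr v < k) ==> (rk v < rk (pr v))]
    & [forall s : 'I_k, forall v : 'I_k, bedge s v ==>
         ((known s || known v) || ((pr s == v) || (pr v == s)))]].

Definition radix v : nat := if fx v then n else 1.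

Definition value a v : nat := if fx v then (digit radix v a).+1 else 0.

Definition dvalue (vl : nat -> nat) v : nat :=
  if dt v < k then (psi (dt v) (vl (dt v)) v).-1 else vl v.

Definition vertex_ok vl v y : bool :=
  [&& y != 0, known v ==> (y == dvalue vl v), sr v ==> good v y &
   [forall u : 'I_k,
     ((known u && bedge u v) ==> (psi u (dvalue vl u) v == y.+1)) &&
     ((known u && bedge v u) ==> ((psi v y u).-1 == dvalue vl u))]].

Definition edge_ok v x p y : bool :=
  (bedge v p ==> (psi v x p == y.+1)) && (bedge p v ==> (psi p y v == x.+1)).

Definition all_ok vl (phi : 'I_k -> 'I_n.+1) : bool :=
  [forall v : 'I_k, vertex_ok vl v (phi v) &&
     (if insub (pr v) is Some p then edge_ok v (phi v) (p : 'I_k) (phi p) else true)].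

Definition solutionb (phi : 'I_k -> nat) : bool :=
  [forall u : 'I_k, forall v : 'I_k, (L u v != 0) ==> (F (L u v) (phi u) == phi v)].

Lemma solutionP phi : reflect (solution phi) (solutionb phi).
Proof.
apply: (iffP forallP) => [h u v|h u]; first by move/forallP: (h u) => /(_ v)/implyP h' /h'/eqP.
by apply/forallP => v; apply/implyP => /h/eqP.
Qed.

(** Each edge from a representative is checked through a known end or along the forest, so every
    representative forces exactly phi on what it reaches. As every vertex is reached and [good]
    covers the arcs leaving reached vertices, phi is a solution. Conversely, values forced by a
    value of a solution are values of that solution, so it passes all tests. *)
Lemma all_okE vl (phi : 'I_k -> 'I_n.+1) : valid ->
  all_ok vl phi = [&& [forall v, phi v != 0 :> nat],
    [forall v : 'I_k, fx v ==> (vl v == phi v)] & solutionb phi].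
Proof.
case/and5P=> _ /forallP V2 /forallP V3 /forallP V4 /andP[/forallP V5 /forallP V6].
have phin v : phi v <= n by rewrite -ltnS.
have fx_dv v : fx v -> v < k -> dvalue vl v = vl v.
  move=> fv lt_vk; rewrite /dvalue; case: ifP => // dk.
  by have := V4 (Ordinal lt_vk); rewrite /= dk fv.
apply/forallP/and3P => [h|[/forallP nz /forallP fxE /solutionP sol] v].
  have ok (v : 'I_k) : vertex_ok vl v (phi v) by case/andP: (h v).
  have dvE (v : 'I_k) : known v -> dvalue vl v = phi v.
    by move=> kv; have /and4P[_ /implyP/(_ kv)/eqP-> _ _] := ok v.
  have psiE (s v : 'I_k) : sr s -> psi s 0 v != 0 -> psi s (phi s) v = (phi v).+1.
    move=> ss sv; case: (eqVneq s v) => [<-|nsv]; first exact: psi_root.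
    have be : bedge s v.
      rewrite /bedge ss sv andbT /=; apply: contra nsv => sv'.
      by have /forallP/(_ v) := V3 s; rewrite ss sv' sv.
    have /forallP/(_ v) := V6 s; rewrite be /=.
    case/orP=> [/orP[ks|kv]|/orP[/eqP ps|/eqP pv]].
    - have /and4P[_ _ _ /forallP/(_ s)] := ok v.
      by rewrite ks be /= => /andP[/eqP <-]; rewrite dvE.
    - have /and4P[_ _ _ /forallP/(_ v)] := ok s.
      rewrite kv be /= => /andP[_ /eqP]; rewrite dvE // => <-.
      (* Whether [psi s x v] vanishes does not depend on x, so that comparing predecessors loses
         nothing. *)
      by rewrite prednK // lt0n psi_reach // -(psi_reach s v (leq0n n)).
    - have /andP[_] := h s; rewrite ps valK => /andP[].
      by rewrite be => /eqP.
    - have /andP[_] := h v; rewrite pv valK => /andP[_].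
      by rewrite be => /eqP.
  split.
  - by apply/forallP => v; case/and4P: (ok v).
  - apply/forallP => v; apply/implyP => fv.
    by rewrite -dvE ?fx_dv // /known fv.
  apply/solutionP => u v uv; have /existsP[s /andP[ss su]] := V2 u.
  have /and4P[_ _ /implyP/(_ ss)/forallP/(_ u)/forallP/(_ v)/andP[_] + _] := ok s.
  have pu := psiE _ _ ss su; rewrite uv pu /= => /eqP pv.
  have sv : psi s 0 v != 0 by rewrite psi_reach // -(psi_reach s v (phin s)) pv.
  by have := psiE _ _ ss sv; rewrite pv => -[].
have psiE (s w : 'I_k) : psi s 0 w != 0 -> psi s (phi s) w = (phi w).+1.
  by rewrite psi_reach // => sw; apply: (psi_val (phin s) sol sw).
have fxE' u : fx u -> forall lt_uk : u < k, vl u = phi (Ordinal lt_uk).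
  by move=> fu lt_uk; have := fxE (Ordinal lt_uk); rewrite /= fu => /eqP.
have dvE (u : 'I_k) : known u -> dvalue vl u = phi u.
  case/orP=> [fu|dk]; first by rewrite fx_dv // (fxE' u fu (ltn_ord u)); congr (val (phi _)); apply: val_inj.
  rewrite /dvalue dk; have := V4 u; rewrite dk /= => /and3P[_ fd /and3P[_ _ sd]].
  by rewrite (fxE' _ fd dk) (psiE (Ordinal dk)).
apply/andP; split.
  apply/and4P; split.
  - exact: nz.
  - by apply/implyP => kv; rewrite dvE.
  - apply/implyP => _; apply/forallP => u; apply/forallP => w.
    apply/andP; split.
      case: (eqVneq (psi v (phi v) w) 0) => [->//|]; rewrite psi_reach // => vw.
      by rewrite (psi_val (phin v) sol vw) eqSS.
    apply/implyP => /andP[uw]; rewrite psi_reach // => vu.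
    have vw : connect arc_rel v w by apply: connect_trans vu (connect1 _).
    by rewrite (psi_val (phin v) sol vu) (psi_val (phin v) sol vw) /= sol.
  - apply/forallP => u; apply/andP; split.
      by apply/implyP => /andP[ku /and3P[_ _ uv]]; rewrite dvE // psiE.
    by apply/implyP => /andP[ku /and3P[_ _ uv]]; rewrite dvE // psiE.
case: insubP => // p _ _; rewrite /edge_ok; apply/andP; split.
  by apply/implyP => /and3P[_ _ vp]; rewrite psiE.
by apply/implyP => /and3P[_ _ pv]; rewrite psiE.
Qed.

Local Open Scope ring_scope.

Definition par_of (v : 'I_k) : option 'I_k := insub (pr v).
Definition vertex_weight vl (v : 'I_k) (y : 'I_n.+1) : R := (vertex_ok vl v y)%:R.
Definition edge_weight (v p : 'I_k) (x y : 'I_n.+1) : R := (edge_ok v x p y)%:R.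

Lemma forest_sum_ok vl : forest_sum ord0 edge_weight par_of set0 (vertex_weight vl) =
  \sum_(phi : {ffun 'I_k -> 'I_n.+1}) (all_ok vl phi)%:R.
Proof.
rewrite forest_sum0; apply: eq_bigr => phi _; rewrite /all_ok -prod_bool.
apply: eq_bigr => v _; rewrite /vertex_weight /link /par_of /edge_weight.
by case: insub => [p|]; rewrite ?andbT ?mulr1 // -natrM mulnb.
Qed.

(** A solution is compatible with exactly one assignment to the fixed vertices, its own restriction,
    so it is counted once. *)
Lemma sum_solution : valid ->
  \sum_(a < place radix k)
    forest_sum ord0 edge_weight par_of set0 (vertex_weight (value a)) =
  (\sum_(phi : {ffun 'I_k -> 'I_n}) sat F L phi)%N%:R.
Proof.
move=> V; under eq_bigr => a _ do rewrite forest_sum_ok.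
rewrite exchange_big /= natr_sum.
pose nzb (phi : {ffun 'I_k -> 'I_n.+1}) := [forall v, phi v != 0%N :> nat].
pose sol (phi : {ffun 'I_k -> 'I_n.+1}) := solutionb (phi : 'I_k -> 'I_n.+1).
rewrite (eq_bigr (fun phi : {ffun 'I_k -> 'I_n.+1} => (nzb phi && sol phi)%:R)); last first.
  move=> phi _; case nz: (nzb phi); last first.
    by rewrite big1 // => a _; rewrite all_okE // -/(nzb phi) nz.
  case so: (sol phi); last first.
    by rewrite big1 // => a _; rewrite all_okE // -/(sol phi) so !andbF.
  (* The digits of the code that belongs to phi: values are shifted back by one, and a vertex that
     is not fixed has radix 1 and digit 0. *)
  pose t v := if insub v is Some u then (if fx v then (phi (u : 'I_k)).-1 else 0)%N else 0%N.
  have ht v : (v < k)%N -> (t v < radix v)%N.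
    move=> lt_vk; rewrite /t /radix insubT /=; case: ifP => // _.
    rewrite -[eqtype.Sub v lt_vk]/(Ordinal lt_vk).
    by have := forallP nz (Ordinal lt_vk); have := ltn_ord (phi (Ordinal lt_vk)); lia.
  rewrite -[RHS](congr1 (fun m => m%:R : R) (digit_unique ht)) natr_sum.
  apply: eq_bigr => a _; congr (_%:R); apply: (congr1 nat_of_bool).
  rewrite all_okE // -/(nzb phi) -/(sol phi) nz so andbT /=.
  apply: eq_forallb => v; rewrite /t valK /value /radix.
  have := forallP nz v; case fv: (fx v) => /=; last by rewrite /digit fv modn1.
  by case: (nat_of_ord (phi v)) => // y _; rewrite eqSS.
rewrite -!natr_sum; congr (_%:R).
have ifb (b : bool) : (b : nat) = (if b then 1 else 0)%N by case: b.
pose h (psi' : {ffun 'I_k -> 'I_n}) : {ffun 'I_k -> 'I_n.+1} := [ffun v => lift ord0 (psi' v)].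
have inj_h : injective h.
  move=> f g /ffunP E; apply/ffunP => v; have := E v; rewrite !ffunE.
  exact: lift_inj.
transitivity #|[set phi : {ffun 'I_k -> 'I_n.+1} | nzb phi && sol phi]|.
  by rewrite -sum1_card [RHS]big_mkcond; apply: eq_bigr => phi _; rewrite inE ifb.
transitivity #|h @: [set phi : {ffun 'I_k -> 'I_n} | sat F L phi]|; last first.
  rewrite card_imset // -sum1_card big_mkcond; apply: eq_bigr => phi _.
  by rewrite inE ifb.
apply: eq_card => phi; rewrite inE.
have hE (f : {ffun 'I_k -> 'I_n}) v : h f v = (f v).+1 :> nat by rewrite ffunE.
apply/andP/imsetP => [[/forallP nz /solutionP so]|[f]].
  have lt_n v : ((phi v).-1 < n)%N.
    by have := nz v; have := ltn_ord (phi v); case: (nat_of_ord (phi v)).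
  have E : phi = h [ffun v => Ordinal (lt_n v)].
    apply/ffunP => v; apply: val_inj; rewrite /= hE ffunE /=.
    by rewrite prednK // lt0n.
  exists [ffun v => Ordinal (lt_n v)] => //; rewrite inE.
  apply/forallP => u; apply/forallP => v; apply/implyP => uv.
  by rewrite -!hE -E so.
rewrite inE => /forallP so ->; split.
  by apply/forallP => v; rewrite hE.
apply/forallP => u; apply/forallP => v; rewrite !hE.
by have /forallP := so u; apply.
Qed.

Lemma place_radix : valid -> (place radix k <= maxn 1 n ^ (k %/ 4))%N.
Proof.
case/andP=> V1 _.
have -> : (maxn 1 n ^ (k %/ 4) = maxn 1 n ^ (k %/ 4 - \sum_(v < k) fx v) *
    maxn 1 n ^ \sum_(v < k) fx v)%N.
  by rewrite -expnD subnK // leq_divRL // mulnC.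
apply: leq_trans (leq_pmull _ _); last by rewrite expn_gt0 leq_max.
rewrite expn_sum /place; elim/big_ind2: _ => // [a b c d|i _]; first exact: leq_mul.
by rewrite /radix; case: (fx i); rewrite ?expn1 ?leq_maxr.
Qed.

End Evaluation.

(** * Existence of a valid strategy code *)

Section StrategyCode.

Variables (k n : nat) (L : nat -> nat -> nat) (psi : nat -> nat -> nat -> nat).
Hypothesis psi_reach : forall (s v : 'I_k) x, x <= n ->
  (psi s x v != 0) = connect (arc_rel L) s v.

Let reach : rel 'I_k := connect (arc_rel L).

(** The least vertex of a strongly connected component that no arc enters from outside. *)
Definition least_source (s : 'I_k) : bool :=
  [forall u : 'I_k, reach u s ==> (reach s u && (s <= u))].

(** An ancestor m of v with the fewest ancestors lies in a source component, because each ancestor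
    of m has the same ancestors as m. *)
Lemma least_source_cover (v : 'I_k) : exists2 s, least_source s & reach s v.
Proof.
pose up w := #|[set u | reach u w]|.
have hP : reach v v by apply: connect0.
case: (@arg_minnP _ v (fun u => reach u v) up hP) => m mv min_m.
case: (@arg_minnP _ m (fun u => reach u m) (fun u : 'I_k => u : nat) (connect0 _ m)) => s sm min_s.
exists s; last exact: connect_trans sm mv.
apply/forallP => u; apply/implyP => us.
have um : reach u m by apply: connect_trans us sm.
rewrite min_s // andbT.
have sub_u : [set w | reach w u] \subset [set w | reach w m].
  by apply/subsetP => w; rewrite !inE => wu; apply: connect_trans wu um.
have /eqP E : [set w | reach w u] == [set w | reach w m].
  by rewrite eqEcard sub_u; apply: min_m; apply: connect_trans um mv.
have : m \in [set w | reach w u] by rewrite E inE; apply: connect0.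
by rewrite inE => mu; apply: connect_trans sm mu.
Qed.

Lemma least_source_anti s t : least_source s -> least_source t -> reach s t -> s = t.
Proof.
move=> /forallP ls /forallP lt st; have := lt s; rewrite st /= => /andP[ts le_ts].
have := ls t; rewrite ts /= => /andP[_ le_st].
by apply: val_inj; apply/eqP; rewrite eqn_leq le_st.
Qed.

(** [strategy_ex] is applied to all vertices of H, with the least sources on one side. The function
    t lists the digits of the code, block by block; a missing determining vertex or parent becomes
    the digit k. *)
Lemma valid_ex : exists t : nat -> nat, (forall i, t i <= k) /\
  valid k psi (fun v => t v == 1) (fun v => t (k + (k + (k + (k + v)))) == 1)
    (fun v => t (k + v)) (fun v => t (k + (k + v))) (fun v => t (k + (k + (k + v)))).
Proof.
pose B : rel 'I_k := fun s v => [&& least_source s, ~~ least_source v & reach s v].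
have bip s v : B s v -> least_source s && ~~ least_source v by case/and3P=> -> ->.
have [X dt pr rk X1 X2 X3 X4 X5 X6] := strategy_ex bip [set: 'I_k].
rewrite cardsT card_ord in X2 X3.
pose lft (f : 'I_k -> nat) v := if insub v is Some u then f u else 0.
have lftE f (v : 'I_k) : lft f v = f v by rewrite /lft valK.
have lft_le f v : (forall u, f u <= k) -> lft f v <= k by rewrite /lft; case: insub.
pose opt (o : option 'I_k) : nat := if o is Some u then u : nat else k.
have opt_le o : opt o <= k by case: o => //= u; apply: ltnW.
pose g0 := lft (fun v => v \in X); pose g1 := lft (fun v => opt (dt v)).
pose g2 := lft (fun v => opt (pr v)); pose g3 := lft rk; pose g4 := lft least_source.
pose t i := if i < k then g0 i else if i < k + k then g1 (i - k)
  else if i < k + (k + k) then g2 (i - (k + k))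
  else if i < k + (k + (k + k)) then g3 (i - (k + (k + k)))
  else g4 (i - (k + (k + (k + k)))).
have t0 (v : 'I_k) : t v = (v \in X) by rewrite /t ltn_ord /g0 lftE.
have t1 (v : 'I_k) : t (k + v) = opt (dt v).
  by rewrite /t ltnNge leq_addr /= ltn_add2l ltn_ord addKn /g1 lftE.
have t2 (v : 'I_k) : t (k + (k + v)) = opt (pr v).
  rewrite /t ltnNge leq_addr /= ltn_add2l ltnNge leq_addr /= !ltn_add2l ltn_ord.
  by rewrite addnA addKn /g2 lftE.
have t3 (v : 'I_k) : t (k + (k + (k + v))) = rk v.
  rewrite /t ltnNge leq_addr /= ltn_add2l ltnNge leq_addr /= !ltn_add2l ltnNge leq_addr /=.
  by rewrite ltn_ord !addnA addKn /g3 lftE.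
have t4 (v : 'I_k) : t (k + (k + (k + (k + v)))) = least_source v.
  rewrite /t ltnNge leq_addr /= ltn_add2l ltnNge leq_addr /= !ltn_add2l ltnNge leq_addr /=.
  by rewrite ltnNge leq_addr /= !addnA addKn /g4 lftE.
have k1 (v : 'I_k) : 1 <= k by apply: leq_trans (ltn_ord v).
exists t; split.
  have rkb (u : 'I_k) : rk u <= k by apply/ltnW/X3; rewrite inE.
  move=> i; rewrite /t; do !case: ifP => _; apply: lft_le => // u.
    by case: (u \in X) => //; apply: k1.
  by case: (least_source u) => //; apply: k1.
have b1 (b : bool) : ((b : nat) == 1) = b by case: b.
have optE o : (opt o < k) = (o != None).
  by case: o => [u|] /=; rewrite ?ltn_ord ?ltnn.
have beE (s v : 'I_k) : bedge psi (fun v => t (k + (k + (k + (k + v)))) == 1) s v = B s v.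
  by rewrite /bedge /B !t4 !b1 psi_reach.
have optS o (s : 'I_k) : (o == Some s) = (opt o == s).
  case: o => [u|]; first by apply/eqP/eqP => [[->] //|/val_inj ->].
  by rewrite /opt [RHS]eq_sym ltn_eqF ?ltn_ord.
apply/and5P; split; [| | | |apply/andP; split].
- rewrite (eq_bigr (fun v : 'I_k => (v \in X) : nat)) => [|v _]; last by rewrite t0 b1.
  by rewrite -big_mkcond /= sum1_card mulnC -leq_divRL.
- apply/forallP => v; have [s ls sv] := least_source_cover v.
  by apply/existsP; exists s; rewrite t4 b1 ls psi_reach.
- apply/forallP => s; apply/forallP => u; apply/implyP; rewrite !t4 !b1 psi_reach //.
  by case/and3P=> ls lu su; apply/eqP/least_source_anti.
- apply/forallP => v; apply/implyP; rewrite t1 t0 b1 optE.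
  case E: (dt v) => [s|//] _; have := X4 _ _ (in_setT v) E => /and3P[vX sX sv].
  by rewrite vX /= t0 b1 sX beE.
- apply/forallP => v; apply/implyP; rewrite t2 optE t3.
  by case E: (pr v) => [p|//] _ /=; rewrite t3; have /andP[] := X5 _ _ (in_setT v) E.
- apply/forallP => s; apply/forallP => v; apply/implyP; rewrite beE => sv.
  rewrite /known !t0 !t1 !t2 !b1 !optE -!optS.
  by have /or3P[->|->|->] := X6 _ _ (in_setT s) (in_setT v) sv; rewrite ?orbT.
Qed.

End StrategyCode.

(** * Sums over codes as sums over functions *)

Section SumDigits.

Variables (R : nmodType) (I : finType) (A m : nat) (idx : I -> 'I_m).
Hypothesis idx_bij : bijective idx.

(** Each function into digits belongs to exactly one code, by [digit_unique]. *)
Lemma sum_digits (f : (I -> nat) -> R) : (forall g g', g =1 g' -> f g = f g') ->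
  (\sum_(c < A ^ m) f (fun i => digit (fun=> A) (idx i) c) =
   \sum_(E : {ffun I -> 'I_A}) f (fun i => E i))%R.
Proof.
move=> fE; have [idx' idxK idxK'] := idx_bij.
have plA : place (fun=> A) m = A ^ m by rewrite /place prod_nat_const card_ord.
have digA (c : 'I_(A ^ m)) i : digit (fun=> A) (idx i) c < A.
  rewrite /digit ltn_mod; have := ltn_ord c; case: (posnP A) => // A0.
  by rewrite {2}A0 exp0n // (leq_ltn_trans _ (ltn_ord (idx i))).
pose E_ (c : 'I_(A ^ m)) : {ffun I -> 'I_A} := [ffun i => Ordinal (digA c i)].
rewrite (partition_big E_ xpredT) //=; apply: eq_bigr => E _.
have cE : \sum_(c < A ^ m) (E_ c == E) = 1.
  pose t j := if insub j is Some i then E (idx' i) : nat else 0.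
  have ht j : j < m -> t j < A by move=> ltj; rewrite /t insubT.
  have <- : \sum_(c < A ^ m) [forall i : 'I_m, digit (fun=> A) i c == t i] = 1.
    by rewrite -plA digit_unique.
  apply: eq_bigr => c _.
  apply: (congr1 nat_of_bool); apply/eqP/forallP => [Ec i|h].
    by rewrite /t valK -Ec ffunE /= idxK'.
  apply/ffunP => i; apply: val_inj; rewrite ffunE /=; have /eqP-> := h (idx i).
  by rewrite /t valK idxK.
rewrite (eq_bigr (fun=> f (fun i => E i))) => [|c /eqP <-]; last first.
  by apply: fE => i; rewrite ffunE.
rewrite -[RHS]mulr1n -cE sumr_const; congr (_ *+ _)%R.
rewrite -sum1_card big_mkcond; apply: eq_bigr => c _.
by rewrite -[_ \in _]/(E_ c == E); case: (E_ c == E).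
Qed.

End SumDigits.

(** * Evaluation rules for array programs *)

Section Reasoning.

Variables (W : nat) (par inp : nat -> nat).
Hypothesis W_ge : narr <= W.

Local Notation den := (den W par inp).
Local Notation run := (run W par inp).

Implicit Types (s t : arrays) (a b e : exp nat) (p q : bool).

Lemma W_gt1 : 1 < W. Proof. exact: leq_trans W_ge. Qed.

Lemma den_Not a s : den (Not a) s = (den a s == 0).
Proof. by []. Qed.

Lemma den_Notb a s p : den a s = p -> den (Not a) s = ~~ p.
Proof. by rewrite den_Not => ->; case: p. Qed.

Lemma den_Nz a s : den (Nz a) s = (den a s != 0).
Proof. by rewrite /= lt0n. Qed.

Lemma den_Le a b s : den (Le a b) s = (den a s <= den b s).
Proof. by rewrite /Le den_Not /= subn_eq0. Qed.

Lemma den_Imp a b s p q : den a s = p -> den b s = q -> den (Le a b) s = (p ==> q).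
Proof. by rewrite den_Le => -> ->; case: p; case: q. Qed.

Lemma den_And a b s p q : den a s = p -> den b s = q -> den (And a b) s = p && q.
Proof. by move=> /= -> ->; case: p; case: q. Qed.

Lemma den_Or a b s p q : den a s = p -> den b s = q -> den (Or a b) s = p || q.
Proof. by move=> ha hb; rewrite /Or (den_Imp (den_Notb ha) hb); case: p {ha}; case: q {hb}. Qed.

Lemma den_Eq a b s x y : den a s = x -> den b s = y -> den (Bin Eq a b) s = (x == y).
Proof. by move=> /= -> ->. Qed.

Lemma den_Lt a b s x y : den a s = x -> den b s = y -> den (Bin Lt a b) s = (x < y).
Proof. by move=> /= -> ->. Qed.

Lemma den_Add a b s x y : den a s = x -> den b s = y -> x + y < W ->
  den (Bin Add a b) s = x + y.
Proof. by move=> /= -> -> /modn_small. Qed.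

Lemma den_Mul a b s x y : den a s = x -> den b s = y -> x * y < W ->
  den (Bin Mul a b) s = x * y.
Proof. by move=> /= -> -> /modn_small. Qed.

Lemma den_Ite c a b s p : den c s = p ->
  den (Ite c a b) s = if p then den a s else den b s.
Proof. by move=> /= ->; case: p. Qed.

Lemma fold_iota (T : Type) (f : T -> nat -> T) x m (g : nat -> T) :
  g 0 = x -> (forall i, i < m -> f (g i) i = g i.+1) ->
  foldl f x (iota 0 m) = g m.
Proof.
move=> g0; elim: m => [|m IH] hg; first by rewrite /= g0.
rewrite -addn1 iotaD foldl_cat IH => [|i ltim]; last exact/hg/ltnW.
by rewrite /= add0n hg ?addn1.
Qed.

Lemma den_All i m f s (g : nat -> bool) : par i = m ->
  (forall x : 'I_m, den (f (Var (x : nat))) s = g x) ->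
  den (All i f) s = [forall x : 'I_m, g x].
Proof.
move=> <- hg; rewrite /All.
pose h j : nat := [forall x : 'I_(par i), (x < j) ==> g x].
transitivity (h (par i)); last first.
  by congr nat_of_bool; apply: eq_forallb => x; rewrite ltn_ord.
apply: (fold_iota (g := h)) => [|j ltj].
  by rewrite /h; case: forallP => // -[].
have hj := hg (Ordinal ltj); rewrite [LHS](@den_And (Var (h j : nat)) _ s _ _ erefl hj).
congr nat_of_bool; apply/andP/forallP => [[/forallP hx gj] x|hx].
  apply/implyP; rewrite ltnS leq_eqVlt => /orP[/eqP->//|xj].
  by have := hx x; rewrite xj.
split; last by have := hx (Ordinal ltj); rewrite ltnSn.
by apply/forallP => x; apply/implyP => xj; have := hx x; rewrite ltnS ltnW.
Qed.

Lemma den_Exi i m f s (g : nat -> bool) : par i = m ->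
  (forall x : 'I_m, den (f (Var (x : nat))) s = g x) ->
  den (Exi i f) s = [exists x : 'I_m, g x].
Proof.
move=> hm hg; rewrite /Exi.
rewrite (@den_Notb _ _ [forall x : 'I_m, ~~ g x]).
  by rewrite negb_forall; congr nat_of_bool; apply: eq_existsb => x; rewrite negbK.
by apply: (@den_All _ _ _ _ (fun x => ~~ g x)) => // x; apply: den_Notb.
Qed.

Lemma den_Sum i m f s (g : nat -> nat) : par i = m ->
  (forall x : 'I_m, den (f (Var (x : nat))) s = g x) ->
  den (Sum i f) s = (\sum_(x < m) g x) %% W.
Proof.
move=> <- hg.
rewrite -[LHS]/(foldl (fun acc x => (acc + den (f (Var x)) s) %% W) 0 (iota 0 (par i))).
apply: (fold_iota (g := fun j => (\sum_(x < j) g x) %% W)) => [|j ltj].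
  by rewrite big_ord0 mod0n.
have /= hj := hg (Ordinal ltj).
by rewrite hj modnDml big_ord_recr.
Qed.

Lemma den_Prod i m f s (g : nat -> nat) : par i = m ->
  (forall x : 'I_m, den (f (Var (x : nat))) s = g x) ->
  den (Prod i f) s = (\prod_(x < m) g x) %% W.
Proof.
move=> <- hg.
rewrite -[LHS]/(foldl (fun acc x => (acc * den (f (Var x)) s) %% W) 1 (iota 0 (par i))).
apply: (fold_iota (g := fun j => (\prod_(x < j) g x) %% W)) => [|j ltj].
  by rewrite big_ord0 modn_small ?W_gt1.
have /= hj := hg (Ordinal ltj).
by rewrite hj modnMml big_ord_recr.
Qed.

Lemma prod_place (bx : nat -> nat) i m : i <= m ->
  \prod_(j < m) (if j < i then bx j else 1) = place bx i.
Proof.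
by move=> le_im; rewrite -big_mkcond /place (big_ord_widen_cond _ xpredT bx le_im).
Qed.

Lemma den_Digit (q : nat) m base code idx s (bx : nat -> nat) c i : par q = m -> i <= m ->
  den idx s = i -> den code s = c -> den (base idx) s = bx i ->
  (forall j : 'I_m, den (base (Var (j : nat))) s = bx j) ->
  place bx i < W -> den (Digit q base code idx) s = digit bx i c.
Proof.
move=> hm le_im hi hc hb hbj pl; rewrite /Digit.
have hp : den (Prod q (fun j => Ite (Bin Lt j idx) (base j) (Cst 1))) s = place bx i.
  rewrite (den_Prod (m := m) (g := fun j => if j < i then bx j else 1)) // => [|j].
    by rewrite prod_place // modn_small.
  by rewrite (@den_Ite _ _ _ _ (j < i)) ?(den_Lt (x := j) (y := i)) // hbj.
rewrite -[LHS]/((den code s %/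
  den (Prod q (fun j => Ite (Bin Lt j idx) (base j) (Cst 1))) s) %% den (base idx) s).
by rewrite hp hc hb.
Qed.

Lemma run_Loop i m f s (P : nat -> arrays -> Prop) : par i = m -> P 0 s ->
  (forall j t, j < m -> P j t -> P j.+1 (run (f (Var j)) t)) ->
  P m (run (Loop i f) s).
Proof.
move=> <- P0 hP.
rewrite -[X in P _ X]/(foldl (fun t j => run (f (Var j)) t) s (iota 0 (par i))).
elim: (par i) hP => [//|m' IH] hP; rewrite -addn1 iotaD foldl_cat /= add0n addn1.
by apply: (hP) => //; apply: IH => j t ltj; apply: hP; apply: ltnW.
Qed.

Fixpoint avoids (x : nat) (c : stm nat) : Prop :=
  match c with
  | Sto a _ _ _ _ => x != a
  | Then c1 c2 => avoids x c1 /\ avoids x c2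
  | For _ f => forall v, avoids x (f v)
  end.

Lemma run_avoids x c s : avoids x c -> run c s x = s x.
Proof.
elim: c s => [a i j l e|c1 IH1 c2 IH2|b f IH] s /=.
- by move=> /negPf xa; rewrite /upda xa.
- by case=> /IH1 h1 /IH2 h2; rewrite h2 h1.
move=> h; elim: (iota _ _) s => //= v l IHl s.
by rewrite IHl IH.
Qed.

(** An entry may be computed from every array but the one being filled. *)
Lemma run_fill1 i m r (f : exp nat -> exp nat) s (E : nat -> nat) : par i = m ->
  (forall v t, v < m -> (forall r', r' != r -> t r' = s r') -> den (f (Var v)) t = E v) ->
  forall v, v < m -> run (Loop i (fun x => Sto1 r x (f x))) s r v 0 0 = E v.
Proof.
move=> hm hE.
suff [] : (forall v, v < m -> run (Loop i (fun x => Sto1 r x (f x))) s r v 0 0 = E v) /\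
  (forall r', r' != r -> run (Loop i (fun x => Sto1 r x (f x))) s r' = s r') by [].
apply: (run_Loop (P := fun j t => (forall v, v < j -> t r v 0 0 = E v) /\
  (forall r', r' != r -> t r' = s r'))) hm _ _ => // j t ltj [h1 h2]; split.
  move=> v; rewrite ltnS leq_eqVlt /= /upda /upd3 eqxx => /orP[/eqP->|ltv].
    by rewrite eqxx /= hE.
  by rewrite ltn_eqF //= h1.
by move=> r' na; rewrite /= /upda (negPf na) h2.
Qed.

Lemma run_fill2 i m i' m' r (f : exp nat -> exp nat -> exp nat) s (E : nat -> nat -> nat) :
  par i = m -> par i' = m' ->
  (forall u v t, u < m -> v < m' -> (forall r', r' != r -> t r' = s r') ->
     den (f (Var u) (Var v)) t = E u v) ->
  forall u v, u < m -> v < m' ->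
  run (Loop i (fun x => Loop i' (fun y => Sto2 r x y (f x y)))) s r u v 0 = E u v.
Proof.
move=> hm hm' hE; set p := Loop i _.
suff [] : (forall u v, u < m -> v < m' -> run p s r u v 0 = E u v) /\
  (forall r', r' != r -> run p s r' = s r') by [].
apply: (run_Loop (P := fun j t => (forall u v, u < j -> v < m' -> t r u v 0 = E u v) /\
  (forall r', r' != r -> t r' = s r'))) hm _ _ => // j t ltj [h1 h2].
have [] : [/\ forall v, v < m' -> run (Loop i' (fun y => Sto2 r (Var j) y (f (Var j) y))) t r j v 0 = E j v,
    forall u v, u < j -> run (Loop i' (fun y => Sto2 r (Var j) y (f (Var j) y))) t r u v 0 = t r u v 0
  & forall r', r' != r -> run (Loop i' (fun y => Sto2 r (Var j) y (f (Var j) y))) t r' = s r'].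
  apply: (run_Loop (P := fun j' t' => [/\ forall v, v < j' -> t' r j v 0 = E j v,
    forall u v, u < j -> t' r u v 0 = t r u v 0
    & forall r', r' != r -> t' r' = s r'])) hm' _ _ => // j' t' ltj' [k1 k2 k3]; split.
  - move=> v; rewrite ltnS leq_eqVlt /= /upda /upd3 !eqxx => /orP[/eqP->|ltv].
      by rewrite !eqxx /= hE.
    by rewrite ltn_eqF //= k1.
  - by move=> u v ltu; rewrite /= /upda /upd3 eqxx ltn_eqF //= k2.
  - by move=> r' na; rewrite /= /upda (negPf na) k3.
move=> k1 k2 k3; split=> // u v; rewrite ltnS leq_eqVlt => /orP[/eqP->|ltu ltv]; first exact: k1.
by rewrite k2 ?h1.
Qed.

End Reasoning.

Ltac avoid := repeat (split || intro); exact isT.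

(** * Reading and orienting the host graph *)

Section ReadGraph.

Variables (W : nat) (par inp : nat -> nat).
Hypothesis W_ge : narr <= W.

Local Notation den := (den W par inp).
Local Notation run := (run W par inp).

Variables (m q : nat) (nb : nat -> seq nat).

Definition row_pos u := q.+1 + \sum_(w < u) (size (nb w)).+1.

Lemma row_posS u : row_pos u.+1 = row_pos u + (size (nb u)).+1.
Proof. by rewrite /row_pos big_ord_recr addnA. Qed.

Lemma row_pos_le u v : u <= v -> row_pos u <= row_pos v.
Proof.
elim: v => [|v IH]; first by rewrite leqn0 => /eqP->.
rewrite leq_eqVlt => /orP[/eqP->//|]; rewrite ltnS => /IH h.
by rewrite row_posS; apply: leq_trans h (leq_addr _ _).
Qed.

Hypothesis pos_lt : row_pos m < W.
Hypothesis inp_size : forall u, u < m -> inp (row_pos u) = size (nb u).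
Hypothesis inp_nth : forall u j, u < m -> j < size (nb u) ->
  inp (row_pos u + j.+1) = nth 0 (nb u) j.
Hypothesis size_nb : forall u, u < m -> size (nb u) <= m.

Lemma read_graphP (ptr : exp nat) (i a : nat) (s : arrays) : par i = m -> (forall t, den ptr t = q) ->
  a != aPT -> (forall u v, s a u v 0 = 0) ->
  forall u v, u < m -> run (read_graph ptr i a) s a u v 0 = (v \in nb u).
Proof.
move=> hm hptr aPTa sa0; rewrite /read_graph.
set c1 := Sto1 _ _ _; set c2 := Loop _ _; set c3 := Loop _ _.
rewrite -[run (c1;; (c2;; c3)) s]/(run c3 (run c2 (run c1 s))).
set s1 := run c1 s; set s2 := run c2 s1.
have [sPT2 sa2] : (forall u, u <= m -> s2 aPT u 0 0 = row_pos u) /\ s2 a = s a.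
  apply: (run_Loop (P := fun j t => (forall u, u <= j -> t aPT u 0 0 = row_pos u) /\
     t a = s a) hm).
    split; last by rewrite /s1 /= /upda (negPf aPTa).
    move=> u; rewrite leqn0 => /eqP->; rewrite /s1 /= /upda /upd3 !eqxx /= hptr.
    rewrite /row_pos big_ord0 addn0 addn1 modn_small //.
    by apply: leq_ltn_trans pos_lt; rewrite /row_pos leq_addr.
  move=> j t ltj [h1 h2]; split; last by rewrite /= /upda (negPf aPTa).
  have ltmW : j.+1 < W.
    apply: leq_trans (_ : m.+1 <= W) => //; apply: leq_ltn_trans pos_lt.
    rewrite /row_pos; apply: leq_trans (leq_addl _ _).
    by rewrite -{1}(card_ord m) -sum1_card leq_sum.
  have e1 : den (Var j + Cst 1)%exp t = j.+1 by rewrite (den_Add (x := j) (y := 1)) ?addn1.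
  have posj := leq_ltn_trans (row_pos_le ltj) pos_lt; rewrite row_posS in posj.
  have ePT : den (Arr1 aPT (Var j)) t = row_pos j by apply: h1.
  have e2 : den (Arr1 aPT (Var j) + (Cst 1 + Inp (Arr1 aPT (Var j))))%exp t = row_pos j.+1.
    rewrite row_posS (den_Add (x := row_pos j) (y := (size (nb j)).+1)) //.
    rewrite (den_Add (x := 1) (y := size (nb j))) ?add1n //.
      by rewrite -[LHS]/(inp (den (Arr1 aPT (Var j)) t)) ePT inp_size.
    by apply: leq_ltn_trans posj; rewrite leq_addl.
  move=> u; rewrite leq_eqVlt -[run _ _]/(upda _ _ (den _ t) 0 0 (den _ t)) e1 e2.
  rewrite /upda /upd3 eqxx !andbT => /orP[/eqP->|]; first by rewrite eqxx.
  by rewrite ltnS => leu; rewrite ltn_eqF ?ltnS // h1.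
(* The invariants quantify over all columns v, because past the end of a row the column addressed is
   an arbitrary number. *)
pose row (t : arrays) (u : nat) := forall v : nat, t a u v 0 = (v \in nb u) :> nat.
pose zero (t : arrays) (u : nat) := forall v : nat, t a u v 0 = 0 :> nat.
suff [_ h _] : [/\ run c3 s2 aPT = s2 aPT, forall u, u < m -> row (run c3 s2) u &
    forall u, m <= u -> zero (run c3 s2) u] by move=> u v /h.
apply: (run_Loop (P := fun j t => [/\ t aPT = s2 aPT, forall u, u < j -> row t u
   & forall u, j <= u -> zero t u]) hm).
  by split=> // u _ v; rewrite sa2.
move=> u t ltu [t1 t2 t3].
set c := Loop i _.
have [r1 r2 r3] : [/\ run c t aPT = s2 aPT,
    forall v, run c t a u v 0 = (v \in take m (nb u)) :> nat
  & forall w v, w != u -> run c t a w v 0 = t a w v 0].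
  apply: (run_Loop (P := fun j t' => [/\ t' aPT = s2 aPT,
    forall v, t' a u v 0 = (v \in take j (nb u)) :> nat
    & forall w v, w != u -> t' a w v 0 = t a w v 0]) hm).
    by split=> // v; rewrite take0 in_nil t3.
  move=> j t' ltj [k1 k2 k3].
  have ePT : den (Arr1 aPT (Var u)) t' = row_pos u.
    by rewrite -[LHS]/(t' aPT u 0 0) k1 sPT2 // ltnW.
  have eS : den (Inp (Arr1 aPT (Var u))) t' = size (nb u).
    by rewrite -[LHS]/(inp (den (Arr1 aPT (Var u)) t')) ePT inp_size.
  set w := Inp (Arr1 aPT (Var u) + (Cst 1 + Var j))%exp.
  have eO : den (Arr2 a (Var u) w || (Var j < Inp (Arr1 aPT (Var u))))%exp t' =
      (den w t' \in take j (nb u)) || (j < size (nb u)).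
    apply: (den_Or (p := den w t' \in take j (nb u)) (q := j < size (nb u))) => //.
      exact: k2.
    exact: den_Lt.
  rewrite -[run _ _]/(upda t' a u (den w t') 0 (den _ t')) eO.
  set x := den w t'.
  split.
  - by rewrite /upda eq_sym (negPf aPTa).
  - move=> v; rewrite /upda /upd3 !eqxx /= andbT.
    case: (ltnP j (size (nb u))) => [ltjs|lesj].
      have ew : x = nth 0 (nb u) j.
        have posu := leq_ltn_trans (row_pos_le ltu) pos_lt; rewrite row_posS in posu.
        rewrite -[LHS]/(inp (den (Arr1 aPT (Var u) + (Cst 1 + Var j))%exp t')).
        rewrite (den_Add (x := row_pos u) (y := j.+1)) ?inp_nth //; last first.
          by apply: leq_ltn_trans posu; rewrite leq_add2l ltnW.
        rewrite (den_Add (x := 1) (y := j)) // add1n.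
        by apply: leq_ltn_trans posu; apply: leq_trans (leq_addl _ _); rewrite ltnW.
      rewrite ew (take_nth 0 ltjs) mem_rcons inE orbT.
      by case: eqP => // _; rewrite k2.
    rewrite orbF k2 !take_oversize //; last exact: leqW.
    by case: eqP => [->|].
  - by move=> y v yu; rewrite /upda /upd3 eqxx (negPf yu) /= k3.
split=> //.
- move=> w; rewrite ltnS leq_eqVlt => /orP[/eqP-> v|ltw v].
    by rewrite r2 take_oversize // size_nb.
  by rewrite r3 ?ltn_eqF // t2.
- by move=> w ltw v; rewrite r3 ?gtn_eqF // t3 // ltnW.
Qed.

End ReadGraph.

(** * Removing vertices of minimum degree *)

Section Peeling.

Variables (W : nat) (par inp : nat -> nat).
Hypothesis W_ge : narr <= W.

Local Notation den := (den W par inp).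
Local Notation run := (run W par inp).

Variables (n d : nat) (g : nat -> nat -> bool).
Hypotheses (parN : par pN = n) (n_lt : n.+1 < W).
Hypothesis g_sym : forall u v, g u v = g v u.
Hypothesis g_irr : forall u, g u u = false.
Hypothesis sparse : forall P : 'I_n -> bool, (exists u, P u) ->
  exists2 u : 'I_n, P u & \sum_(v < n) (g u v && P v) <= d.

(** When u is removed this describes its remaining neighbours. A later removal turns the position 0
    of v into one beyond that of u and changes nothing. *)
Definition sees_later (p : nat -> nat) (u v : nat) : bool :=
  g u v && ((p v == 0) || (p u < p v)).

Record peeled (i : nat) (p deg : nat -> nat) : Prop := Peeled {
  pos_le : forall u, u < n -> p u <= i;
  pos_card : \sum_(u < n) (p u == 0) = n - i;
  pos_inj : forall u v, u < n -> v < n -> p u != 0 -> p u = p v -> u = v;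
  deg_left : forall u, u < n -> p u = 0 -> deg u = \sum_(v < n) (g u v && (p v == 0));
  deg_out : forall u, u < n -> p u != 0 -> \sum_(v < n) sees_later p u v <= d }.

Lemma sum_bool_le m (b : 'I_m -> bool) : \sum_(v < m) b v <= m.
Proof.
rewrite -[leqRHS]card_ord -sum1_card; apply: leq_sum => v _.
by case: (b v).
Qed.

Lemma best_vertexP (t : arrays) : exists b, [/\ den (best_vertex nat) t = b,
  b = 0 -> forall u, u < n -> t aPOS u 0 0 != 0
  & b != 0 -> [/\ b.-1 < n, t aPOS b.-1 0 0 = 0 &
      forall u, u < n -> t aPOS u 0 0 = 0 -> t aDEG b.-1 0 0 <= t aDEG u 0 0]].
Proof.
pose f acc u := den (Ite (Not (Arr1 aPOS (Var u)) &&
         (Not (Var acc) || (Arr1 aDEG (Var u) < Arr1 aDEG (Var acc - Cst 1))))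
        (Var u + Cst 1) (Var acc))%exp t.
rewrite -[den _ t]/(foldl f 0 (iota 0 (par pN))) parN.
have fE acc u : u < n -> f acc u =
   if (t aPOS u 0 0 == 0) && ((acc == 0) || (t aDEG u 0 0 < t aDEG acc.-1 0 0)) then u.+1 else acc.
  move=> ltu; rewrite /f; set c := And _ _.
  have hc : den c t = (t aPOS u 0 0 == 0) && ((acc == 0) || (t aDEG u 0 0 < t aDEG acc.-1 0 0)).
    by apply: den_And => //; apply: den_Or => //; rewrite /= subn1.
  rewrite (den_Ite _ _ hc); case: (_ && _) => //.
  by rewrite (den_Add (x := u) (y := 1)) ?addn1 //; apply: leq_ltn_trans n_lt; lia.
suff H j : j <= n -> let b := foldl f 0 (iota 0 j) in
   [/\ b = 0 -> forall u, u < j -> t aPOS u 0 0 != 0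
   & b != 0 -> [/\ b.-1 < j, t aPOS b.-1 0 0 = 0 &
      forall u, u < j -> t aPOS u 0 0 = 0 -> t aDEG b.-1 0 0 <= t aDEG u 0 0]].
  by exists (foldl f 0 (iota 0 n)); have [] := H n (leqnn n).
elim: j => [//|j IH] ltj; rewrite -addn1 iotaD foldl_cat add0n /=.
have [h1 h2] := IH (ltnW ltj); set b := foldl _ _ _ in h1 h2 *.
rewrite fE //; case: ifP => [/andP[/eqP p0 hb]|hb].
  split=> // _; rewrite addn1; split=> // u; rewrite ltnS leq_eqVlt => /orP[/eqP->//|ltu] pu.
  case: (eqVneq b 0) hb => [/h1/(_ u ltu)|b0 /= lt_b]; first by rewrite pu.
  by have [_ _ /(_ u ltu pu)] := h2 b0; apply: leq_trans; apply: ltnW.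
split=> [b0 u|b0]; rewrite addn1.
  rewrite ltnS leq_eqVlt => /orP[/eqP->|]; last exact: h1.
  by move: hb; rewrite b0 /= andbT => ->.
have [k1 k2 k3] := h2 b0; split=> //; first exact: ltnW.
move=> u; rewrite ltnS leq_eqVlt => /orP[/eqP->|]; last exact: k3.
by move=> pj; move: hb; rewrite pj (negPf b0) /= => /negbT; rewrite -leqNgt.
Qed.

(** By [sparse] some remaining vertex has at most d remaining neighbours. So the vertex b of least
    degree has at most d as well, and these are its future out-neighbours. *)
Lemma peel_step i p deg b : i < n -> peeled i p deg -> b < n -> p b = 0 ->
  (forall u, u < n -> p u = 0 -> deg b <= deg u) ->
  peeled i.+1 (fun u => if u == b then i.+1 else p u) (fun u => deg u - g b u).
Proof.
move=> lti [h1 h2 h3 h4 h5] ltb pb minb; set p' := fun u => _.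
have p'E u : u != b -> p' u = p u by rewrite /p' => /negPf->.
have p'b : p' b = i.+1 by rewrite /p' eqxx.
split.
- by move=> u ltu; rewrite /p'; case: eqP => // _; apply/leqW/h1.
- move: h2; rewrite (bigD1 (Ordinal ltb)) //= pb eqxx [in X in _ -> X](bigD1 (Ordinal ltb)) //= p'b /=.
  rewrite add1n add0n => E; rewrite subnS -E /=; apply: eq_bigr => u; rewrite -val_eqE /= => ub.
  by rewrite p'E.
- move=> u v ltu ltv; case: (eqVneq u b) => [->|ub]; case: (eqVneq v b) => [->|vb] //; rewrite ?p'b ?p'E //.
  + by move=> _ E; have := h1 v ltv; rewrite -E ltnn.
  + by move=> _ E; have := h1 u ltu; rewrite E ltnn.
  + exact: h3.
- move=> u ltu; case: (eqVneq u b) => [->|ub]; rewrite ?p'b ?p'E // => pu.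
  rewrite h4 // g_sym (bigD1 (Ordinal ltb)) //= pb eqxx andbT addKn.
  rewrite [in RHS](bigD1 (Ordinal ltb)) //= p'b andbF add0n.
  by apply: eq_bigr => v; rewrite -val_eqE /= => vb; rewrite p'E.
- move=> u ltu; case: (eqVneq u b) => [->|ub] pu.
    have [w pw cw] := @sparse (fun u => p u == 0) (ex_intro _ (Ordinal ltb) (introT eqP pb)).
    have := minb w (ltn_ord w) (eqP pw); rewrite !h4 //; last exact/eqP.
    move=> /leq_trans/(_ cw); apply: leq_trans; apply: leq_sum => v _.
    rewrite /sees_later p'b; case: (eqVneq (v : nat) b) => [->|vb]; first by rewrite g_irr.
    by rewrite p'E // ltnNge (leqW (h1 v (ltn_ord v))) orbF.
  rewrite p'E // in pu; apply: leq_trans (h5 u ltu pu); apply: leq_sum => v _.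
  rewrite /sees_later (p'E u ub); case: (eqVneq (v : nat) b) => [->|vb]; last by rewrite p'E.
  by rewrite pb eqxx orTb; case: (g u b) => //; apply: leq_b1.
Qed.

Lemma peelP (s : arrays) :
  (forall u v, u < n -> s aGA u v 0 = g u v) -> (forall u, s aPOS u 0 0 = 0) ->
  let p u := run (peel nat) s aPOS u 0 0 in
  (forall u v, u < n -> v < n -> p u = p v -> u = v) /\
  (forall u, u < n -> \sum_(v < n) (g u v && (p u < p v)) <= d).
Proof.
move=> sG sP; rewrite /peel; set c1 := Loop _ _; set c2 := Loop _ _.
rewrite -[run (c1;; c2) s]/(run c2 (run c1 s)); set s1 := run c1 s.
have s1G : s1 aGA = s aGA by apply: run_avoids; avoid.
have s1P : s1 aPOS = s aPOS by apply: run_avoids; avoid.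
have s1D u : u < n -> s1 aDEG u 0 0 = \sum_(v < n) g u v.
  apply: (run_fill1 (E := fun u => \sum_(v < n) g u v) parN) => v t ltv ht.
  rewrite (den_Sum (m := n) (g := g v)) // => [|x].
    by rewrite modn_small //; apply: leq_ltn_trans (sum_bool_le _) (ltnW n_lt).
  by rewrite -[LHS]/(t aGA v x 0) ht // sG.
have [GA pe] : run c2 s1 aGA = s aGA /\ peeled n (fun u => run c2 s1 aPOS u 0 0)
    (fun u => run c2 s1 aDEG u 0 0).
  apply: (run_Loop (P := fun i t => t aGA = s aGA /\ peeled i (fun u => t aPOS u 0 0)
    (fun u => t aDEG u 0 0)) parN).
    split=> //; split; rewrite ?s1P.
    - by move=> u ltu; rewrite sP.
    - under eq_bigr => u _ do rewrite sP.
      by rewrite sum_nat_const card_ord muln1 subn0.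
    - by move=> u v _ _; rewrite sP.
    - move=> u ltu _; rewrite s1D //; apply: eq_bigr => v _.
      by rewrite sP andbT.
    - by move=> u ltu; rewrite sP.
  move=> i t lti [tG pe].
  have [b [eb b0 bP]] := best_vertexP t.
  have nz : b != 0.
    apply/eqP => /b0 all; have := pos_card pe; rewrite big1 => [|u _]; first by lia.
    by rewrite (negPf (all u (ltn_ord u))).
  have [ltb pb minb] := bP nz.
  set c := (_ ;; _)%exp; set t1 := upda t aBEST 0 0 0 b.
  set t2 := upda t1 aPOS b.-1 0 0 i.+1.
  pose c' := Loop pN (fun v : exp nat => Sto1 aDEG v (Arr1 aDEG v - Arr2 aGA (Arr0 aBEST - Cst 1) v)%exp).
  have -> : run c t = run c' t2.
    rewrite -[LHS]/(run c' (upda (upda t aBEST 0 0 0 (den (best_vertex nat) t)) aPOS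
      (den (Arr0 aBEST - Cst 1)%exp (upda t aBEST 0 0 0 (den (best_vertex nat) t))) 0 0
      (den (Var i + Cst 1)%exp (upda t aBEST 0 0 0 (den (best_vertex nat) t))))) eb -/t1.
    rewrite (den_Add (x := i) (y := 1)) //; last by rewrite addn1; apply: leq_ltn_trans n_lt; lia.
    have -> : den (Arr0 aBEST - Cst 1)%exp t1 = b.-1 by rewrite /= subn1.
    by rewrite addn1.
  have [q1 q2 q3 q4] : [/\ run c' t2 aGA = t aGA, run c' t2 aPOS = t2 aPOS,
     run c' t2 aBEST = t1 aBEST & forall u, u < n -> run c' t2 aDEG u 0 0 = t aDEG u 0 0 - g b.-1 u].
    split; try by (rewrite run_avoids //; avoid).
    suff [] : (forall u, u < n -> run c' t2 aDEG u 0 0 = t aDEG u 0 0 - g b.-1 u) /\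
       (forall u, n <= u -> run c' t2 aDEG u 0 0 = t aDEG u 0 0) by [].
    suff [h1 h2 _ _] : [/\ forall u, u < n -> run c' t2 aDEG u 0 0 = t aDEG u 0 0 - g b.-1 u,
        forall u, n <= u -> run c' t2 aDEG u 0 0 = t aDEG u 0 0,
        run c' t2 aGA = t aGA & run c' t2 aBEST = t1 aBEST] by [].
    apply: (run_Loop (P := fun j t' => [/\ forall u, u < j -> t' aDEG u 0 0 = t aDEG u 0 0 - g b.-1 u,
        forall u, j <= u -> t' aDEG u 0 0 = t aDEG u 0 0,
        t' aGA = t aGA & t' aBEST = t1 aBEST]) parN) => // j t' ltj [k1 k2 k3 k4].
    have ev : den (Arr1 aDEG (Var j) - Arr2 aGA (Arr0 aBEST - Cst 1) (Var j))%exp t' =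
        t aDEG j 0 0 - g b.-1 j.
      rewrite -[LHS]/(t' aDEG j 0 0 - t' aGA (t' aBEST 0 0 0 - 1) j 0) k2 // k3 k4.
      by rewrite -[t1 aBEST 0 0 0]/b subn1 tG sG.
    rewrite -[run _ _]/(upda t' aDEG j 0 0 (den _ t')) ev; split=> //.
    - move=> u; rewrite ltnS leq_eqVlt /upda /upd3 eqxx /= andbT => /orP[/eqP->|ltu].
        by rewrite eqxx.
      by rewrite ltn_eqF // k1.
    - by move=> u ltu; rewrite /upda /upd3 eqxx /= gtn_eqF // k2 // ltnW.
  split; first by rewrite q1.
  have [r1 r2 r3 r4 r5] := peel_step lti pe ltb pb minb.
  have posE u : run c' t2 aPOS u 0 0 = if u == b.-1 then i.+1 else t aPOS u 0 0.
    by rewrite q2 /t2 /upda /upd3 eqxx !andbT.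
  have slE u v : sees_later (fun u => run c' t2 aPOS u 0 0) u v =
     sees_later (fun u => if u == b.-1 then i.+1 else t aPOS u 0 0) u v.
    by rewrite /sees_later !posE.
  split.
  - by move=> u ltu; rewrite posE r1.
  - by rewrite -r2; apply: eq_bigr => u _; rewrite posE.
  - by move=> u v ltu ltv; rewrite !posE; apply: r3.
  - move=> u ltu; rewrite posE q4 // => /(r4 _ ltu) ->; apply: eq_bigr => v _.
    by rewrite posE.
  - move=> u ltu; rewrite posE => /(r5 _ ltu); apply: leq_trans.
    by apply: leq_sum => v _; rewrite slE.
have nz u : u < n -> run c2 s1 aPOS u 0 0 != 0.
  move=> ltu; have /eqP := pos_card pe; rewrite subnn sum_nat_eq0 => /forallP/(_ (Ordinal ltu)).
  by rewrite /= eqb0.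
split=> [u v ltu ltv|u ltu].
  exact: (pos_inj pe ltu ltv (nz u ltu)).
apply: leq_trans (deg_out pe ltu (nz u ltu)); apply: leq_sum => v _.
by rewrite /sees_later (negPf (nz v (ltn_ord v))).
Qed.

End Peeling.

(** * Listing the out-neighbours *)

Section Orienting.

Variables (W : nat) (par inp : nat -> nat).
Hypothesis W_ge : narr <= W.

Local Notation den := (den W par inp).
Local Notation run := (run W par inp).

Variables (n d : nat) (g : nat -> nat -> bool) (p : nat -> nat) (s : arrays).
Hypotheses (parN : par pN = n) (n_lt : n.+2 < W).
Hypothesis sG : forall u v, u < n -> s aGA u v 0 = g u v.
Hypothesis sP : forall u, s aPOS u 0 0 = p u.
Hypothesis sIDX : forall u, s aIDX u 0 0 = 0.
Hypothesis sOUT : forall l x, s aOUT l x 0 = 0.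

Definition oarc u v : bool := g u v && (p u < p v).
Definition orank u v : nat := \sum_(w < v) oarc u w.

Hypothesis out_le : forall u, u < n -> orank u n <= d.

Lemma orank_le u v w : v <= w -> orank u v <= orank u w.
Proof.
elim: w => [|w IH]; first by rewrite leqn0 => /eqP->.
rewrite leq_eqVlt => /orP[/eqP->//|]; rewrite ltnS => /IH h.
by apply: leq_trans h _; rewrite /orank big_ord_recr leq_addr.
Qed.

Lemma orankS u v : oarc u v -> orank u v.+1 = (orank u v).+1.
Proof. by move=> h; rewrite /orank big_ord_recr /= h addn1. Qed.

Lemma orank_inj u v w : oarc u v -> oarc u w -> orank u v = orank u w -> v = w.
Proof.
move=> hv hw E; case: (ltngtP v w) => // lt.
  by have := orank_le u lt; rewrite orankS // E ltnn.
by have := orank_le u lt; rewrite orankS // E ltnn.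
Qed.

Lemma orank_leq u v : orank u v <= v.
Proof.
rewrite -[leqRHS]card_ord -sum1_card; apply: leq_sum => w _.
by case: (oarc _ _).
Qed.

Lemma den_earlier (t : arrays) u v : u < n -> t aGA = s aGA -> t aPOS = s aPOS ->
  den (earlier (Var u) (Var v)) t = oarc u v.
Proof.
move=> ltu tG tP; apply: (den_And (p := g u v) (q := p u < p v)).
  by rewrite -[LHS]/(t aGA u v 0) tG sG.
by rewrite -!sP -tP.
Qed.

(** [orank u] increases strictly along the out-neighbours of u, so that distinct arcs from u get
    distinct indices, all at most the maximal out-degree D. *)
Lemma orientP : exists D, let s' := run (orient nat) s in
  [/\ s' aD 0 0 0 = D, D <= d, D <= n,
      forall x y : 'I_n, \sum_(1 <= l < D.+1) (s' aOUT l x.+1 0 == y.+1) = oarc x y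
    & [/\ forall x : 'I_n, s' aOUT D.+1 x.+1 0 = x.+1,
      forall l, 0 < l -> s' aOUT l 0 0 = 0
    & forall l x, 0 < l -> s' aOUT l x 0 <= n]].
Proof.
rewrite /orient; set c1 := Loop _ _; set c2 := Sto0 _ _; set c3 := Loop _ _; set c4 := Loop _ _.
rewrite -[run (c1;; _) s]/(run c4 (run c3 (run c2 (run c1 s)))).
set s1 := run c1 s; set s2 := run c2 s1; set s3 := run c3 s2; set s4 := run c4 s3.
have n_lt1 : n.+1 < W by apply: ltnW.
have [G1 P1 O1 I1] : [/\ s1 aGA = s aGA, s1 aPOS = s aPOS, s1 aOUT = s aOUT &
    forall u v, u < n -> v <= n -> s1 aIDX u v 0 = orank u v].
  split; try by (rewrite /s1 run_avoids //; avoid).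
  suff [_ _ h _] : [/\ s1 aGA = s aGA, s1 aPOS = s aPOS,
    forall u v, u < n -> v <= n -> s1 aIDX u v 0 = orank u v
    & forall u, n <= u -> s1 aIDX u 0 0 = 0] by [].
  apply: (run_Loop (P := fun j t => [/\ t aGA = s aGA, t aPOS = s aPOS,
    forall u v, u < j -> v <= n -> t aIDX u v 0 = orank u v
    & forall u, j <= u -> t aIDX u 0 0 = 0]) parN) => // u t ltu [t1 t2 t3 t4].
  set c := Loop _ _.
  have [r1 r2 r3 r4] : [/\ run c t aGA = s aGA, run c t aPOS = s aPOS,
      forall v, v <= n -> run c t aIDX u v 0 = orank u v
    & forall w v, w != u -> run c t aIDX w v 0 = t aIDX w v 0].
    apply: (run_Loop (P := fun j t' => [/\ t' aGA = s aGA, t' aPOS = s aPOS,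
      forall v, v <= j -> t' aIDX u v 0 = orank u v
    & forall w v, w != u -> t' aIDX w v 0 = t aIDX w v 0]) parN).
      by split=> // v; rewrite leqn0 => /eqP->; rewrite t4 // /orank big_ord0.
    move=> j t' ltj [k1 k2 k3 k4].
    have e1 : den (Var j + Cst 1)%exp t' = j.+1.
      by rewrite (den_Add (x := j) (y := 1)) ?addn1 //; apply: leq_ltn_trans n_lt1; lia.
    have e2 : den (Arr2 aIDX (Var u) (Var j) + earlier (Var u) (Var j))%exp t' = orank u j.+1.
      have eo : orank u j.+1 = orank u j + oarc u j by rewrite /orank big_ord_recr.
      rewrite eo; apply: den_Add; first by rewrite -k3.
        exact: den_earlier.
      by rewrite -eo; apply: leq_ltn_trans (orank_leq _ _) _; apply: leq_ltn_trans n_lt1; lia.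
    rewrite -[run _ _]/(upda t' aIDX u (den _ t') 0 (den _ t')) e1 e2; split=> //.
    - move=> v; rewrite leq_eqVlt /upda /upd3 !eqxx /= andbT => /orP[/eqP->|].
        by rewrite eqxx.
      by rewrite ltnS => ltv; rewrite ltn_eqF ?ltnS // k3.
    - by move=> w v wu; rewrite /upda /upd3 eqxx (negPf wu) /= k4.
  split=> //.
  - move=> w v; rewrite ltnS leq_eqVlt => /orP[/eqP->|ltw]; first exact: r3.
    by rewrite r4 ?ltn_eqF //; apply: t3.
  - by move=> w ltw; rewrite r4 ?gtn_eqF // t4 // ltnW.
have [G2 P2 O2 I2] : [/\ s2 aGA = s aGA, s2 aPOS = s aPOS, s2 aOUT = s aOUT & s2 aIDX = s1 aIDX].
  by split; rewrite /s2 run_avoids.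
pose D := \max_(u < n) orank u n.
have D2 : s2 aD 0 0 0 = D.
  rewrite -[LHS]/(foldl (fun acc u => den (Ite (Var acc < Arr2 aIDX (Var u) (Par pN))
     (Arr2 aIDX (Var u) (Par pN)) (Var acc))%exp s1) 0 (iota 0 (par pN))) parN.
  pose g' j := \max_(u < n | u < j) orank u n.
  have -> : D = g' n by apply: eq_bigl => u; rewrite ltn_ord.
  apply: fold_iota => [|j ltj]; first by rewrite /g' big_pred0.
  have ej : den (Arr2 aIDX (Var j) (Par pN)) s1 = orank j n.
    by rewrite -[LHS]/(s1 aIDX j (par pN) 0) parN I1.
  have -> : g' j.+1 = maxn (orank j n) (g' j).
    rewrite /g' (bigD1 (Ordinal ltj)) //=; congr maxn; apply: eq_bigl => u.
    by rewrite ltnS -val_eqE /= andbC ltn_neqAle.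
  rewrite (den_Ite _ _ (p := g' j < orank j n)); last by rewrite -ej.
  by rewrite ej /maxn; case: (ltngtP (g' j) (orank j n)) => //= ->.
have D_ge u : u < n -> orank u n <= D by move=> ltu; apply: (leq_bigmax (Ordinal ltu)).
have D_le_d : D <= d by apply/bigmax_leqP => u _; apply: out_le.
have D_le_n : D <= n by apply/bigmax_leqP => u _; apply: orank_leq.
(* Every arc is listed under its index and every non-zero entry comes from an arc. Row 0, which
   collects the non-arcs, is excluded by [0 < l]. *)
pose spec (t : arrays) (u m : nat) :=
  (forall v, v < m -> oarc u v -> t aOUT (orank u v).+1 u.+1 0 = v.+1) /\
  (forall l, 0 < l -> t aOUT l u.+1 0 != 0 ->
     exists v, [/\ v < m, oarc u v, l = (orank u v).+1 & t aOUT l u.+1 0 = v.+1]).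
have [D3 S3 Z3 L3] : [/\ s3 aD = s2 aD, forall u, u < n -> spec s3 u n,
    forall l, 0 < l -> s3 aOUT l 0 0 = 0 & forall l x, n < x -> 0 < l -> s3 aOUT l x 0 = 0].
  suff [? ? ? [? ? ?]] : [/\ s3 aD = s2 aD, forall u, u < n -> spec s3 u n,
    forall l, 0 < l -> s3 aOUT l 0 0 = 0 & [/\ forall l x, n < x -> 0 < l -> s3 aOUT l x 0 = 0,
    s3 aGA = s aGA /\ s3 aPOS = s aPOS & s3 aIDX = s1 aIDX]] by [].
  apply: (run_Loop (P := fun j t => [/\ t aD = s2 aD, forall u, u < j -> spec t u n,
    forall l, 0 < l -> t aOUT l 0 0 = 0 & [/\ forall l x, j < x -> 0 < l -> t aOUT l x 0 = 0,
    t aGA = s aGA /\ t aPOS = s aPOS & t aIDX = s1 aIDX]]) parN).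
    by split=> // [l _|]; [rewrite O2 sOUT|split=> // l x _ _; rewrite O2 sOUT].
  move=> u t ltu [t1 t2 t3 [t4 [t5 t5'] t6]].
  set c := Loop _ _.
  have [r1 r2 r3 [r4 r5]] : [/\ run c t aD = s2 aD, spec (run c t) u n,
      forall l x, 0 < l -> x != u.+1 -> run c t aOUT l x 0 = t aOUT l x 0
    & (run c t aGA = s aGA /\ run c t aPOS = s aPOS) /\ run c t aIDX = s1 aIDX].
    apply: (run_Loop (P := fun j t' => [/\ t' aD = s2 aD, spec t' u j,
      forall l x, 0 < l -> x != u.+1 -> t' aOUT l x 0 = t aOUT l x 0
    & (t' aGA = s aGA /\ t' aPOS = s aPOS) /\ t' aIDX = s1 aIDX]) parN).
      by split=> //; split=> // l l0; rewrite t4.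
    move=> j t' ltj [k1 [k2 k2'] k3 [[k4 k4'] k5]].
    have le : orank u j < n by apply: leq_ltn_trans (orank_leq _ _) ltj.
    have e1 : den (Ite (earlier (Var u) (Var j)) (Arr2 aIDX (Var u) (Var j) + Cst 1) (Cst 0))%exp t' =
        if oarc u j then (orank u j).+1 else 0.
      rewrite (den_Ite _ _ (den_earlier j ltu k4 k4')); case: (oarc u j) => //.
      rewrite (den_Add (x := orank u j) (y := 1)) ?addn1 //.
        by rewrite -[LHS]/(t' aIDX u j 0) k5 I1 // ltnW.
      by apply: leq_ltn_trans n_lt1; lia.
    have e2 x : x < n -> den (Var x + Cst 1)%exp t' = x.+1.
      by move=> ltx; rewrite (den_Add (x := x) (y := 1)) ?addn1 //; apply: leq_ltn_trans n_lt1; lia.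
    rewrite -[run _ _]/(upda t' aOUT (den _ t') (den _ t') 0 (den _ t')) e1 !e2 //.
    split=> //.
    - case: ifP => o; last first.
        split=> [v|l l0]; rewrite /upda /upd3 !eqxx.
          rewrite ltnS leq_eqVlt => /orP[/eqP->|ltv] o'; first by rewrite o' in o.
          by rewrite /= k2.
        rewrite (gtn_eqF l0) /= => /(k2' l l0)[v [q1 q2 q3 q4]].
        by exists v; split=> //; apply: ltnW.
      split=> [v|l l0]; rewrite /upda /upd3 !eqxx /= !andbT.
        rewrite ltnS leq_eqVlt => /orP[/eqP->|ltv] o'; first by rewrite eqxx.
        rewrite eqSS; case: eqP => [E|_]; last exact: k2.
        by have E' := orank_inj o' o E; rewrite E' ltnn in ltv.
      case: (eqVneq l (orank u j).+1) => [-> _|_ /(k2' l l0)[v [q1 q2 q3 q4]]]; first by exists j.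
      by exists v; split=> //; apply: ltnW.
    - move=> l x l0 xu; rewrite /upda /upd3 eqxx (negPf xu) /= andbF.
      exact: k3.
  split=> //.
  - move=> w; rewrite ltnS leq_eqVlt => /orP[/eqP->//|ltw].
    have nwu : w.+1 != u.+1 by rewrite eqSS ltn_eqF.
    have [h1 h2] := t2 w ltw; split=> [v ltv o|l l0]; rewrite r3 //; first exact: h1.
    exact: h2.
  - by move=> l l0; rewrite r3 // t3.
  - split=> // l x ltx l0; rewrite r3 ?gtn_eqF // t4 //; exact: ltnW.
have [D4 F4 K4] : [/\ s4 aD = s2 aD, forall x, x < n -> s4 aOUT D.+1 x.+1 0 = x.+1
   & forall l x, (l != D.+1) || (x == 0) || (n < x) -> s4 aOUT l x 0 = s3 aOUT l x 0].
  apply: (run_Loop (P := fun j t => [/\ t aD = s2 aD, forall x, x < j -> t aOUT D.+1 x.+1 0 = x.+1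
   & forall l x, (l != D.+1) || (x == 0) || (n < x) -> t aOUT l x 0 = s3 aOUT l x 0]) parN) => //.
  move=> j t ltj [k1 k2 k3].
  have e1 : den (Arr0 aD + Cst 1)%exp t = D.+1.
    rewrite (den_Add (x := D) (y := 1)) ?addn1 //.
      by rewrite -[LHS]/(t aD 0 0 0) k1.
    by apply: leq_ltn_trans n_lt1; lia.
  have e2 : den (Var j + Cst 1)%exp t = j.+1.
    by rewrite (den_Add (x := j) (y := 1)) ?addn1 //; apply: leq_ltn_trans n_lt1; lia.
  rewrite -[run _ _]/(upda t aOUT (den _ t) (den _ t) 0 (den _ t)) e1 e2; split=> //.
  - move=> x; rewrite ltnS leq_eqVlt /upda /upd3 !eqxx /= andbT => /orP[/eqP->|ltx].
      by rewrite eqxx.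
    by rewrite eqSS ltn_eqF // k2.
  - move=> l x h; rewrite /upda /upd3 eqxx /= andbT; case: eqP => [El|_]; last exact: k3.
    case: eqP => [Ex|_]; last exact: k3.
    by move: h; rewrite El Ex eqxx /= ltnNge ltj.
exists D; split=> //.
- by rewrite D4.
- move=> x y; have [h1 h2] := S3 x (ltn_ord x).
  have Kl l : 1 <= l < D.+1 -> s4 aOUT l x.+1 0 = s3 aOUT l x.+1 0.
    by case/andP=> _ ltl; rewrite K4 // ltn_eqF.
  have uniq_l l : 0 < l -> s3 aOUT l x.+1 0 = y.+1 -> oarc x y /\ l = (orank x y).+1.
    move=> l0 E; have [|v [q1 q2 q3 q4]] := h2 l l0; first by rewrite E.
    by move: q4; rewrite E => -[->].
  rewrite big_nat; case o: (oarc x y); last first.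
    rewrite big1 // => l lD; rewrite Kl //; case: eqP => // /uniq_l.
    by case/andP: lD => l0 _ /(_ l0)[]; rewrite o.
  have lD : 1 <= (orank x y).+1 < D.+1.
    rewrite /= ltnS -orankS //; apply: leq_trans (D_ge x (ltn_ord x)).
    by apply: orank_le.
  rewrite -big_nat (bigD1_seq (orank x y).+1) ?mem_index_iota ?iota_uniq //=.
  rewrite Kl // h1 // eqxx big1_seq // => l /andP[nl]; rewrite mem_index_iota => ll.
  rewrite Kl //; case: eqP => // E; case/andP: ll => l0 _.
  by have [_ El] := uniq_l l l0 E; rewrite El eqxx in nl.
- split=> [x|l l0|l x l0].
  + exact: F4.
  + by rewrite K4 ?orbT // Z3.
  case: (boolP ((l != D.+1) || (x == 0) || (n < x))) => [h|].
    rewrite K4 //; case: x h => [|x] h; first by rewrite Z3.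
    case: (ltnP x n) => [ltx|lex]; last by rewrite L3.
    case: (eqVneq (s3 aOUT l x.+1 0) 0) => [->//|].
    by have [_ h2] := S3 x ltx; move=> /(h2 l l0)[v [q1 _ _ ->]].
  rewrite !negb_or negbK -leqNgt => /andP[/andP[/eqP-> x0] lex].
  by case: x x0 lex => // x _ ltx; rewrite F4.
Qed.

End Orienting.

(** * Correctness of the counting phase *)

Section Labels.

Variables (W : nat) (par inp : nat -> nat).
Hypothesis W_ge : narr <= W.

Local Notation den := (den W par inp).
Local Notation run := (run W par inp).

Variables (k D : nat).
Hypotheses (parK : par pK = k) (parKK : par pKK = k * k) (parD : par pD1 = D.+1).
Hypotheses (parA : par pA = 2 * D.+1) (codes_lt : (2 * D.+1) ^ (k * k) < W).

Definition label_digit c u v := digit (fun=> 2 * D.+1) (u * k + v) c.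

Lemma pair_index u v : u < k -> v < k -> u * k + v < k * k.
Proof.
move=> ltu ltv; apply: leq_trans (_ : u.+1 * k <= _); first by rewrite mulSn addnC ltn_add2r.
by rewrite leq_mul2r ltu orbT.
Qed.

Lemma kk_lt : k * k < W.
Proof.
apply: leq_trans codes_lt; rewrite ltnS; apply: ltnW.
by apply: ltn_expl; rewrite mul2n doubleS.
Qed.

Lemma load_labelsP (s : arrays) c cx : (forall t, den cx t = c) ->
  let s' := run (load_labels cx) s in
  (forall u v, u < k -> v < k -> s' aE u v 0 = label_digit c u v) /\
  (forall u v, u < k -> v < k -> s' aL u v 0 = arc_label D (label_digit c) u v).
Proof.
move=> hc; rewrite /load_labels; set c1 := Loop _ _; set c2 := Loop _ _.
rewrite -[run (c1;; c2) s]/(run c2 (run c1 s)); set s1 := run c1 s.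
have E1 u v : u < k -> v < k -> s1 aE u v 0 = label_digit c u v.
  apply: (run_fill2 (E := label_digit c) parK parK) => {}u {}v t ltu ltv ht.
  have kk := kk_lt; have lt_i := pair_index ltu ltv.
  apply: (den_Digit W_ge (m := k * k) (bx := fun=> 2 * D.+1)) => //; first exact: ltnW.
    apply: den_Add => //; last exact: ltn_trans kk.
    rewrite (den_Mul (x := u) (y := k)) //.
    by apply: leq_ltn_trans kk; rewrite leq_mul2r (ltnW ltu) orbT.
  apply: leq_ltn_trans codes_lt; rewrite /place prod_nat_const card_ord.
  by apply: leq_pexp2l => //; apply: ltnW.
have E2 : run c2 s1 aE = s1 aE by rewrite run_avoids //; avoid.
split=> u v; first by rewrite E2; apply: E1.
apply: (run_fill2 (E := arc_label D (label_digit c)) parK parK) => {}u {}v t ltu ltv ht.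
have te x y : x < k -> y < k -> den (Arr2 aE (Var x) (Var y)) t = label_digit c x y.
  by move=> ltx lty; rewrite -[LHS]/(t aE x y 0) ht // E1.
rewrite (den_Ite _ _ (p := u < v)) // /arc_label; case: (ltngtP u v) => uv.
- rewrite (den_Ite _ _ (p := label_digit c u v <= D.+1)); last first.
    by rewrite den_Le te // -parD.
  by case: ifP => // _; rewrite te.
- rewrite (den_Ite _ _ (p := true)) ?(den_Lt (x := v) (y := u)) ?uv //.
  by rewrite -[LHS]/(den (Arr2 aE (Var v) (Var u)) t - par pD1) te // parD.
- by rewrite (den_Ite _ _ (p := false)) // (den_Lt (x := v) (y := u)) ?uv // ltnn.
Qed.

End Labels.

(** * Forced values *)

Section Propagation.

Variables (W : nat) (par inp : nat -> nat).
Hypothesis W_ge : narr <= W.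

Local Notation den := (den W par inp).
Local Notation run := (run W par inp).

Variables (k n : nat) (L F : nat -> nat -> nat) (s0 : arrays).
Hypotheses (parK : par pK = k) (parN1 : par pN1 = n.+1) (n_lt : n.+2 < W).
Hypothesis sL : forall u v, u < k -> v < k -> s0 aL u v 0 = L u v.
Hypothesis sF : forall l x, 0 < l -> s0 aOUT l x 0 = F l x.
Hypothesis F_le : forall l x, 0 < l -> F l x <= n.

Local Notation arc := (@arc_rel k L).

Lemma short_path (s v : 'I_k) : connect arc s v ->
  exists p, [/\ path arc s p, v = last s p & size p < k].
Proof.
case/connectP=> p ep ->; case/shortenP: ep => q eq uq _.
exists q; split=> //; rewrite -[k in _ < k]card_ord.
have /card_uniqP E := uq; rewrite -[(size q).+1]/(size (s :: q)) -E.
exact: max_card.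
Qed.

Section OneRoot.

Variables (s : 'I_k) (x : nat).
Hypothesis x_le : x <= n.

Let frame (t : arrays) :=
  (forall a, a != aPSI -> a != aGOOD -> t a = s0 a) /\
  (forall s' x' v : nat, (s' != s :> nat) || (x' != x) -> t aPSI s' x' v = s0 aPSI s' x' v).

Let sound (A : nat -> nat) := [/\ A s = x.+1,
  forall v : 'I_k, A v != 0 -> connect arc s v,
  forall phi (v : 'I_k), phi s = x -> solution L F phi -> A v != 0 -> A v = (phi v).+1
  & forall v : 'I_k, A v <= n.+1].

Let closed_step (A : nat -> nat) (u v : nat) : nat -> nat :=
  fun w => if (w == v) && [&& L u v != 0, A u != 0 & A v == 0]
           then (F (L u v) (A u).-1).+1 else A w.

Lemma sound_step A u v : u < k -> v < k -> sound A -> sound (closed_step A u v).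
Proof.
move=> ltu ltv [h1 h2 h3 h4]; rewrite /closed_step; split.
- case: ifP => // /andP[/eqP sv /and3P[_ _]].
  by rewrite -sv h1.
- move=> w; case: ifP => [|_]; last exact: h2.
  case/andP=> /eqP wv /and3P[Luv Au _] _.
  apply: connect_trans (h2 (Ordinal ltu) Au) (connect1 _) => /=.
  by rewrite /arc_rel /= wv.
- move=> phi w ps sol; case: ifP => [|_]; last exact: h3.
  case/andP=> /eqP wv /and3P[Luv Au _] _; congr _.+1.
  rewrite (h3 phi (Ordinal ltu) ps sol Au) /=.
  rewrite -(sol (Ordinal ltu) w) /= wv //.
- move=> w; case: ifP => // /andP[_ /and3P[Luv _ _]].
  by rewrite ltnS F_le // lt0n.
Qed.

Lemma sound_ext A A' : A =1 A' -> sound A -> sound A'.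
Proof.
move=> E [h1 h2 h3 h4]; split; [by rewrite -E|move=> v..]; last by rewrite -E.
- by rewrite -E; apply: h2.
- by move=> phi ps sol; rewrite -E; apply: h3.
Qed.

(** Two invariants: every entered value is forced by the value x of s, and after r rounds the ends
    of all walks with at most r arcs have been reached. The frame condition preserves the results
    for other roots and values. *)
Lemma propagateP (ex_s ex_x : exp nat) (t0 : arrays) :
  (forall t, den ex_s t = s) -> (forall t, den ex_x t = x) -> frame t0 ->
  let t := run (propagate ex_s ex_x) t0 in
  [/\ frame t, forall v : 'I_k, (t aPSI s x v != 0) = connect arc s v,
     t aPSI s x s = x.+1
   & (forall phi (v : 'I_k), phi s = x -> solution L F phi ->
       connect arc s v -> t aPSI s x v = (phi v).+1) /\
     t aGOOD s x 0 = @good k L F (t aPSI) s x /\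
     (forall s' x' : nat, (s' != s :> nat) || (x' != x) -> t aGOOD s' x' 0 = t0 aGOOD s' x' 0)].
Proof.
move=> hs hx fr0; rewrite /propagate; set c1 := Loop _ _; set c2 := Loop _ _; set c3 := Sto2 _ _ _ _.
rewrite -[run (c1;; _) t0]/(run c3 (run c2 (run c1 t0))).
set t1 := run c1 t0; set t2 := run c2 t1.
have x_lt : x.+1 < W by apply: leq_ltn_trans n_lt; lia.
have den_psi t (v : nat) : den (psi ex_s ex_x (Var v)) t = t aPSI s x v.
  by rewrite -[LHS]/(t aPSI (den ex_s t) (den ex_x t) v) hs hx.
have frame_upd t v y : frame t -> frame (upda t aPSI s x v y).
  move=> [f1 f2]; split=> [a a1 a2|s' x' w ne].
    by rewrite /upda (negPf a1) f1.
  rewrite /upda eqxx /upd3; case: ifP => [/and3P[/eqP es /eqP ex _]|_]; last exact: f2.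
  by move: ne; rewrite es ex !eqxx.
have [fr1 E1 GD1] : [/\ frame t1, forall v, v < k -> t1 aPSI s x v = if v == s then x.+1 else 0
   & t1 aGOOD = t0 aGOOD].
  apply: (run_Loop (P := fun j t => [/\ frame t,
     forall v, v < j -> t aPSI s x v = if v == s then x.+1 else 0 & t aGOOD = t0 aGOOD]) parK) => //.
  move=> v t ltv [h1 h2 h3].
  have e1 : den (Ite (Var v == ex_s) (ex_x + Cst 1) (Cst 0))%exp t = if v == s then x.+1 else 0.
    rewrite (den_Ite _ _ (p := v == s)); last by rewrite (den_Eq (x := v) (y := s)).
    by case: eqP => // _; rewrite (den_Add (x := x) (y := 1)) ?addn1.
  rewrite -[run _ _]/(upda t aPSI (den ex_s t) (den ex_x t) v (den _ t)) hs hx e1.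
  split=> //; first exact: frame_upd.
  move=> w; rewrite ltnS leq_eqVlt /upda /upd3 !eqxx => /orP[/eqP->|ltw].
    by rewrite eqxx.
  by rewrite ltn_eqF //= h2.
have so1 : sound (t1 aPSI s x).
  split.
  - by rewrite E1 // eqxx.
  - by move=> v; rewrite E1 //; case: (eqVneq (v : nat) s) => [/ord_inj->|].
  - by move=> phi v ps _; rewrite E1 //; case: (eqVneq (v : nat) s) => // /ord_inj-> _; rewrite ps.
  - by move=> v; rewrite E1 //; case: eqP.
pose ok t := frame t /\ sound (t aPSI s x) /\ t aGOOD = t0 aGOOD.
have step u v t : u < k -> v < k -> ok t ->
    let t' := run (Sto aPSI ex_s ex_x (Var v)
      (Ite ((Nz (Arr2 aL (Var u) (Var v)) && Nz (psi ex_s ex_x (Var u))) &&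
             Not (psi ex_s ex_x (Var v)))%exp
         (psi_next ex_s ex_x (Var u) (Var v)) (psi ex_s ex_x (Var v)))) t in
    [/\ ok t', forall w, t aPSI s x w != 0 -> t' aPSI s x w != 0
      & L u v != 0 -> t aPSI s x u != 0 -> t' aPSI s x v != 0].
  move=> ltu ltv [f1 [f2 f3]].
  have tL : den (Arr2 aL (Var u) (Var v)) t = L u v.
    by rewrite -[LHS]/(t aL u v 0) (proj1 f1) // sL.
  set c := And _ _.
  have ec : den c t = [&& L u v != 0, t aPSI s x u != 0 & t aPSI s x v == 0].
    rewrite andbA; apply: den_And; last by rewrite den_Not den_psi.
    by apply: den_And; rewrite den_Nz ?tL // den_psi.
  have en : L u v != 0 -> den (psi_next ex_s ex_x (Var u) (Var v)) t =
      (F (L u v) (t aPSI s x u).-1).+1.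
    move=> Luv; rewrite (den_Add (x := F (L u v) (t aPSI s x u).-1) (y := 1)) ?addn1 //.
      rewrite -[LHS]/(t aOUT (den (Arr2 aL (Var u) (Var v)) t) (den (psi ex_s ex_x (Var u)) t - 1) 0).
      by rewrite tL den_psi (proj1 f1) // sF ?subn1 // lt0n.
    by apply: leq_ltn_trans n_lt; rewrite ltnS; apply: leq_trans (leqnSn _); rewrite F_le // lt0n.
  set e := Ite _ _ _; have ee : den e t = closed_step (t aPSI s x) u v v.
    rewrite (den_Ite _ _ ec) /closed_step eqxx /=; case: ifP => [/and3P[Luv _ _]|_].
      exact: en.
    exact: den_psi.
  rewrite -[run _ t]/(upda t aPSI (den ex_s t) (den ex_x t) v (den e t)) hs hx ee.
  have psiE w : upda t aPSI s x v (closed_step (t aPSI s x) u v v) aPSI s x w =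
      closed_step (t aPSI s x) u v w.
    rewrite /upda /upd3 !eqxx /=; case: (eqVneq w v) => [->//|wv].
    by rewrite /closed_step (negPf wv).
  split.
  - split; [exact: frame_upd | split=> //].
    by apply: sound_ext (fun w => esym (psiE w)) _; apply: sound_step.
  - move=> w tw; rewrite psiE /closed_step; by case: ifP.
  - move=> Luv tu; rewrite psiE /closed_step Luv tu eqxx /=.
    by case: (eqVneq (t aPSI s x v) 0).
have [[fr2 [so2 GD2]] reach2] : ok t2 /\ forall p, path arc s p -> size p <= k ->
    t2 aPSI s x (last s p) != 0.
  apply: (run_Loop (P := fun r t => ok t /\ forall p, path arc s p -> size p <= r ->
    t aPSI s x (last s p) != 0) parK).
    split; first by split.
    by move=> p _; rewrite leqn0 => /nilP->; rewrite /= E1 // eqxx.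
  move=> r t ltr [okt rt]; set c := Loop _ _.
  have [ok' mono next] : [/\ ok (run c t), forall w, t aPSI s x w != 0 -> run c t aPSI s x w != 0
    & forall u v, u < k -> v < k -> L u v != 0 -> t aPSI s x u != 0 -> run c t aPSI s x v != 0].
    apply: (run_Loop (P := fun j t' => [/\ ok t', forall w, t aPSI s x w != 0 -> t' aPSI s x w != 0
    & forall u v, u < j -> v < k -> L u v != 0 -> t aPSI s x u != 0 -> t' aPSI s x v != 0]) parK) => //.
    move=> u t' ltu [k1 k2 k3]; set c' := Loop _ _.
    have [q1 q2 q3] : [/\ ok (run c' t'), forall w, t' aPSI s x w != 0 -> run c' t' aPSI s x w != 0
      & forall v, v < k -> L u v != 0 -> t' aPSI s x u != 0 -> run c' t' aPSI s x v != 0].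
      apply: (run_Loop (P := fun j t'' => [/\ ok t'',
         forall w, t' aPSI s x w != 0 -> t'' aPSI s x w != 0
      & forall v, v < j -> L u v != 0 -> t' aPSI s x u != 0 -> t'' aPSI s x v != 0]) parK) => //.
      move=> v t'' ltv [m1 m2 m3]; have [p1 p2 p3] := step u v t'' ltu ltv m1.
      split=> //; first by move=> w /m2/p2.
      move=> w; rewrite ltnS leq_eqVlt => /orP[/eqP->|ltw] Luw tu; last exact/p2/m3.
      by apply: p3 => //; apply: m2.
    split=> //; first by move=> w /k2/q2.
    move=> w v; rewrite ltnS leq_eqVlt => /orP[/eqP->|ltw] ltv Lwv tw; last exact/q2/(k3 w).
    by apply: q3 => //; apply: k2.
  split=> // p; case: (lastP p) => [|q w].
    by move=> _ _; apply: mono; apply: (rt [::]).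
  rewrite rcons_path size_rcons last_rcons => /andP[pq qw] ltq.
  by apply: (next (last s q)) => //; apply: rt.
have [so_root so_conn so_val so_le] := so2.
have reachE (v : 'I_k) : (t2 aPSI s x v != 0) = connect arc s v.
  apply/idP/idP => [|/short_path[p [pp -> ltp]]]; first exact: so_conn.
  by apply: reach2 => //; apply: ltnW.
pose t3 := run c3 t2.
have t3E : t3 aPSI = t2 aPSI by rewrite /t3 run_avoids.
rewrite -/t3 t3E; split=> //.
- split=> [a a1 a2|s' x' v]; last by rewrite t3E; apply: (proj2 fr2).
  by rewrite /t3 /= /upda (negPf a2) (proj1 fr2).
split; first by move=> phi v ps sol; rewrite -reachE; apply: so_val.
set e := All pK _ in c3 @t3 t3E *.
have -> : t3 = upda t2 aGOOD s x 0 (den e t2).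
  by rewrite /t3 -[run _ _]/(upda t2 aGOOD (den ex_s t2) (den ex_x t2) 0 (den e t2)) hs hx.
have -> : den e t2 = @good k L F (t2 aPSI) s x.
  apply: (den_All (g := fun u => [forall v : 'I_k, (t2 aPSI s x v != 1) &&
     (((L u v != 0) && (t2 aPSI s x u != 0)) ==>
        (t2 aPSI s x v == (F (L u v) (t2 aPSI s x u).-1).+1))]) parK) => u.
  apply: (den_All (g := fun v => (t2 aPSI s x v != 1) &&
     (((L u v != 0) && (t2 aPSI s x u != 0)) ==>
        (t2 aPSI s x v == (F (L u v) (t2 aPSI s x u).-1).+1))) parK) => v.
  have tL : den (Arr2 aL (Var (u : nat)) (Var (v : nat))) t2 = L u v.
    by rewrite -[LHS]/(t2 aL u v 0) (proj1 fr2) // sL.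
  apply: den_And.
    by apply: den_Notb; apply: den_Eq => //; apply: den_psi.
  (* With label 0 the successor would be read from row 0 of [aOUT], about which nothing is known.
     But then the premise is 0, and [Le] holds whatever its right side is. *)
  case: (eqVneq (L u v) 0) => [L0|Luv].
    rewrite den_Le; set c := And _ _; have -> : den c t2 = 0; last by rewrite leq0n.
    by rewrite (@den_And _ _ _ _ _ _ false (t2 aPSI s x u != 0)) // den_Nz ?tL ?L0 // den_psi.
  apply: den_Imp.
    by rewrite -[RHS]/(nat_of_bool (true && (t2 aPSI s x u != 0))); apply: den_And;
      rewrite den_Nz ?tL ?Luv // den_psi.
  apply: den_Eq; first exact: den_psi.
  rewrite (den_Add (x := F (L u v) (t2 aPSI s x u).-1) (y := 1)) ?addn1 //.
    rewrite -[LHS]/(t2 aOUT (den (Arr2 aL (Var (u : nat)) (Var (v : nat))) t2)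
       (den (psi ex_s ex_x (Var (u : nat))) t2 - 1) 0).
    by rewrite tL den_psi (proj1 fr2) // sF ?subn1 // lt0n.
  by apply: leq_ltn_trans n_lt; rewrite ltnS; apply: leq_trans (leqnSn _); rewrite F_le // lt0n.
split=> [|s' x' ne]; first by rewrite /upda /upd3 !eqxx.
rewrite /upda /upd3 eqxx GD2; case: ifP => // /and3P[/eqP es /eqP ex _].
by move: ne; rewrite es ex !eqxx.
Qed.

End OneRoot.

End Propagation.

(** * A single strategy: validity, known values and summation *)

Section StrategyProgram.

Variables (W : nat) (par inp : nat -> nat).
Hypothesis W_ge : narr <= W.

Local Notation den := (den W par inp).
Local Notation run := (run W par inp).

Variables (k n : nat).
Hypotheses (parK : par pK = k) (par5 : par p5K = 5 * k) (parK1 : par pK1 = k.+1).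
Hypotheses (code_lt : k.+1 ^ (5 * k) < W) (k5_lt : 5 * k < W).

Definition strat_digit c i := digit (fun=> k.+1) i c.
Definition code_fx c v := strat_digit c v == 1.
Definition code_dt c v := strat_digit c (k + v).
Definition code_pr c v := strat_digit c (k + (k + v)).
Definition code_rk c v := strat_digit c (k + (k + (k + v))).
Definition code_sr c v := strat_digit c (k + (k + (k + (k + v)))) == 1.

Lemma strat_digit_le c i : strat_digit c i <= k.
Proof. by rewrite -ltnS /strat_digit /digit ltn_mod. Qed.

Record strat_arrays (t : arrays) (c : nat) : Prop := StratArrays {
  sa_fx : forall v, v < k -> t aFX v 0 0 = code_fx c v;
  sa_dt : forall v, v < k -> t aDT v 0 0 = code_dt c v;
  sa_pr : forall v, v < k -> t aPR v 0 0 = code_pr c v;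
  sa_rk : forall v, v < k -> t aRK v 0 0 = code_rk c v;
  sa_sr : forall v, v < k -> t aSR v 0 0 = code_sr c v }.

Lemma strat_arrays_eq t t' c : t' aFX = t aFX -> t' aDT = t aDT -> t' aPR = t aPR ->
  t' aRK = t aRK -> t' aSR = t aSR -> strat_arrays t c -> strat_arrays t' c.
Proof. by move=> e1 e2 e3 e4 e5 [h1 h2 h3 h4 h5]; split; rewrite ?e1 ?e2 ?e3 ?e4 ?e5. Qed.

Lemma load_strategyP (cx : exp nat) c s : (forall t, den cx t = c) ->
  strat_arrays (run (load_strategy cx) s) c.
Proof.
move=> hc; rewrite /load_strategy.
set k' := Par pK; set c1 := Loop _ _; set c2 := Loop _ _; set c3 := Loop _ _.
set c4 := Loop _ _; set c5 := Loop _ _.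
rewrite -[run (c1;; _) s]/(run c5 (run c4 (run c3 (run c2 (run c1 s))))).
have digE (i : exp nat) j t : den i t = j -> j < 5 * k ->
    den (Digit p5K (fun=> Par pK1) cx i) t = strat_digit c j.
  move=> hi ltj; apply: (den_Digit W_ge (m := 5 * k) (bx := fun=> k.+1)) => //.
    exact: ltnW.
  apply: leq_ltn_trans code_lt; rewrite /place prod_nat_const card_ord.
  by apply: leq_pexp2l => //; apply: ltnW.
have addE (i : exp nat) j t : den i t = j -> k + j < 5 * k -> den (k' + i)%exp t = k + j.
  by move=> hi lt; apply: den_Add => //; apply: ltn_trans k5_lt.
have bound v j : v < k -> j <= 4 -> j * k + v < 5 * k.
  move=> ltv lej; apply: leq_trans (_ : j.+1 * k <= _); last by rewrite leq_mul2r ltnS lej orbT.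
  by rewrite mulSn addnC ltn_add2r.
have b1 v : v < k -> k + v < 5 * k by move=> /bound/(_ (isT : 1 <= 4)); lia.
have b2 v : v < k -> k + (k + v) < 5 * k by move=> /bound/(_ (isT : 2 <= 4)); lia.
have b3 v : v < k -> k + (k + (k + v)) < 5 * k by move=> /bound/(_ (isT : 3 <= 4)); lia.
have b4 v : v < k -> k + (k + (k + (k + v))) < 5 * k by move=> /bound/(_ (isT : 4 <= 4)); lia.
split=> v ltv.
- do ?(rewrite run_avoids; last by avoid).
  apply: (run_fill1 (E := fun v => code_fx c v) parK) ltv => w t ltw _.
  by apply: den_Eq => //; apply: (digE) => //; apply: leq_trans ltw _; apply: leq_pmull.
- do ?(rewrite run_avoids; last by avoid).
  apply: (run_fill1 (E := fun v => code_dt c v) parK) ltv => w t ltw _.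
  apply: (digE); last exact: b1.
  by apply: (addE); last exact: b1.
- do ?(rewrite run_avoids; last by avoid).
  apply: (run_fill1 (E := fun v => code_pr c v) parK) ltv => w t ltw _.
  apply: (digE); last exact: b2.
  by apply: (addE); [apply: (addE); last exact: b1|exact: b2].
- do ?(rewrite run_avoids; last by avoid).
  apply: (run_fill1 (E := fun v => code_rk c v) parK) ltv => w t ltw _.
  apply: (digE); last exact: b3.
  by apply: (addE); [apply: (addE); [apply: (addE); last exact: b1|exact: b2]|exact: b3].
- apply: (run_fill1 (E := fun v => code_sr c v) parK) ltv => w t ltw _.
  apply: den_Eq => //; apply: (digE); last exact: b4.
  apply: (addE); last exact: b4.
  by apply: (addE); [apply: (addE); [apply: (addE); last exact: b1|exact: b2]|exact: b3].
Qed.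

Variables (psi0 : nat -> nat -> nat -> nat) (c : nat).

Local Notation fx := (code_fx c).
Local Notation dt := (code_dt c).
Local Notation pr := (code_pr c).
Local Notation rk := (code_rk c).
Local Notation sr := (code_sr c).
Local Notation bedge0 := (bedge psi0 sr).
Local Notation known0 := (known k fx dt).

Lemma den_bedge (t : arrays) (es ev : exp nat) s v :
  strat_arrays t c -> t aPSI = psi0 -> den es t = s -> den ev t = v -> s < k -> v < k ->
  den (bedge_ex es ev) t = bedge0 s v.
Proof.
move=> [_ _ _ _ hsr] hp he hv lts ltv.
apply: den_And; first by rewrite -[LHS]/(t aSR (den es t) 0 0) he hsr.
apply: den_And.
  by apply: den_Notb; rewrite -[LHS]/(t aSR (den ev t) 0 0) hv hsr.
by rewrite den_Nz -[den _ t]/(t aPSI (den es t) 0 (den ev t)) he hv hp.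
Qed.

Lemma den_known (t : arrays) (ev : exp nat) v :
  strat_arrays t c -> den ev t = v -> v < k -> den (known_ex ev) t = known0 v.
Proof.
move=> [hfx hdt _ _ _] hv ltv; apply: den_Or.
  by rewrite -[LHS]/(t aFX (den ev t) 0 0) hv hfx.
by apply: den_Lt => //; rewrite -[LHS]/(t aDT (den ev t) 0 0) hv hdt.
Qed.

Lemma den_valid (t : arrays) : strat_arrays t c -> t aPSI = psi0 ->
  den (valid_strategy nat) t = valid k psi0 fx sr dt pr rk.
Proof.
move=> sa hp; have [hfx hdt hpr hrk hsr] := sa; rewrite /valid_strategy.
have dfx (v : exp nat) w : den v t = w -> w < k -> den (Arr1 aFX v) t = fx w.
  by move=> hv ltw; rewrite -[LHS]/(t aFX (den v t) 0 0) hv hfx.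
have ddt (v : 'I_k) : den (Arr1 aDT (Var (v : nat))) t = dt v by rewrite -[LHS]/(t aDT v 0 0) hdt.
have dpr (v : 'I_k) : den (Arr1 aPR (Var (v : nat))) t = pr v by rewrite -[LHS]/(t aPR v 0 0) hpr.
have drk (v : 'I_k) : den (Arr1 aRK (Var (v : nat))) t = rk v by rewrite -[LHS]/(t aRK v 0 0) hrk.
have dsr (v : 'I_k) : den (Arr1 aSR (Var (v : nat))) t = sr v by rewrite -[LHS]/(t aSR v 0 0) hsr.
have dpsi (s v : 'I_k) : den (Nz (psi (Var (s : nat)) (Cst 0) (Var (v : nat)))) t = (psi0 s 0 v != 0).
  by rewrite den_Nz -hp.
apply: den_And.
  rewrite den_Le; congr nat_of_bool; congr (_ <= _); last exact: parK.
  have le_sum : \sum_(v < k) fx v <= k.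
    rewrite -[leqRHS]card_ord -sum1_card; apply: leq_sum => v _.
    by case: (fx v).
  apply: den_Mul => //; last by apply: leq_ltn_trans k5_lt; apply: leq_mul.
  rewrite (den_Sum (m := k) (g := fun v => fx v : nat)) // => [|v]; last exact: dfx.
  by rewrite modn_small //; apply: leq_ltn_trans le_sum _; apply: leq_ltn_trans k5_lt; apply: leq_pmull.
apply: den_And.
  apply: (den_All (g := fun v => [exists s : 'I_k, sr s && (psi0 s 0 v != 0)]) parK) => v.
  by apply: (den_Exi (g := fun s => sr s && (psi0 s 0 v != 0)) parK) => s; apply: den_And.
apply: den_And.
  apply: (den_All (g := fun s => [forall u : 'I_k, [&& sr s, sr u & psi0 s 0 u != 0] ==> (s == u :> nat)]) parK) => s.
  apply: (den_All (g := fun u => [&& sr s, sr u & psi0 s 0 u != 0] ==> (s == u :> nat)) parK) => u.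
  by apply: den_Imp; [apply: den_And => //; apply: den_And | apply: den_Eq].
apply: den_And.
  apply: (den_All (g := fun v => (dt v < k) ==> [&& ~~ fx v, fx (dt v) & bedge0 (dt v) v]) parK) => v.
  have lt_dt : den (Arr1 aDT (Var (v : nat)) < Par pK)%exp t = (dt v < k).
    by apply: den_Lt; rewrite ?ddt.
  (* Without a determining vertex the conclusion would read cells that belong to no vertex, so the
     false premise has to decide alone. *)
  case: (ltnP (dt v) k) => [ltd|led]; last first.
    by rewrite den_Le lt_dt ltnNge led.
  apply: (den_Imp (p := true)); first by rewrite lt_dt ltd.
  apply: den_And; first by apply: den_Notb; apply: dfx.
  apply: den_And; first by apply: dfx; rewrite ?ddt.
  exact: den_bedge.
apply: den_And.
  apply: (den_All (g := fun v => (pr v < k) ==> (rk v < rk (pr v))) parK) => v.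
  have lt_pr : den (Arr1 aPR (Var (v : nat)) < Par pK)%exp t = (pr v < k).
    by apply: den_Lt; rewrite ?dpr.
  case: (ltnP (pr v) k) => [ltd|led]; last first.
    by rewrite den_Le lt_pr ltnNge led.
  apply: (den_Imp (p := true)); first by rewrite lt_pr ltd.
  apply: den_Lt; first exact: drk.
  by rewrite -[LHS]/(t aRK (den (Arr1 aPR (Var (v : nat))) t) 0 0) dpr hrk.
apply: (den_All (g := fun s => [forall v : 'I_k, bedge0 s v ==>
         ((known0 s || known0 v) || ((pr s == v) || (pr v == s)))]) parK) => s.
apply: (den_All (g := fun v => bedge0 s v ==>
         ((known0 s || known0 v) || ((pr s == v) || (pr v == s)))) parK) => v.
apply: den_Imp; first exact: den_bedge.
apply: den_Or; first by apply: den_Or; apply: den_known.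
by apply: den_Or; apply: den_Eq.
Qed.

Hypotheses (parN : par pN = n) (parN1 : par pN1 = n.+1) (n_lt : n.+2 < W).
Hypothesis values_lt : maxn 1 n ^ k < W.

Local Notation value0 := (value n fx).
Local Notation dvalue0 a := (dvalue k psi0 dt (value0 a)).

Lemma place_radix_le i : i <= k -> place (radix n fx) i < W.
Proof.
move=> lei; apply: leq_ltn_trans values_lt; apply: leq_trans (_ : maxn 1 n ^ i <= _); last first.
  by apply: leq_pexp2l => //; rewrite leq_max.
rewrite /place -[X in _ ^ X](card_ord i) -prod_nat_const; apply: leq_prod => j _.
by rewrite /radix; case: (fx j); rewrite ?leq_maxr ?leq_maxl.
Qed.

Lemma den_radix (t : arrays) (ev : exp nat) v : strat_arrays t c -> den ev t = v -> v < k ->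
  den (radix_ex ev) t = radix n fx v.
Proof.
move=> [hfx _ _ _ _] hv ltv; rewrite (den_Ite _ _ (p := fx v)) /radix.
  by case: (fx v).
by rewrite -[LHS]/(t aFX (den ev t) 0 0) hv hfx.
Qed.

Lemma load_valuesP (ax : exp nat) a s : (forall t, den ax t = a) -> a.+1 < W ->
  strat_arrays s c -> s aPSI = psi0 ->
  forall v, v < k -> run (load_values ax) s aDV v 0 0 = dvalue0 a v.
Proof.
move=> ha lt_a sa hp v ltv; rewrite /load_values; set c1 := Loop _ _; set c2 := Loop _ _.
rewrite -[run (c1;; c2) s]/(run c2 (run c1 s)); set s1 := run c1 s.
have V1 w : w < k -> s1 aVAL w 0 0 = value0 a w.
  apply: (run_fill1 (E := value0 a) parK) => {}w t ltw ht.
  have sat : strat_arrays t c by apply: strat_arrays_eq sa; rewrite ht.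
  have [hfx _ _ _ _] := sat.
  rewrite (den_Ite _ _ (p := fx w)); last by rewrite -hfx.
  rewrite /value; case fw: (fx w) => //.
  have le_da : digit (radix n fx) w a <= a.
    by apply: leq_trans (leq_mod _ _) (leq_div _ _).
  rewrite (den_Add (x := digit (radix n fx) w a) (y := 1)) ?addn1 //; last first.
    by apply: leq_ltn_trans lt_a; rewrite ltnS.
  apply: (den_Digit W_ge (m := k) (bx := radix n fx)) => //.
  - exact: ltnW.
  - exact: den_radix.
  - by move=> j; apply: den_radix.
  - by apply: place_radix_le; apply: ltnW.
apply: (run_fill1 (E := dvalue0 a) parK) ltv => w t ltw ht.
have s1E b : b != aVAL -> s1 b = s b.
  by move=> nb; rewrite /s1 run_avoids //; repeat (split || intro).
have [_ hdt _ _ _] : strat_arrays t c by apply: strat_arrays_eq sa; rewrite ht // s1E.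
have dE : den (Arr1 aDT (Var w)) t = dt w by rewrite -hdt.
rewrite (den_Ite _ _ (p := dt w < k)); last by apply: den_Lt.
rewrite /dvalue; case: ifP => [ltd|_]; last by rewrite -V1 // -ht.
set x := psi _ _ _; have -> : den (x - Cst 1)%exp t = (den x t).-1 by rewrite -subn1.
have vE : den (Arr1 aVAL (Arr1 aDT (Var w))) t = value0 a (dt w).
  by rewrite -[LHS]/(t aVAL (den (Arr1 aDT (Var w)) t) 0 0) dE ht // V1.
have tp : t aPSI = psi0 by rewrite ht // s1E.
have -> : den x t = t aPSI (den (Arr1 aDT (Var w)) t) (den (Arr1 aVAL (Arr1 aDT (Var w))) t) w by [].
by rewrite dE vE tp.
Qed.

Variables (L F : nat -> nat -> nat) (good0 : nat -> nat -> nat).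
Hypothesis good0E : forall s x, s < k -> x <= n -> good0 s x = good k L F psi0 s x.

Lemma den_edge_ok (t : arrays) (ev ex ep ey : exp nat) v x p y :
  strat_arrays t c -> t aPSI = psi0 ->
  den ev t = v -> den ex t = x -> den ep t = p -> den ey t = y ->
  v < k -> p < k -> x <= n -> y <= n ->
  den (edge_ok_ex ev ex ep ey) t = edge_ok psi0 sr v x p y.
Proof.
move=> sa hp hv hx hpp hy ltv ltp lex ley.
have add1 (e : exp nat) z : den e t = z -> z <= n -> den (e + Cst 1)%exp t = z.+1.
  by move=> he lez; rewrite (den_Add (x := z) (y := 1)) ?addn1 //; apply: leq_ltn_trans n_lt; lia.
apply: den_And; apply: den_Imp.
- exact: den_bedge.
- apply: den_Eq; last exact: add1.
  by rewrite -[LHS]/(t aPSI (den ev t) (den ex t) (den ep t)) hv hx hpp hp.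
- exact: den_bedge.
- apply: den_Eq; last exact: add1.
  by rewrite -[LHS]/(t aPSI (den ep t) (den ey t) (den ev t)) hpp hy hv hp.
Qed.

Lemma den_init_weight (t : arrays) vl v y :
  strat_arrays t c -> t aPSI = psi0 -> (forall s x, t aGOOD s x 0 = good0 s x) ->
  (forall u, u < k -> t aDV u 0 0 = dvalue k psi0 dt vl u) -> v < k -> y <= n ->
  den (init_weight (Var v) (Var y)) t = vertex_ok k L F psi0 fx sr dt vl v y.
Proof.
move=> sa hp hg hd ltv ley; have [hfx hdt hpr hrk hsr] := sa.
have dd (e : exp nat) u : den e t = u -> u < k ->
    den (Arr1 aDV e) t = dvalue k psi0 dt vl u.
  by move=> he ltu; rewrite -[LHS]/(t aDV (den e t) 0 0) he hd.
apply: den_And; first by rewrite den_Nz.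
apply: den_And.
  by apply: den_Imp; [apply: den_known | apply: den_Eq => //; apply: dd].
apply: den_And.
  apply: den_Imp; first by rewrite -[LHS]/(t aSR v 0 0) hsr.
  by rewrite -[LHS]/(t aGOOD v y 0) hg good0E.
apply: (den_All (g := fun u =>
     ((known0 u && bedge0 u v) ==> (psi0 u (dvalue k psi0 dt vl u) v == y.+1)) &&
     ((known0 u && bedge0 v u) ==> ((psi0 v y u).-1 == dvalue k psi0 dt vl u))) parK) => u.
apply: den_And; apply: den_Imp.
- by apply: den_And; [apply: den_known | apply: den_bedge].
- apply: den_Eq; last first.
    by rewrite (den_Add (x := y) (y := 1)) ?addn1 //; apply: leq_ltn_trans n_lt; lia.
  by rewrite -[LHS]/(t aPSI u (den (Arr1 aDV (Var (u : nat))) t) v) (dd _ u) // hp.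
- by apply: den_And; [apply: den_known | apply: den_bedge].
- apply: den_Eq; last exact: dd.
  by rewrite -[LHS]/(t aPSI v y u - 1) hp subn1.
Qed.

Let R : comNzRingType := 'Z_W.

(** In ['Z_W] the reductions made by the program disappear, and its results can be compared with
    signed sums. *)
Lemma natr_mod m : (m %% W)%:R%R = m%:R%R :> R.
Proof. by rewrite Zp_nat_mod // (leq_trans _ W_ge). Qed.

Definition wt (t : arrays) (v : 'I_k) (y : 'I_n.+1) : R := (t aWT v y 0)%:R%R.

Local Notation fsum := (forest_sum (ord0 : 'I_n.+1) (edge_weight R psi0 sr) (@par_of k pr)).

Lemma par_ofP (v p : 'I_k) : par_of pr v = Some p <-> pr v = p.
Proof.
rewrite /par_of; split=> [|->]; last by rewrite valK.
by case: insubP => // u _ E [<-].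
Qed.

(** In round r the vertices are visited in their natural order and those of rank r are eliminated;
    these are the vertices eliminated before j is visited. *)
Definition done_set r j : {set 'I_k} :=
  [set u : 'I_k | (rk u < r) || (rk u == r) && (u < j)].

(** The total times the remaining forest sum is invariant. The children of v have smaller ranks, so
    they are gone when v is eliminated. *)
Lemma eliminateP (t : arrays) r (v : 'I_k) :
  valid k psi0 fx sr dt pr rk -> strat_arrays t c -> t aPSI = psi0 ->
  let q := ((Loop pN1 (fun y => Sto2 aWT (Arr1 aPR (Var (v : nat))) y
      (Ite (Arr1 aRK (Var (v : nat)) == Var r)
        (Arr2 aWT (Arr1 aPR (Var (v : nat))) y *
          Sum pN1 (fun x => Arr2 aWT (Var (v : nat)) x *
             edge_ok_ex (Var (v : nat)) x (Arr1 aPR (Var (v : nat))) y))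
        (Arr2 aWT (Arr1 aPR (Var (v : nat))) y)));;
    Sto0 aTOT (Ite ((Arr1 aRK (Var (v : nat)) == Var r) && (Arr1 aPR (Var (v : nat)) == Par pK))
      (Arr0 aTOT * Sum pN1 (fun x => Arr2 aWT (Var (v : nat)) x)) (Arr0 aTOT)))%exp) in
  ((run q t aTOT 0 0 0)%N%:R * fsum (done_set r v.+1) (wt (run q t)) =
   (t aTOT 0 0 0)%N%:R * fsum (done_set r v) (wt t) :> R)%R.
Proof.
move=> V sa hp; have [hfx hdt hpr hrk hsr] := sa.
cbv zeta; set c1 := Loop _ _; set c2 := Sto0 _ _.
rewrite -[run (c1;; c2) t]/(run c2 (run c1 t)); set t1 := run c1 t.
have prE t' : t' aPR = t aPR -> den (Arr1 aPR (Var (v : nat))) t' = pr v.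
  by move=> h; rewrite -hpr // -h.
have rkE t' : t' aRK = t aRK -> den (Arr1 aRK (Var (v : nat)) == Var r)%exp t' = (rk v == r).
  by move=> h; apply: den_Eq => //; rewrite -hrk // -h.
have t1E b : b != aWT -> t1 b = t b.
  by move=> nb; rewrite /t1 run_avoids //; repeat (split || intro).
pose msg (y : nat) := (\sum_(x < n.+1) (t aWT v x 0 * edge_ok psi0 sr v x (pr v) y) %% W) %% W.
have rk_pr : pr v < k -> rk v < rk (pr v).
  by case/and5P: V => _ _ _ _ /andP[/forallP/(_ v)/implyP].
have [T1 T2] : (forall y, y < n.+1 -> pr v < k -> t1 aWT (pr v) y 0 =
    if rk v == r then (t aWT (pr v) y 0 * msg y) %% W else t aWT (pr v) y 0) /\
    (forall u y, u != pr v -> t1 aWT u y 0 = t aWT u y 0).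
  suff [h1 h2 _ _] : [/\ forall y, y < n.+1 -> pr v < k -> t1 aWT (pr v) y 0 =
    if rk v == r then (t aWT (pr v) y 0 * msg y) %% W else t aWT (pr v) y 0,
    forall u y, u != pr v -> t1 aWT u y 0 = t aWT u y 0,
    forall y, n.+1 <= y -> t1 aWT (pr v) y 0 = t aWT (pr v) y 0
    & forall b, b != aWT -> t1 b = t b] by [].
  apply: (run_Loop (P := fun j t' => [/\ forall y, y < j -> pr v < k -> t' aWT (pr v) y 0 =
    if rk v == r then (t aWT (pr v) y 0 * msg y) %% W else t aWT (pr v) y 0,
    forall u y, u != pr v -> t' aWT u y 0 = t aWT u y 0,
    forall y, j <= y -> t' aWT (pr v) y 0 = t aWT (pr v) y 0
    & forall b, b != aWT -> t' b = t b]) parN1) => // y t' lty [k1 k2 k3 k4].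
  have sa' : strat_arrays t' c by apply: strat_arrays_eq sa; rewrite k4.
  set e := Ite _ _ _.
  have eE : pr v < k -> den e t' =
      if rk v == r then (t aWT (pr v) y 0 * msg y) %% W else t aWT (pr v) y 0.
    move=> ltp; rewrite /e (den_Ite _ _ (rkE t' _)) ?k4 //.
    have wE : den (Arr2 aWT (Arr1 aPR (Var (v : nat))) (Var y)) t' = t aWT (pr v) y 0.
      by rewrite -[LHS]/(t' aWT (den (Arr1 aPR (Var (v : nat))) t') y 0) prE ?(k4 aPR) // k3.
    case: eqP => [rv|_]; last exact: wE.
    set e1 := Arr2 _ _ _; set e2 := Sum _ _.
    rewrite -[LHS]/((den e1 t' * den e2 t') %% W) wE; congr ((_ * _) %% W).
    rewrite /e2 (den_Sum (m := n.+1) (g := fun x =>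
      (t aWT v x 0 * edge_ok psi0 sr v x (pr v) y) %% W)) // => x.
    set e3 := Arr2 _ _ _; set e4 := edge_ok_ex _ _ _ _.
    rewrite -[LHS]/((den e3 t' * den e4 t') %% W); congr ((_ * _) %% W).
      by apply: k2; apply/eqP => E; have := rk_pr ltp; rewrite -E ltnn.
    by apply: den_edge_ok; rewrite ?k4 ?prE ?k4 // -ltnS.
  rewrite -[run _ t']/(upda t' aWT (den (Arr1 aPR (Var (v : nat))) t') y 0 (den e t')) prE ?(k4 aPR) //.
  set z0 := den e t' in eE *.
  split.
  - move=> z; rewrite ltnS leq_eqVlt /upda /upd3 !eqxx /= andbT => /orP[/eqP->|ltz] ltp; last first.
      by rewrite ltn_eqF // k1.
    by rewrite eqxx eE.
  - by move=> u z up; rewrite /upda /upd3 eqxx (negPf up) /= k2.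
  - by move=> z ltz; rewrite /upda /upd3 !eqxx /= gtn_eqF //= k3 // ltnW.
  - by move=> b nb; rewrite /upda (negPf nb) k4.
set t2 := run c2 t1.
have W2 : t2 aWT = t1 aWT by rewrite /t2 run_avoids.
pose tot := \sum_(x < n.+1) t aWT v x 0.
have TOT2 : t2 aTOT 0 0 0 =
    if (rk v == r) && (pr v == k) then (t aTOT 0 0 0 * (tot %% W)) %% W else t aTOT 0 0 0.
  set e := Ite _ _ _ in c2 @t2 W2 *.
  rewrite -[LHS]/(den e t1) /e (den_Ite _ _ (p := (rk v == r) && (pr v == k))); last first.
    by apply: den_And; [apply: rkE; rewrite t1E | apply: den_Eq => //; apply: prE; rewrite t1E].
  case: ifP => [/andP[_ /eqP prk]|_]; last by rewrite -t1E.
  set e1 := Arr0 _; set e2 := Sum _ _.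
  rewrite -[LHS]/((den e1 t1 * den e2 t1) %% W); congr ((_ * _) %% W).
    by rewrite -t1E.
  rewrite /e2; apply: (den_Sum (g := fun x => t aWT v x 0) parN1) => x.
  by apply: T2; rewrite prk ltn_eqF.
case: (eqVneq (rk v) r) => [rv|nrv]; last first.
  rewrite TOT2 (negPf nrv) /=; congr (_ * _)%R.
  have -> : done_set r v.+1 = done_set r v.
    apply/setP => u; rewrite !inE ltnS (leq_eqVlt u).
    by case: (eqVneq (u : nat) v) => [/ord_inj->|//]; rewrite (negPf nrv).
  rewrite !/(forest_sum _ _ _ _ _); apply: eq_bigr => phi _; apply: eq_bigr => u _.
  rewrite /wt W2; case: (eqVneq (u : nat) (pr v)) => [E|ne]; last by rewrite T2.
  by rewrite E T1 ?(negPf nrv) // -E.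
have vQ : v \notin done_set r v by rewrite inE rv ltnn eqxx ltnn.
have -> : done_set r v.+1 = v |: done_set r v.
  apply/setP => u; rewrite !inE ltnS (leq_eqVlt u) -val_eqE /=.
  by case: (eqVneq (u : nat) v) => [/ord_inj->|//]; rewrite rv eqxx /= orbT.
have pre u : par_of pr u = Some v -> u \in done_set r v.
  move=> /par_ofP E; rewrite inE -rv.
  by case/and5P: V => _ _ _ _ /andP[/forallP/(_ u)]; rewrite E ltn_ord /= => ->.
case E: (par_of pr v) => [p|].
  have pE : pr v = p by apply/par_ofP.
  have ltr : rk v < rk p by rewrite -pE; apply: rk_pr; rewrite pE.
  rewrite (forest_sum_step _ (w' := wt t2) (c := 1%R) vQ pre).
    by rewrite mul1r TOT2 pE (ltn_eqF (ltn_ord p)) andbF.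
  rewrite E; split=> //.
  - by rewrite inE -rv ltnNge (ltnW ltr) gtn_eqF.
  - by apply/eqP => Ev; rewrite Ev ltnn in ltr.
  - move=> y; rewrite /wt W2 -pE T1 ?pE // rv eqxx natr_mod natrM; congr (_ * _)%R.
    rewrite /msg natr_mod natr_sum; apply: eq_bigr => x _.
    by rewrite natr_mod natrM /edge_weight pE.
  - by move=> u y up _; rewrite /wt W2 T2 // pE.
have pE : pr v = k.
  move: E; rewrite /par_of; case: insubP => // /negP lt _; apply/eqP.
  by rewrite eqn_leq strat_digit_le leqNgt; apply/negP.
rewrite (forest_sum_step _ (w' := wt t2) (c := (\sum_x wt t v x)%R) vQ pre); last first.
  rewrite E; split=> // u y _; rewrite /wt W2 T2 // pE.
  by rewrite ltn_eqF.
rewrite mulrA TOT2 rv pE !eqxx natr_mod natrM natr_mod /tot natr_sum.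
by [].
Qed.

(** Ranks are digits and hence at most k, so after k + 1 rounds every vertex is eliminated and the
    remaining forest sum is 1. *)
Lemma tree_sumP (s : arrays) vl : valid k psi0 fx sr dt pr rk ->
  strat_arrays s c -> s aPSI = psi0 -> (forall u x, s aGOOD u x 0 = good0 u x) ->
  (forall u, u < k -> s aDV u 0 0 = dvalue k psi0 dt vl u) ->
  ((run (tree_sum nat) s aTOT 0 0 0)%N%:R = fsum set0 (vertex_weight R L F psi0 fx sr dt vl) :> R)%R.
Proof.
move=> V sa hp hg hd; rewrite /tree_sum; set c1 := Loop _ _; set c2 := Sto0 _ _; set c3 := Loop _ _.
rewrite -[run (c1;; _) s]/(run c3 (run c2 (run c1 s))).
set s1 := run c1 s; set s2 := run c2 s1.
have s1E b : b != aWT -> s1 b = s b.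
  by move=> nb; rewrite /s1 run_avoids //; repeat (split || intro).
have W1 v y : v < k -> y < n.+1 -> s1 aWT v y 0 = vertex_ok k L F psi0 fx sr dt vl v y.
  apply: (run_fill2 (E := vertex_ok k L F psi0 fx sr dt vl) parK parN1) => {}v {}y t ltv lty ht.
  apply: den_init_weight => //.
  - by apply: strat_arrays_eq sa; rewrite ht.
  - by rewrite ht.
  - by move=> u x; rewrite ht.
  - by move=> u ltu; rewrite ht // hd.
pose G := fsum set0 (vertex_weight R L F psi0 fx sr dt vl).
pose inv r j (t : arrays) := [/\ strat_arrays t c, t aPSI = psi0 &
  ((t aTOT 0 0 0)%N%:R * fsum (done_set r j) (wt t) = G :> R)%R].
suff [_ _ E] : inv k.+1 0 (run c3 s2).
  have QT : done_set k.+1 0 = setT.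
    by apply/setP => u; rewrite !inE ltnS strat_digit_le.
  by rewrite -/G -E QT forest_sum_full mulr1.
apply: (run_Loop (P := fun r t => inv r 0 t) parK1).
  split.
  - by apply: strat_arrays_eq sa; rewrite /s2 run_avoids // s1E.
  - by rewrite /s2 run_avoids // s1E.
  have -> : s2 aTOT 0 0 0 = 1 by [].
  rewrite mul1r (_ : done_set 0 0 = set0); last by apply/setP => u; rewrite !inE ltn0 andbF.
  rewrite /G !/(forest_sum _ _ _ _ _); apply: eq_bigr => phi _; apply: eq_bigr => u _.
  congr (_ * _)%R; rewrite /wt /vertex_weight (_ : s2 aWT = s1 aWT); last by rewrite /s2 run_avoids.
  by rewrite W1.
move=> r t ltr inv0; set d := Loop _ _.
suff [h1 h2 h3] : inv r k (run d t).
  split=> //; rewrite -h3; congr (_ * fsum _ _)%R.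
  by apply/setP => u; rewrite !inE ltn0 andbF orbF ltn_ord andbT ltnS leq_eqVlt orbC.
apply: (run_Loop (P := fun j t => inv r j t) parK) => // v t' ltv [h1 h2 h3].
split.
- by apply: strat_arrays_eq h1; rewrite run_avoids //; avoid.
- by rewrite run_avoids //; avoid.
- by rewrite -h3; apply: (eliminateP r (Ordinal ltv)).
Qed.

End StrategyProgram.

(** * Running through all strategies *)

Section TryStrategies.

Variables (W : nat) (par inp : nat -> nat).
Hypothesis W_ge : narr <= W.

Local Notation den := (den W par inp).
Local Notation run := (run W par inp).

Variables (k n : nat).
Hypotheses (parK : par pK = k) (par5 : par p5K = 5 * k) (parK1 : par pK1 = k.+1).
Hypotheses (code_lt : k.+1 ^ (5 * k) < W) (k5_lt : 5 * k < W).
Hypotheses (parN : par pN = n) (parN1 : par pN1 = n.+1) (n_lt : n.+2 < W).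
Hypotheses (values_lt : maxn 1 n ^ k < W) (parP : par pP = maxn 1 n ^ (k %/ 4)).
Hypothesis P_lt : (maxn 1 n ^ (k %/ 4)).+1 < W.
Hypothesis parCS : par pCS = k.+1 ^ (5 * k).

Variables (L F : nat -> nat -> nat) (psi0 : nat -> nat -> nat -> nat) (good0 : nat -> nat -> nat).
Hypothesis good0E : forall s x, s < k -> x <= n -> good0 s x = good k L F psi0 s x.
Hypothesis psi_reach : forall (s v : 'I_k) x, x <= n ->
  (psi0 s x v != 0) = connect (arc_rel L) s v.
Hypothesis psi_root : forall (s : 'I_k) x, x <= n -> psi0 s x s = x.+1.
Hypothesis psi_val : forall (phi : 'I_k -> nat) (s v : 'I_k), phi s <= n ->
  solution L F phi -> connect (arc_rel L) s v -> psi0 s (phi s) v = (phi v).+1.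

Let R : comNzRingType := 'Z_W.

Definition valid_code c :=
  valid k psi0 (code_fx k c) (code_sr k c) (code_dt k c) (code_pr k c) (code_rk k c).

Definition solutions : nat := \sum_(phi : {ffun 'I_k -> 'I_n}) sat F L phi.

(** The loop bound [pP] is common to all strategies; codes that are not below the actual number Q of
    assignments contribute 0. *)
Lemma try_strategyP (s : arrays) (cx : exp nat) c : (forall t, den cx t = c) ->
  s aPSI = psi0 -> (forall u x, s aGOOD u x 0 = good0 u x) ->
  if valid_code c then ((run (try_strategy cx) s aRES 0 0 0)%N%:R = solutions%:R :> R)%R
  else run (try_strategy cx) s aRES 0 0 0 = s aRES 0 0 0.
Proof.
move=> hc hp hg; rewrite /try_strategy.
set c1 := load_strategy cx; set c2 := Sto0 aOK _; set c3 := Sto0 aCNT _; set c4 := Loop pP _.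
set c5 := Sto0 aRES _.
rewrite -[run (c1;; _) s]/(run c5 (run c4 (run c3 (run c2 (run c1 s))))).
set s1 := run c1 s; have sa1 : strat_arrays k s1 c by apply: load_strategyP.
have hp1 : s1 aPSI = psi0 by rewrite /s1 run_avoids //; avoid.
set s2 := run c2 s1.
have OK2 : s2 aOK 0 0 0 = valid_code c.
  by rewrite -[LHS]/(den (valid_strategy nat) s1); apply: den_valid.
set s3 := run c3 s2; set s4 := run c4 s3.
have OK4 : s4 aOK = s2 aOK.
  by rewrite /s4 run_avoids; [rewrite /s3 run_avoids | avoid].
have RES5 : run c5 s4 aRES 0 0 0 = if valid_code c then s4 aCNT 0 0 0 else s4 aRES 0 0 0.
  rewrite -[LHS]/(den (Ite (Arr0 aOK) (Arr0 aCNT) (Arr0 aRES)) s4).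
  by rewrite (den_Ite _ _ (p := valid_code c)) // -OK2 -OK4.
rewrite RES5; case V: (valid_code c); last first.
  rewrite /s4 run_avoids; last by avoid.
  rewrite /s3 run_avoids; last by avoid.
  rewrite /s2 run_avoids; last by avoid.
  by rewrite /s1 run_avoids; last by avoid.
have V' := V; rewrite /valid_code in V'.
pose fx := code_fx k c.
pose f a : R := forest_sum (ord0 : 'I_n.+1) (edge_weight R psi0 (code_sr k c)) (@par_of k (code_pr k c))
   set0 (vertex_weight R L F psi0 fx (code_sr k c) (code_dt k c) (value n fx a)).
pose Q := place (radix n fx) k.
have Q_lt : Q < W by apply: place_radix_le.
have PQ : Q <= maxn 1 n ^ (k %/ 4) by apply: place_radix V'.
have [_ _ _ E] : [/\ strat_arrays k s4 c, s4 aPSI = psi0, forall u x, s4 aGOOD u x 0 = good0 u x &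
    ((s4 aCNT 0 0 0)%N%:R = \sum_(a < maxn 1 n ^ (k %/ 4)) if (a < Q)%N then f a else 0 :> R)%R].
  apply: (run_Loop (P := fun j t => [/\ strat_arrays k t c, t aPSI = psi0,
    forall u x, t aGOOD u x 0 = good0 u x &
    ((t aCNT 0 0 0)%N%:R = \sum_(a < j) if (a < Q)%N then f a else 0 :> R)%R]) parP).
    split.
    - by apply: strat_arrays_eq sa1.
    - by rewrite -hp1.
    - by move=> u x; rewrite -hg /s3 /s2 /s1 !run_avoids //; avoid.
    - by rewrite big_ord0.
  move=> a t lta [k1 k2 k3 k4].
  set d1 := load_values _; set d2 := tree_sum _; set d3 := Sto0 _ _.
  rewrite -[run _ t]/(run d3 (run d2 (run d1 t))).
  set t1 := run d1 t; set t2 := run d2 t1; set t3 := run d3 t2.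
  have lt_a : a.+1 < W by apply: leq_ltn_trans P_lt; apply: ltnW.
  have ax t' : den (Var a) t' = a by [].
  have DV := load_valuesP W_ge parK parN values_lt ax lt_a k1 k2.
  have t1E b : [&& b != aVAL & b != aDV] -> t1 b = t b.
    by case/andP=> b1 b2; rewrite /t1 run_avoids //; repeat (split || intro).
  have sa1' : strat_arrays k t1 c by apply: strat_arrays_eq k1; rewrite t1E.
  have t2E b : [&& b != aVAL, b != aDV, b != aWT & b != aTOT] -> t2 b = t b.
    case/and4P=> b1 b2 b3 b4; rewrite -t1E ?b1 // /t2 run_avoids //.
    by repeat (split || intro).
  have sa2 : strat_arrays k t2 c by apply: strat_arrays_eq k1; rewrite t2E.
  have TS : ((t2 aTOT 0 0 0)%N%:R = f a :> R)%R.
    apply: (tree_sumP inp W_ge parK par5 parK1 code_lt k5_lt parN parN1 n_lt values_lt good0E V' sa1').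
    - by rewrite t1E.
    - by move=> u x; rewrite t1E.
    - exact: DV.
  have t3E b : [&& b != aVAL, b != aDV, b != aWT, b != aTOT & b != aCNT] -> t3 b = t b.
    case/and5P=> b1 b2 b3 b4 b5; rewrite -t2E ?b1 ?b2 ?b3 // /t3 run_avoids //.
  split.
  - by apply: strat_arrays_eq k1; rewrite t3E.
  - by rewrite t3E.
  - by move=> u x; rewrite t3E.
  pose e1 : exp nat := Arr0 aCNT.
  pose e2 : exp nat := Ite (Bin Lt (Var a) (Prod pK (@radix_ex nat))) (Arr0 aTOT) (Cst 0).
  have e2E : den e2 t2 = if a < Q then t2 aTOT 0 0 0 else 0.
    rewrite /e2 (den_Ite _ _ (p := a < Q)) //.
    apply: den_Lt => //.
    rewrite (den_Prod W_ge (g := radix n fx) parK) => [|j]; last exact: den_radix.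
    by rewrite -/(place _ _) modn_small.
  rewrite -[t3 aCNT 0 0 0]/((den e1 t2 + den e2 t2) %% W) natr_mod // natrD e2E.
  have -> : den e1 t2 = t aCNT 0 0 0 by rewrite -t2E.
  by rewrite k4 [in RHS]big_ord_recr /=; case: ifP => // _; rewrite TS.
rewrite E -(sum_solution R psi_reach psi_root psi_val V').
rewrite (big_ord_widen_cond _ xpredT f PQ) /= [RHS]big_mkcond.
by apply: eq_bigr.
Qed.

(** Before the first valid code [aRES] may hold a leftover. A valid code exists, and invalid ones do
    not change the result. *)
Lemma try_all (s : arrays) : s aPSI = psi0 -> (forall u x, s aGOOD u x 0 = good0 u x) ->
  ((run (Loop pCS (fun c => try_strategy c)) s aRES 0 0 0)%N%:R = solutions%:R :> R)%R.
Proof.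
move=> hp hg; set c0 := Loop _ _.
have [t [t_le t_valid]] := valid_ex psi_reach.
have [c lt_c hc] : exists2 c, c < k.+1 ^ (5 * k) & valid_code c.
  have plE : place (fun=> k.+1) (5 * k) = k.+1 ^ (5 * k) by rewrite /place prod_nat_const card_ord.
  have ht i : i < 5 * k -> t i < (fun=> k.+1) i by rewrite ltnS.
  have := digit_unique ht; rewrite plE.
  have [/existsP[c /forallP dc] _|] := boolP [exists c : 'I_(k.+1 ^ (5 * k)),
     [forall i : 'I_(5 * k), digit (fun=> k.+1) i c == t i]]; last first.
    rewrite negb_exists => /forallP none; rewrite big1 // => c _.
    by rewrite (negPf (none c)).
  exists c => //; have dE i : i < 5 * k -> strat_digit k c i = t i.
    by move=> lti; apply/eqP; apply: (dc (Ordinal lti)).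
  have bnd j (v : 'I_k) : j <= 4 -> j * k + v < 5 * k.
    move=> lej; apply: leq_trans (_ : j.+1 * k <= _); last by rewrite leq_mul2r ltnS lej orbT.
    by rewrite mulSn addnC ltn_add2r.
  have b0 (v : 'I_k) : v < 5 * k by have := bnd 0 v isT; lia.
  have b1 (v : 'I_k) : k + v < 5 * k by have := bnd 1 v isT; lia.
  have b2 (v : 'I_k) : k + (k + v) < 5 * k by have := bnd 2 v isT; lia.
  have b3 (v : 'I_k) : k + (k + (k + v)) < 5 * k by have := bnd 3 v isT; lia.
  have b4 (v : 'I_k) : k + (k + (k + (k + v))) < 5 * k by have := bnd 4 v isT; lia.
  have e0 (v : 'I_k) : code_fx k c v = (t v == 1) by rewrite /code_fx dE.
  have e1 (v : 'I_k) : code_dt k c v = t (k + v) by rewrite /code_dt dE.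
  have e2 (v : 'I_k) : code_pr k c v = t (k + (k + v)) by rewrite /code_pr dE.
  have e3 (v : 'I_k) : code_rk k c v = t (k + (k + (k + v))) by rewrite /code_rk dE.
  have e4 (v : 'I_k) : code_sr k c v = (t (k + (k + (k + (k + v)))) == 1) by rewrite /code_sr dE.
  have eb (s' v : 'I_k) : bedge psi0 (code_sr k c) s' v =
     bedge psi0 (fun v => t (k + (k + (k + (k + v)))) == 1) s' v by rewrite /bedge !e4.
  have ek (v : 'I_k) : known k (code_fx k c) (code_dt k c) v =
     known k (fun v => t v == 1) (fun v => t (k + v)) v by rewrite /known e0 e1.
  rewrite /valid_code; apply: etrans t_valid; rewrite /valid.
  congr [&& _, _, _, _, _ & _].
  - by congr (4 * _ <= _); apply: eq_bigr => v _; rewrite e0.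
  - by apply: eq_forallb => v; apply: eq_existsb => s'; rewrite e4.
  - by apply: eq_forallb => s'; apply: eq_forallb => v; rewrite !e4.
  - apply: eq_forallb => v; rewrite e1 e0; case: (ltnP (t (k + v)) k) => //= lt.
    by rewrite -[t (k + v)]/(nat_of_ord (Ordinal lt)) e0 eb.
  - apply: eq_forallb => v; rewrite e2 e3; case: (ltnP (t (k + (k + v))) k) => //= lt.
    by rewrite -[t (k + (k + v))]/(nat_of_ord (Ordinal lt)) e3.
  - by apply: eq_forallb => s'; apply: eq_forallb => v; rewrite eb !ek !e2.
suff [_ _ h] : [/\ run c0 s aPSI = psi0, forall u x, run c0 s aGOOD u x 0 = good0 u x
   & (exists2 c, c < k.+1 ^ (5 * k) & valid_code c) ->
     ((run c0 s aRES 0 0 0)%N%:R = solutions%:R :> R)%R].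
  by apply: h; exists c.
apply: (run_Loop (P := fun j t => [/\ t aPSI = psi0, forall u x, t aGOOD u x 0 = good0 u x
   & (exists2 c, c < j & valid_code c) ->
     ((t aRES 0 0 0)%N%:R = solutions%:R :> R)%R]) parCS).
  by split=> // -[].
move=> {lt_c hc}{}c t' ltc [k1 k2 k3]; split.
- by rewrite run_avoids //; avoid.
- by move=> u x; rewrite run_avoids //; avoid.
have := @try_strategyP t' (Var c) c (fun=> erefl) k1 k2.
case: ifP => // nv -> [c' ltc' V]; apply: k3; exists c' => //.
by move: ltc'; rewrite ltnS leq_eqVlt => /orP[/eqP E|//]; rewrite E nv in V.
Qed.

End TryStrategies.

(** * Forced values for all roots *)

Section PropagateAll.

Variables (W : nat) (par inp : nat -> nat).
Hypothesis W_ge : narr <= W.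

Local Notation den := (den W par inp).
Local Notation run := (run W par inp).

Variables (k n : nat) (L F : nat -> nat -> nat) (s0 : arrays).
Hypotheses (parK : par pK = k) (parN1 : par pN1 = n.+1) (n_lt : n.+2 < W).
Hypothesis sL : forall u v, u < k -> v < k -> s0 aL u v 0 = L u v.
Hypothesis sF : forall l x, 0 < l -> s0 aOUT l x 0 = F l x.
Hypothesis F_le : forall l x, 0 < l -> F l x <= n.

(** The root is a plain number, as in the loop invariants, so reachability refers to it through an
    ordinal of the same value. *)
Definition propagated (t : arrays) (s x : nat) : Prop :=
  [/\ forall v : 'I_k, (t aPSI s x v != 0) = [exists s' : 'I_k, (s' == s :> nat) && connect (arc_rel L) s' v],
     t aPSI s x s = x.+1,
     forall phi (s' v : 'I_k), s' = s :> nat -> phi s' = x -> solution L F phi ->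
       connect (arc_rel L) s' v -> t aPSI s x v = (phi v).+1
   & t aGOOD s x 0 = good k L F (t aPSI) s x].

Lemma propagated_eq t t' s x : (forall v, t' aPSI s x v = t aPSI s x v) ->
  t' aGOOD s x 0 = t aGOOD s x 0 -> propagated t s x -> propagated t' s x.
Proof.
move=> E1 E2 [h1 h2 h3 h4]; split.
- by move=> v; rewrite E1.
- by rewrite E1.
- by move=> phi s' v es ps sol sv; rewrite E1; apply: (h3 _ s').
rewrite E2 h4; congr nat_of_bool; apply: eq_forallb => u; apply: eq_forallb => v.
by rewrite !E1.
Qed.

Lemma propagate_all : let t := run (Loop pK (fun s => Loop pN1 (fun x => propagate s x))) s0 in
  (forall a, a != aPSI -> a != aGOOD -> t a = s0 a) /\
  (forall s x, s < k -> x <= n -> propagated t s x).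
Proof.
set c0 := Loop _ _.
apply: (run_Loop (P := fun j t => (forall a, a != aPSI -> a != aGOOD -> t a = s0 a) /\
  (forall s x, s < j -> x <= n -> propagated t s x)) parK) => // s t lts [h1 h2].
set c := Loop _ _.
have [r1 r2 r3] : [/\ forall a, a != aPSI -> a != aGOOD -> run c t a = s0 a,
    forall x, x < n.+1 -> propagated (run c t) s x
  & forall s' x, s' != s -> x <= n -> propagated t s' x -> propagated (run c t) s' x].
  apply: (run_Loop (P := fun j t' => [/\ forall a, a != aPSI -> a != aGOOD -> t' a = s0 a,
    forall x, x < j -> propagated t' s x
  & forall s' x, s' != s -> x <= n -> propagated t s' x -> propagated t' s' x]) parN1) => // x t' ltx [k1 k2 k3].
  have tL u v : u < k -> v < k -> t' aL u v 0 = L u v by move=> ltu ltv; rewrite k1 // sL.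
  have tF l y : 0 < l -> t' aOUT l y 0 = F l y by move=> l0; rewrite k1 // sF.
  have [|[f1 f2] p1 p2 [p3 [p4 p5]]] := propagateP W_ge parK parN1 n_lt tL tF F_le
    (s := Ordinal lts) ltx (inp := inp) (ex_s := Var s) (ex_x := Var x) (t0 := t') (fun=> erefl) (fun=> erefl).
    by [].
  split.
  - by move=> a a1 a2; rewrite f1 // k1.
  - move=> y; rewrite ltnS leq_eqVlt => /orP[/eqP->|lty].
      split=> //.
      + move=> v; rewrite p1; apply/idP/existsP => [h|[s' /andP[/eqP es h]]].
          by exists (Ordinal lts); rewrite /= eqxx.
        by rewrite (_ : Ordinal lts = s') //; apply: val_inj.
      + move=> phi s' v es ps sol sv; have es' : s' = Ordinal lts by apply: val_inj.
        by apply: p3; rewrite -?es'.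
    have ne : (s != s :> nat) || (y != x) by rewrite (ltn_eqF lty) orbT.
    apply: propagated_eq (k2 y lty); first by move=> v; rewrite f2.
    by rewrite p5.
  - move=> s' y ne ley /(k3 s' y ne ley).
    apply: propagated_eq; first by move=> v; rewrite f2 // ne.
    by rewrite p5 // ne.
split=> // s' x; rewrite ltnS leq_eqVlt => /orP[/eqP->|lts'] lex; first exact: r2.
by apply: r3 => //; [rewrite ltn_eqF | apply: h2].
Qed.

End PropagateAll.

(** * Summation over all label matrices *)

Section CountMaps.

Variables (W : nat) (par inp : nat -> nat).
Hypothesis W_ge : narr <= W.

Local Notation den := (den W par inp).
Local Notation run := (run W par inp).

Variables (k n D : nat) (H : sgraph k) (G : sgraph n) (F : nat -> nat -> nat).
Hypotheses (parK : par pK = k) (parN : par pN = n) (parM : par pM = W.-1).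
Hypotheses (parN1 : par pN1 = n.+1) (parK1 : par pK1 = k.+1) (parKK : par pKK = k * k).
Hypotheses (par5 : par p5K = 5 * k) (parD : par pD1 = D.+1) (parA : par pA = 2 * D.+1).
Hypotheses (parCL : par pCL = (2 * D.+1) ^ (k * k)) (parCS : par pCS = k.+1 ^ (5 * k)).
Hypotheses (parP : par pP = maxn 1 n ^ (k %/ 4)) (parKPK : par pKPK = k ^ k).
Hypotheses (n_lt : n.+2 < W) (k5_lt : 5 * k < W) (codes_lt : (2 * D.+1) ^ (k * k) < W).
Hypotheses (code_lt : k.+1 ^ (5 * k) < W) (values_lt : maxn 1 n ^ k < W).
Hypotheses (P_lt : (maxn 1 n ^ (k %/ 4)).+1 < W) (kk_pow_lt : k ^ k < W) (pow_lt : n ^ k < W).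

Variable oarc : rel 'I_n.
Hypothesis adjE : forall x y, (adj G x y : nat) = oarc x y + oarc y x.
Hypothesis FE : forall x y : 'I_n,
  \sum_(1 <= l < D.+1) (F l x.+1 == y.+1) = oarc x y.
Hypothesis F_id : forall x : 'I_n, F D.+1 x.+1 = x.+1.
Hypothesis F_le : forall l x, 0 < l -> F l x <= n.

Let R : comNzRingType := 'Z_W.

Variable s0 : arrays.
Hypothesis sH : forall u v : 'I_k, s0 aHA u v 0 = adj H u v.
Hypothesis sF : forall l x, 0 < l -> s0 aOUT l x 0 = F l x.

Definition const_arrays (t : arrays) := t aHA = s0 aHA /\ t aOUT = s0 aOUT.

Lemma W1_opp : (W.-1%:R = -1 :> R)%R.
Proof.
have W0 : 0 < W by apply: leq_trans W_ge.
apply/eqP; rewrite -subr_eq0 opprK -(natrD _ W.-1 1) addn1 prednK //.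
by rewrite -natr_mod // modnn.
Qed.

Lemma den_weight mode c (t : arrays) : mode < 3 -> t aHA = s0 aHA ->
  (forall u v, u < k -> v < k -> t aE u v 0 = label_digit k D c u v) ->
  ((den (weight nat mode) t)%:R =
    \prod_(p : 'I_k * 'I_k) digit_weight R D H mode p.1 p.2 (label_digit k D c p.1 p.2) :> R)%R.
Proof.
move=> m3 tH tE.
pose g (u v : nat) : nat := den (Ite (Var u < Var v)
      (Ite (Arr2 aHA (Var u) (Var v)) (Nz (Arr2 aE (Var u) (Var v)) && Not (Arr2 aE (Var u) (Var v) == Par pD1))
        (Ite (Nz (Arr2 aE (Var u) (Var v)))
          (Ite (Arr2 aE (Var u) (Var v) == Par pD1) (if mode is 0%N then Cst 0 else Par pM)
             (if mode is 2 then Par pM else Cst 0)) (Cst 1)))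
      (Not (Arr2 aE (Var u) (Var v))))%exp t.
rewrite /weight (den_Prod W_ge (g := fun u => (\prod_(v < k) g u v) %% W) parK) => [|u]; last first.
  by apply: (den_Prod W_ge (g := g u) parK).
rewrite natr_mod // natr_prod.
under eq_bigr => u _ do rewrite natr_mod // natr_prod.
rewrite pair_big /=; apply: eq_bigr => -[u v] _ /=.
have eE : den (Arr2 aE (Var (u : nat)) (Var (v : nat))) t = label_digit k D c u v.
  by rewrite -[LHS]/(t aE u v 0) tE.
set x := label_digit k D c u v in eE *.
rewrite /g (den_Ite _ _ (p := u < v)) // /digit_weight; case: ifP => uv; last first.
  by rewrite den_Not eE.
rewrite (den_Ite _ _ (p := adj H u v)); last first.
  by rewrite -sH -tH.
case: ifP => _.
  rewrite (den_And (p := x != 0) (q := x != D.+1)) //; first by rewrite den_Nz eE.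
  by apply: den_Notb; apply: den_Eq.
rewrite (den_Ite _ _ (p := x != 0)); last by rewrite den_Nz eE.
case: ifP => _ //.
rewrite (den_Ite _ _ (p := x == D.+1)); last exact: den_Eq.
rewrite /eq_coef /adj_coef; case: ifP => _.
  by case: (mode) => //= m; rewrite parM W1_opp.
by case: mode m3 {g} => [|[|[|//]]] //= _; rewrite parM W1_opp.
Qed.

Definition label_count c : nat := solutions k n (arc_label D (label_digit k D c)) F.

Lemma count_stepP mode (t : arrays) c (cx : exp nat) : mode < 3 -> (forall t, den cx t = c) ->
  const_arrays t -> t aACC 0 0 0 < W ->
  let q := (load_labels cx;; Loop pK (fun s => Loop pN1 (fun x => propagate s x));;
    Loop pCS (fun c' => try_strategy c');;
    Sto0 aACC (Arr0 aACC + weight nat mode * Arr0 aRES)%exp) in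
  [/\ const_arrays (run q t), run q t aACC 0 0 0 < W &
   ((run q t aACC 0 0 0)%N%:R = (t aACC 0 0 0)%N%:R +
     (\prod_(p : 'I_k * 'I_k) digit_weight R D H mode p.1 p.2 (label_digit k D c p.1 p.2)) *
     (label_count c)%:R :> R)%R].
Proof.
move=> m3 hc [tH tO] ltA; cbv zeta.
set c1 := load_labels cx; set c2 := Loop pK _; set c3 := Loop pCS _; set c4 := Sto0 _ _.
rewrite -[run _ t]/(run c4 (run c3 (run c2 (run c1 t)))).
set t1 := run c1 t; set t2 := run c2 t1; set t3 := run c3 t2; set t4 := run c4 t3.
have [E1 L1'] := load_labelsP W_ge parK parKK parD parA codes_lt t hc.
rewrite -/c1 -/t1 in E1 L1'.
have t1O : t1 aOUT = s0 aOUT by rewrite /t1 run_avoids //; avoid.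
have sF1 l x : 0 < l -> t1 aOUT l x 0 = F l x by move=> l0; rewrite t1O sF.
set L := arc_label D (label_digit k D c) in L1'.
have [f2 p2] := propagate_all inp W_ge parK parN1 n_lt L1' sF1 F_le.
rewrite -/c2 -/t2 in f2 p2.
pose good0 u x := t2 aGOOD u x 0.
have g0 s x : s < k -> x <= n -> good0 s x = good k L F (t2 aPSI) s x.
  by move=> lts lex; have [] := p2 s x lts lex.
have reach (s v : 'I_k) x : x <= n -> (t2 aPSI s x v != 0) = connect (arc_rel L) s v.
  move=> lex; have [-> _ _ _] := p2 s x (ltn_ord s) lex.
  apply/existsP/idP => [[s' /andP[/eqP/val_inj-> //]]|h].
  by exists s; rewrite eqxx.
have root (s : 'I_k) x : x <= n -> t2 aPSI s x s = x.+1.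
  by move=> lex; have [] := p2 s x (ltn_ord s) lex.
have pval (phi : 'I_k -> nat) (s v : 'I_k) : phi s <= n ->
    solution L F phi -> connect (arc_rel L) s v -> t2 aPSI s (phi s) v = (phi v).+1.
  by move=> lex sol sv; have [_ _ h _] := p2 s (phi s) (ltn_ord s) lex; apply: (h phi s).
have RES3 : ((t3 aRES 0 0 0)%N%:R = (label_count c)%:R :> R)%R.
  by apply: (try_all inp W_ge parK par5 parK1 code_lt k5_lt parN parN1 n_lt values_lt parP P_lt
    parCS g0 reach root pval).
have ACC3 : t3 aACC = t aACC.
  rewrite /t3 run_avoids; last by avoid.
  by rewrite f2 // /t1 run_avoids //; avoid.
have HA3 : t3 aHA = s0 aHA.
  rewrite /t3 run_avoids; last by avoid.
  by rewrite f2 // /t1 run_avoids //; avoid.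
have OUT3 : t3 aOUT = s0 aOUT.
  rewrite /t3 run_avoids; last by avoid.
  by rewrite f2.
have E3 u v : u < k -> v < k -> t3 aE u v 0 = label_digit k D c u v.
  move=> ltu ltv; rewrite /t3 run_avoids; last by avoid.
  by rewrite f2 // E1.
pose e1 : exp nat := Arr0 aACC; pose e2 : exp nat := Bin Mul (weight nat mode) (Arr0 aRES).
have A4 : t4 aACC 0 0 0 = (den e1 t3 + den e2 t3) %% W by [].
split.
- by split; rewrite /t4 run_avoids.
- by rewrite A4 ltn_mod (leq_trans _ W_ge).
rewrite A4 natr_mod // natrD; congr (_ + _)%R.
  by rewrite -[den e1 t3]/(t3 aACC 0 0 0) ACC3.
rewrite -[den e2 t3]/((den (weight nat mode) t3 * t3 aRES 0 0 0) %% W) natr_mod // natrM.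
by rewrite (den_weight m3 HA3 E3) RES3.
Qed.

Lemma pair_idx_bij : bijective (fun p : 'I_k * 'I_k =>
  Ordinal (pair_index (ltn_ord p.1) (ltn_ord p.2))).
Proof.
apply: inj_card_bij; last by rewrite card_prod !card_ord.
case=> [u v] [u' v'] [E]; have k0 : 0 < k by apply: leq_ltn_trans (ltn_ord u).
have ev : v = v'.
  apply: val_inj; have := congr1 (modn^~ k) E.
  by rewrite !modnMDl !modn_small.
rewrite ev in E *; congr (_, _); apply: val_inj; apply/eqP.
by rewrite -(eqn_pmul2r k0) -(eqn_add2r v') E.
Qed.

(** The expansion gives the equation in ['Z_W]. Both sides are below W, since there are at most n^k
    maps, so it holds for natural numbers. *)
Lemma count_mapsP mode (s : arrays) : mode < 3 -> const_arrays s -> s aACC 0 0 0 = 0 ->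
  run (count_maps nat mode) s aACC 0 0 0 = count H G mode.
Proof.
move=> m3 cs sA; set c0 := count_maps nat mode.
pose w c : R := (\prod_(p : 'I_k * 'I_k)
  digit_weight R D H mode p.1 p.2 (label_digit k D c p.1 p.2) * (label_count c)%:R)%R.
have [_ lt_acc E] : [/\ const_arrays (run c0 s), run c0 s aACC 0 0 0 < W &
  ((run c0 s aACC 0 0 0)%N%:R = \sum_(c < (2 * D.+1) ^ (k * k)) w c :> R)%R].
  apply: (run_Loop (P := fun j t => [/\ const_arrays t, t aACC 0 0 0 < W &
    ((t aACC 0 0 0)%N%:R = \sum_(c < j) w c :> R)%R]) parCL).
    by rewrite sA big_ord0; split=> //; apply: leq_trans W_ge.
  move=> c t ltc [h1 h2 h3].
  have [k1 k2 k3] := @count_stepP mode t c (Var c) m3 (fun=> erefl) h1 h2.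
  split; [exact: k1 | exact: k2 |].
  by rewrite big_ord_recr -h3; exact: k3.
have count_lt : count H G mode < W.
  apply: leq_ltn_trans pow_lt; rewrite -[n in n ^ _]card_ord -[k in _ ^ k]card_ord -card_ffun.
  by case: mode m3 {c0 w lt_acc E} => [|[|[|//]]] _; apply: max_card.
suff : ((run c0 s aACC 0 0 0)%N%:R = (count H G mode)%:R :> R)%R.
  have W1 : 1 < W by apply: leq_trans W_ge.
  have vE m : nat_of_ord (m%:R : R)%R = m %% W := val_Zp_nat W1 m.
  by move=> E'; rewrite -(modn_small lt_acc) -(modn_small count_lt) -!vE E'.
rewrite E -(count_expansion R H adjE FE F_id m3).
pose f (e : 'I_k * 'I_k -> nat) : R := ((\prod_(p : 'I_k * 'I_k) digit_weight R D H mode p.1 p.2 (e p)) *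
  (\sum_(phi : {ffun 'I_k -> 'I_n}) [forall p : 'I_k * 'I_k, digit_ok D F phi p.1 p.2 (e p)]%:R))%R.
have fE e e' : e =1 e' -> f e = f e'.
  move=> ee; rewrite /f; congr (_ * _)%R; first by apply: eq_bigr => p _; rewrite ee.
  apply: eq_bigr => phi _; congr (_%:R)%R; congr nat_of_bool; apply: eq_forallb => p.
  by rewrite ee.
rewrite -(@sum_digits R _ (2 * D.+1) (k * k) _ pair_idx_bij f fE).
apply: eq_bigr => c _; rewrite /w /f; congr (_ * _)%R.
rewrite /label_count /solutions natr_sum; apply: eq_bigr => phi _.
by rewrite sat_arc_label.
Qed.

Lemma den_automorphisms (t : arrays) : t aHA = s0 aHA -> den (automorphisms nat) t = aut H.
Proof.
move=> tH.
pose f (e : 'I_k -> nat) : nat := [forall u : 'I_k, forall v : 'I_k,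
  ((u == v :> nat) == (e u == e v)) && (s0 aHA u v 0 == s0 aHA (e u) (e v) 0)].
have dig_lt c (i : 'I_k) : digit (fun=> k) i c < k.
  by rewrite /digit ltn_mod (leq_ltn_trans _ (ltn_ord i)).
have phiE c (u : 'I_k) : den (Digit pK (fun=> Par pK) (Var c) (Var (u : nat))) t = digit (fun=> k) u c.
  apply: (den_Digit W_ge (m := k) (bx := fun=> k)) => //; first exact: ltnW.
  apply: leq_ltn_trans kk_pow_lt; rewrite /place prod_nat_const card_ord.
  by apply: leq_pexp2l; [apply: leq_ltn_trans (ltn_ord u) | apply: ltnW].
rewrite /automorphisms (den_Sum (m := k ^ k) (g := fun c => f (fun i => digit (fun=> k) i c))) // => [|c].
  have idb : bijective (@id 'I_k) by exists id.
  rewrite (@sum_digits _ _ k k _ idb f) => [|e e' ee]; last first.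
    rewrite /f; congr nat_of_bool; apply: eq_forallb => u; apply: eq_forallb => v.
    by rewrite !ee.
  rewrite modn_small; last first.
    apply: leq_ltn_trans kk_pow_lt; apply: (@leq_trans (\sum_(E : {ffun 'I_k -> 'I_k}) 1)).
      by apply: leq_sum => E _; rewrite /f; case: [forall u, _].
    by rewrite sum1_card card_ffun !card_ord.
  rewrite /aut -sum1_card [RHS]big_mkcond; apply: eq_bigr => E _; rewrite inE.
  suff -> : f (fun i => E i) = (injectiveb E && [forall u, forall v, adj H u v == adj H (E u) (E v)]).
    by case: (_ && _).
  congr nat_of_bool; apply/forallP/andP => [h|[/injectiveP inj /forallP h] u].
    split.
      apply/injectiveP => u v Euv; have /forallP/(_ v)/andP[/eqP + _] := h u.
      by rewrite Euv eqxx => /eqP/val_inj.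
    apply/forallP => u; apply/forallP => v; have /forallP/(_ v)/andP[_] := h u.
    by rewrite !sH; do 2!case: (adj _ _ _).
  apply/forallP => v; have /forallP/(_ v)/eqP hv := h u.
  by rewrite !sH hv eqxx andbT; apply/eqP; apply/eqP/eqP => [/ord_inj-> //|/ord_inj/inj->].
pose g u v : bool := ((u == v) == (digit (fun=> k) u c == digit (fun=> k) v c)) &&
  (s0 aHA u v 0 == s0 aHA (digit (fun=> k) u c) (digit (fun=> k) v c) 0).
apply: (den_All (g := fun u => [forall v : 'I_k, g u v]) parK) => u.
apply: (den_All (g := g u) parK) => v.
apply: den_And.
  have h (a b : exp nat) x y : den a t = nat_of_bool x -> den b t = nat_of_bool y ->
      den (Bin Eq a b) t = (x == y).
    by move=> ha hb; rewrite (den_Eq ha hb); case: x {ha}; case: y {hb}.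
  by apply: h; apply: den_Eq.
apply: den_Eq; first by rewrite -tH.
by rewrite -[LHS]/(t aHA (den (Digit pK (fun=> Par pK) (Var (c : nat)) (Var (u : nat))) t)
  (den (Digit pK (fun=> Par pK) (Var (c : nat)) (Var (v : nat))) t) 0) !phiE tH.
Qed.

Definition answer mode : nat :=
  match mode with 0 => hom H G | 1 => sub H G | _ => ind H G end.

Lemma phase3P mode (s : arrays) : mode < 3 -> const_arrays s -> s aACC 0 0 0 = 0 ->
  run (phase3 nat mode) s aANS 0 0 0 = answer mode.
Proof.
move=> m3 cs sA; rewrite /phase3; set c1 := count_maps _ _; set c2 := Sto0 _ _.
rewrite -[run (c1;; c2) s]/(run c2 (run c1 s)); set t := run c1 s.
have tA : t aACC 0 0 0 = count H G mode by apply: count_mapsP.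
have tH : t aHA = s0 aHA by rewrite /t run_avoids; [case: cs | avoid].
rewrite -[LHS]/(den (if mode is 0%N then Arr0 aACC else Bin Div (Arr0 aACC) (automorphisms nat)) t).
clearbody t; clear c1 c2 cs.
case: mode m3 tA => [|[|[|//]]] _ tA; rewrite /answer.
- by rewrite -[LHS]/(t aACC 0 0 0) tA.
- rewrite -[LHS]/(t aACC 0 0 0 %/ den (automorphisms nat) t) tA den_automorphisms // /count.
  by rewrite inj_homE mulnK // aut_gt0.
- rewrite -[LHS]/(t aACC 0 0 0 %/ den (automorphisms nat) t) tA den_automorphisms // /count.
  by rewrite ind_homE mulnK // aut_gt0.
Qed.

End CountMaps.

(** * The layout of encoded graphs *)

Section Encoding.

Variables (m : nat) (K : sgraph m).

Definition nb u : seq nat := if insub u is Some v then neighbors K v else [::].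

Lemma nbE (u : 'I_m) : nb u = neighbors K u.
Proof. by rewrite /nb valK. Qed.

Lemma mem_nb (u v : 'I_m) : ((v : nat) \in nb u) = adj K u v.
Proof.
rewrite nbE mem_map => [|x y]; last exact: ord_inj.
by rewrite (mem_filter _ v (enum 'I_m)) mem_enum andbT.
Qed.

Lemma nb_lt u v : v \in nb u -> (u < m) && (v < m).
Proof.
rewrite /nb; case: insubP => // w ltu _ /mapP[x _ ->].
by rewrite ltu ltn_ord.
Qed.

Lemma nb_sym u v : (u \in nb v) = (v \in nb u).
Proof.
have h x y : x \in nb y -> y \in nb x.
  move=> xy; have /andP[lty ltx] := nb_lt xy.
  move: xy; rewrite -[x]/(val (Ordinal ltx)) -[y]/(val (Ordinal lty)).
  by rewrite !mem_nb adj_sym.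
by apply/idP/idP; apply: h.
Qed.

Lemma nb_irr u : (u \in nb u) = false.
Proof.
apply/negP => uu; have /andP[ltu _] := nb_lt uu.
by move: uu; rewrite -[u]/(val (Ordinal ltu)) mem_nb adj_irr.
Qed.

Lemma size_nb_le u : size (nb u) <= m.
Proof.
rewrite /nb; case: insub => // v; rewrite size_map.
by apply: leq_trans (size_subseq (filter_subseq _ _)) _; rewrite size_enum_ord.
Qed.

Lemma nth_flatten_row (ss : seq (seq nat)) u j :
  u < size ss -> j < size (nth [::] ss u) ->
  nth 0 (flatten ss) (\sum_(w < u) size (nth [::] ss w) + j) = nth 0 (nth [::] ss u) j.
Proof.
elim: ss u => // s ss IH [_ ltj|u ltu ltj]; first by rewrite big_ord0 /= nth_cat ltj.
rewrite big_ord_recl /= nth_cat -addnA ltnNge leq_addr /= addKn.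
exact: IH.
Qed.

Lemma size_flatten_rows (ss : seq (seq nat)) :
  size (flatten ss) = \sum_(w < size ss) size (nth [::] ss w).
Proof.
elim: ss => [|s ss IH]; first by rewrite big_ord0.
by rewrite big_ord_recl /= size_cat IH.
Qed.

Let rows := [seq size (neighbors K u) :: neighbors K u | u <- enum 'I_m].

Lemma size_rows : size rows = m.
Proof. by rewrite size_map size_enum_ord. Qed.

Lemma nth_rows u : u < m -> nth [::] rows u = size (nb u) :: nb u.
Proof.
move=> ltu; rewrite (nth_map (Ordinal ltu)) ?size_enum_ord //.
have -> : nth (Ordinal ltu) (enum 'I_m) u = Ordinal ltu.
  by apply: ord_inj; rewrite nth_enum_ord.
by rewrite -nbE.
Qed.

Lemma sum_rows u : u <= m -> \sum_(w < u) size (nth [::] rows w) = \sum_(w < u) (size (nb w)).+1.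
Proof.
move=> leu; apply: eq_bigr => w _.
by rewrite nth_rows // (leq_trans (ltn_ord w)).
Qed.

Lemma row_pos_end q : row_pos q nb m = q + size (encode K).
Proof. by rewrite /row_pos /= size_flatten_rows size_rows sum_rows // addSnnS. Qed.

Variables (pre post : seq nat).
Let inp i := nth 0 (pre ++ encode K ++ post) i.

Lemma inp_encode i : i < size (encode K) -> inp (size pre + i) = nth 0 (encode K) i.
Proof. by move=> lti; rewrite /inp nth_cat (leq_gtF (leq_addr _ _)) addKn nth_cat lti. Qed.

Lemma inp_row u j : u < m -> j <= size (nb u) ->
  inp (row_pos (size pre) nb u + j) = nth 0 (size (nb u) :: nb u) j.
Proof.
move=> ltu lej; have lt_pos : row_pos (size pre) nb u + j < size pre + size (encode K).
  rewrite -row_pos_end; apply: leq_trans (row_pos_le _ _ ltu).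
  by rewrite row_posS ltn_add2l ltnS.
rewrite /row_pos addSn addSnnS -!addnA inp_encode; last first.
  by move: lt_pos; rewrite /row_pos addSn addSnnS -!addnA ltn_add2l.
rewrite addnS /= -sum_rows ?nth_flatten_row ?nth_rows ?size_rows //; exact: ltnW.
Qed.

Lemma inp_size_row u : u < m -> inp (row_pos (size pre) nb u) = size (nb u).
Proof. by move=> ltu; rewrite -[row_pos _ _ _]addn0 inp_row. Qed.

Lemma inp_nth_row u j : u < m -> j < size (nb u) ->
  inp (row_pos (size pre) nb u + j.+1) = nth 0 (nb u) j.
Proof. by move=> ltu ltj; rewrite inp_row. Qed.

Lemma size_encode : size (encode K) <= m.+1 * m.+1.
Proof.
have : row_pos 0 nb m <= 1 + m * m.+1.
  rewrite /row_pos leq_add2l -[X in _ <= X * _]card_ord -sum_nat_const.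
  by apply: leq_sum => w _; rewrite ltnS size_nb_le.
rewrite row_pos_end; lia.
Qed.

Lemma encode_le x : x \in encode K -> x <= m.
Proof.
rewrite inE => /orP[/eqP->//|/flattenP[s /mapP[u _ ->]]]; rewrite inE => /orP[/eqP->|].
  by rewrite -nbE size_nb_le.
by rewrite -nbE => /nb_lt/andP[_ /ltnW].
Qed.

End Encoding.

(** * Low-degree vertices from the degeneracy *)

Section Sparsity.

Variables (n : nat) (G : sgraph n).

(** Take a vertex of P with the fewest ancestors in an acyclic orientation. An arc entering it from
    P would start at a vertex with fewer, so its neighbours in P are all out-neighbours. *)
Lemma sparse_vertex (P : 'I_n -> bool) : (exists u, P u) ->
  exists2 u : 'I_n, P u & \sum_(v < n) (adj G u v && P v) <= degeneracy G.
Proof.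
rewrite /degeneracy; case: ex_minnP => d /existsP[o /and3P[/forallP ori /forallP acy /forallP deg]] _.
case=> u0 Pu0.
pose below (u : 'I_n) := #|[set w | connect (arc o) w u]|.
case: (@arg_minnP _ u0 P below Pu0) => u Pu min_u.
exists u => //; apply: leq_trans (deg u); rewrite -sum1_card big_mkcond.
rewrite (big_mkcond (fun v => v \in _)); apply: leq_sum => v _.
have /forallP/(_ v)/andP[/eqP adjE _] := ori u.
rewrite inE adjE; case Pv: (P v); rewrite ?andbF // andbT.
case uv: (arc o u v) => //=; case vu: (arc o v u) => //.
have := min_u v Pv; rewrite leqNgt => /negP[]; apply: proper_card.
apply/properP; split.
  by apply/subsetP => w; rewrite !inE => wv; apply: connect_trans wv (connect1 vu).
exists u; rewrite !inE ?connect0 //.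
by have /forallP/(_ u)/implyP := acy v; apply.
Qed.

End Sparsity.

(** * The first stage: reading, orienting, simple parameters *)

Section Phase1.

Variables (W : nat) (par inp : nat -> nat).
Hypothesis W_ge : narr <= W.

Local Notation den := (den W par inp).
Local Notation run := (run W par inp).

Variables (k n : nat) (H : sgraph k) (G : sgraph n).
Hypothesis inpE : forall i, inp i = nth 0 (encode H ++ encode G) i.
Hypotheses (parK : par pK = k) (parN : par pN = n) (parG : par pG = size (encode H)).
Hypothesis W_big : size (encode H ++ encode G) < W.
Hypotheses (kk_lt : k * k < W) (k5_lt : 5 * k < W) (n2_lt : 2 * n.+1 < W) (k1_lt : k.+1 < W).

Definition zeros : arrays := fun _ _ _ _ => 0.

Definition phase1_spec (t : arrays) (D : nat) : Prop :=
  [/\ D <= degeneracy G, D <= n,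
     exists oarc : rel 'I_n,
       (forall x y, (adj G x y : nat) = oarc x y + oarc y x) /\
       (forall x y : 'I_n, \sum_(1 <= l < D.+1) (t aOUT l x.+1 0 == y.+1) = oarc x y),
     (forall x : 'I_n, t aOUT D.+1 x.+1 0 = x.+1) /\
       (forall l x, 0 < l -> t aOUT l x 0 <= n)
   & (forall u v : 'I_k, t aHA u v 0 = adj H u v) /\ t aACC 0 0 0 = 0].

Definition phase1_cells (t : arrays) (D : nat) : Prop :=
  [/\ t aPAR pN1 0 0 = n.+1, t aPAR pK1 0 0 = k.+1, t aPAR pKK 0 0 = k * k,
      t aPAR p5K 0 0 = 5 * k & t aPAR pD1 0 0 = D.+1 /\ t aPAR pA 0 0 = 2 * D.+1].

Lemma phase1P : exists D, phase1_spec (run (phase1 nat) zeros) D /\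
  phase1_cells (run (phase1 nat) zeros) D.
Proof.
rewrite /phase1; set c1 := read_graph _ _ _; set c2 := read_graph _ _ _.
set c3 := peel _; set c4 := orient _; set c5 := (set_par pN1 _ ;; _).
rewrite -[run _ _]/(run c5 (run c4 (run c3 (run c2 (run c1 zeros))))).
set t1 := run c1 zeros; set t2 := run c2 t1; set t3 := run c3 t2; set t4 := run c4 t3.
have inpE0 i : inp i = nth 0 ([::] ++ encode H ++ encode G) i by rewrite inpE.
have inpE1 i : inp i = nth 0 (encode H ++ encode G ++ [::]) i by rewrite cats0 inpE.
have HA1 u v : u < k -> t1 aHA u v 0 = (v \in nb H u).
  apply: (read_graphP (q := 0) (m := k)) => //.
  - rewrite row_pos_end; apply: leq_ltn_trans W_big; by rewrite size_cat leq_addr.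
  - by move=> w ltw; rewrite inpE0; apply: (inp_size_row H [::] (encode G)).
  - by move=> w j ltw ltj; rewrite inpE0; apply: (inp_nth_row [::] (encode G)).
  - by move=> w _; apply: size_nb_le.
have GA2 u v : u < n -> t2 aGA u v 0 = (v \in nb G u).
  apply: (read_graphP (q := size (encode H)) (m := n)) => //.
  - by rewrite row_pos_end -size_cat.
  - by move=> w ltw; rewrite inpE1; apply: (inp_size_row G (encode H) [::]).
  - by move=> w j ltw ltj; rewrite inpE1; apply: (inp_nth_row (encode H) [::]).
  - by move=> w _; apply: size_nb_le.
  - by move=> x y; rewrite /t1 run_avoids //; avoid.
have n_lt1 : n.+1 < W by apply: leq_ltn_trans n2_lt; lia.
pose g u v := v \in nb G u.
have gs u v : g u v = g v u by apply: nb_sym.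
have gi u : g u u = false by apply: nb_irr.
have sp (P : 'I_n -> bool) : (exists u, P u) ->
    exists2 u : 'I_n, P u & \sum_(v < n) (g u v && P v) <= degeneracy G.
  move=> /(sparse_vertex G)[u Pu le]; exists u => //; apply: leq_trans le.
  by apply: leq_sum => v _; rewrite /g mem_nb.
have POS2 u : t2 aPOS u 0 0 = 0.
  rewrite /t2 run_avoids; last by avoid.
  by rewrite /t1 run_avoids //; avoid.
have [pinj pout] := peelP inp W_ge parN n_lt1 gs gi sp GA2 POS2.
pose p u := t3 aPOS u 0 0; rewrite -/c3 -/t3 in pinj pout.
have GA3 u v : u < n -> t3 aGA u v 0 = g u v.
  by move=> ltu; rewrite /t3 run_avoids ?GA2 //; avoid.
have z3 a : [&& a != aPT, a != aHA, a != aGA & [&& a != aDEG, a != aPOS & a != aBEST]] ->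
    t3 a = zeros a.
  case/and4P=> a1 a2 a3 /and3P[a4 a5 a6].
  rewrite /t3 run_avoids; last by repeat (split || intro).
  rewrite /t2 run_avoids; last by repeat (split || intro).
  by rewrite /t1 run_avoids //; repeat (split || intro).
have [|||D [D4 Dd Dn OUT [OUTi OUT0 OUTn]]] := @orientP W par inp W_ge n (degeneracy G) g p t3 parN _ GA3 (fun=> erefl) _ _ pout.
- by case: (n) n2_lt n_lt1 => [|n'] h1 h2; [apply: leq_trans W_ge | lia].
- by move=> u; rewrite z3.
- by move=> l x; rewrite z3.
rewrite -/c4 -/t4 in D4 OUT OUTi OUT0 OUTn.
exists D; set t5 := run c5 t4.
have t5E a : a != aPAR -> t5 a = t4 a.
  by move=> na; rewrite /t5 run_avoids //; repeat (split || intro).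
split.
  split=> //.
  - exists (fun x y : 'I_n => oarc g p x y); split=> [x y|x y]; last by rewrite t5E // OUT.
    rewrite /oarc /g !mem_nb [adj G y x]adj_sym; case a: (adj G x y) => //=.
    case: (ltngtP (p x) (p y)) => // E.
    by have /ord_inj xy := pinj x y (ltn_ord x) (ltn_ord y) E; rewrite xy adj_irr in a.
  split=> [u v|].
    rewrite t5E // /t4 run_avoids; last by avoid.
    rewrite /t3 run_avoids; last by avoid.
    rewrite /t2 run_avoids; last by avoid.
    by rewrite HA1 // mem_nb.
  rewrite t5E // /t4 run_avoids; last by avoid.
  by rewrite z3.
have Add1 (e : exp nat) x t : den e t = x -> x.+1 < W -> den (e + Cst 1)%exp t = x.+1.
  by move=> he lt; rewrite (den_Add (x := x) (y := 1)) ?addn1.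
have lt_D : D.+1 < W by apply: leq_ltn_trans n_lt1; lia.
have lt_2D : 2 * D.+1 < W by apply: leq_ltn_trans n2_lt; lia.
pose q1 := upda t4 aPAR pN1 0 0 n.+1; pose q2 := upda q1 aPAR pK1 0 0 k.+1.
pose q3 := upda q2 aPAR pKK 0 0 (k * k); pose q4 := upda q3 aPAR p5K 0 0 (5 * k).
pose q5 := upda q4 aPAR pD1 0 0 D.+1; pose q6 := upda q5 aPAR pA 0 0 (2 * D.+1).
have -> : t5 = q6.
  pose x1 := den (Par pN + Cst 1)%exp t4; pose r1 := upda t4 aPAR pN1 0 0 x1.
  pose x2 := den (Par pK + Cst 1)%exp r1; pose r2 := upda r1 aPAR pK1 0 0 x2.
  pose x3 := den (Par pK * Par pK)%exp r2; pose r3 := upda r2 aPAR pKK 0 0 x3.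
  pose x4 := den (Cst 5 * Par pK)%exp r3; pose r4 := upda r3 aPAR p5K 0 0 x4.
  pose x5 := den (Arr0 aD + Cst 1)%exp r4; pose r5 := upda r4 aPAR pD1 0 0 x5.
  pose x6 := den (Cst 2 * (Arr0 aD + Cst 1))%exp r5.
  rewrite -[t5]/(upda r5 aPAR pA 0 0 x6).
  have e1 : x1 = n.+1 by apply: Add1.
  have e2 : x2 = k.+1 by apply: Add1.
  have e3 : x3 = k * k by apply: den_Mul.
  have e4 : x4 = 5 * k by apply: den_Mul.
  have e5 : x5 = D.+1 by apply: Add1.
  have e6 : x6 = 2 * D.+1 by apply: den_Mul => //; apply: Add1.
  by rewrite e6 /r5 e5 /r4 e4 /r3 e3 /r2 e2 /r1 e1.
by [].
Qed.

End Phase1.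

(** * The second stage: the exponential loop bounds *)

Section Phase2.

Variables (W : nat) (par inp : nat -> nat).
Hypothesis W_ge : narr <= W.

Local Notation den := (den W par inp).
Local Notation run := (run W par inp).

Variables (k n A : nat) (s : arrays).
Hypotheses (parK : par pK = k) (parN : par pN = n) (parK1 : par pK1 = k.+1).
Hypotheses (parKK : par pKK = k * k) (par5 : par p5K = 5 * k) (parA : par pA = A).
Hypotheses (CL_lt : A ^ (k * k) < W) (CS_lt : k.+1 ^ (5 * k) < W).
Hypotheses (P_lt : maxn 1 n ^ (k %/ 4) < W) (KPK_lt : k ^ k < W) (k4_lt : 4 * k.+1 < W).

Lemma phase2P (t := run (phase2 nat) s) :
  [/\ t aPAR pCL 0 0 = A ^ (k * k), t aPAR pCS 0 0 = k.+1 ^ (5 * k),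
      t aPAR pP 0 0 = maxn 1 n ^ (k %/ 4), t aPAR pKPK 0 0 = k ^ k
    & forall a, a != aPAR -> t a = s a].
Proof.
pose y1 := Prod pKK (fun _ : exp nat => Par pA : exp nat).
pose y2 := Prod p5K (fun _ : exp nat => Par pK1 : exp nat).
pose y3 := Prod pK (fun i : exp nat => Ite (Nz (Par pN) && (Cst 4 * (i + Cst 1) <= Par pK)) (Par pN) (Cst 1))%exp.
pose y4 := Prod pK (fun _ : exp nat => Par pK : exp nat).
have e1 t' : den y1 t' = A ^ (k * k).
  rewrite (den_Prod W_ge (g := fun=> A) parKK) => [|_]; last exact: parA.
  by rewrite prod_nat_const card_ord modn_small.
have e2 t' : den y2 t' = k.+1 ^ (5 * k).
  rewrite (den_Prod W_ge (g := fun=> k.+1) par5) => [|_]; last exact: parK1.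
  by rewrite prod_nat_const card_ord modn_small.
have e4 t' : den y4 t' = k ^ k.
  rewrite (den_Prod W_ge (g := fun=> k) parK) => [|_]; last exact: parK.
  by rewrite prod_nat_const card_ord modn_small.
have e3 t' : den y3 t' = maxn 1 n ^ (k %/ 4).
  rewrite (den_Prod W_ge (g := fun i => if i < k %/ 4 then maxn 1 n else 1) parK) => [|i].
    rewrite (prod_place (fun=> maxn 1 n)); last exact: leq_div.
    by rewrite /place prod_nat_const card_ord modn_small.
  have lt4 : 4 * i.+1 < W by apply: leq_ltn_trans k4_lt; rewrite leq_mul2l ltnS ltnW ?orbT.
  rewrite (den_Ite _ _ (p := (n != 0) && (4 * i.+1 <= k))); last first.
    apply: den_And; first by rewrite den_Nz -parN.
    rewrite den_Le (_ : den (Par pK) t' = k); last exact: parK.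
    congr nat_of_bool; congr (_ <= _).
    apply: den_Mul => //; rewrite (den_Add (x := i) (y := 1)) ?addn1 //.
    by apply: leq_ltn_trans lt4; apply: leq_pmull.
  rewrite leq_divRL // [i.+1 * 4]mulnC -[den (Par pN) t']/(par pN) parN.
  by case: (4 * i.+1 <= k); rewrite ?andbF ?andbT //; case: (n) => [|n'] //; rewrite (maxn_idPr _).
pose q1 := upda s aPAR pCL 0 0 (A ^ (k * k)); pose q2 := upda q1 aPAR pCS 0 0 (k.+1 ^ (5 * k)).
pose q3 := upda q2 aPAR pP 0 0 (maxn 1 n ^ (k %/ 4)); pose q4 := upda q3 aPAR pKPK 0 0 (k ^ k).
have -> : t = q4.
  pose r1 := upda s aPAR pCL 0 0 (den y1 s); pose r2 := upda r1 aPAR pCS 0 0 (den y2 r1).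
  pose r3 := upda r2 aPAR pP 0 0 (den y3 r2); pose r4 := upda r3 aPAR pKPK 0 0 (den y4 r3).
  by rewrite -[t]/r4 /r4 e4 /r3 e3 /r2 e2 /r1 e1.
by split=> // a na; rewrite /q4 /q3 /q2 /q1 /upda (negPf na).
Qed.

End Phase2.

(** * The machine programs and their running time *)

Definition achieves (p : cmd) (T : nat) (st : state) (Q : state -> Prop) : Prop :=
  exists t st', [/\ exec p st t st', t <= T & Q st'].

Lemma achieves_seq p q T1 T2 st Q :
  achieves p T1 st (fun st1 => achieves q T2 st1 Q) -> achieves (Seq p q) (T1 + T2) st Q.
Proof.
case=> t1 [st1 [ex1 le1 [t2 [st2 [ex2 le2 q2]]]]].
by exists (t1 + t2), st2; split=> //; [apply: ExecSeq ex1 ex2 | apply: leq_add].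
Qed.

Lemma achieves_weak p T T' st (Q Q' : state -> Prop) :
  T <= T' -> (forall st', Q st' -> Q' st') -> achieves p T st Q -> achieves p T' st Q'.
Proof.
move=> leT sub [t [st' [ex le q]]]; exists t, st'; split=> //; first exact: leq_trans leT.
exact: sub.
Qed.

Section Prologue.

Variable W : nat.
Local Notation U := (unit_cost W).

Lemma achieves_assign r e st (Q : state -> Prop) :
  small_expr W st e -> eval st e <= W -> leaves e <= 3 ->
  Q (State (upd (reg st) r (eval st e)) (mem st)) -> achieves (Assign r e) U st Q.
Proof.
move=> sm le_e l3 q; do 2!eexists; split; [exact: ExecAssign| |exact: q].
have := assign_small sm le_e l3; rewrite /unit_cost; lia.
Qed.

Lemma achieves_load r a st (Q : state -> Prop) :
  reg st a <= W -> mem st (reg st a) <= W ->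
  Q (State (upd (reg st) r (mem st (reg st a))) (mem st)) ->
  achieves (Assign r (Deref (Reg a))) U st Q.
Proof.
move=> le_a le_m q; do 2!eexists; split; [exact: ExecAssign| |exact: q].
rewrite /=; have := leq_bits le_a; have := leq_bits le_m; have := bitsW_sq W.
by rewrite /unit_cost; lia.
Qed.

Lemma achieves_loop (i m M T : nat) body (P : nat -> state -> Prop) st :
  M <= W ->
  (forall j st, j <= M -> P j st -> reg st i = j /\ reg st m = M) ->
  (forall j st, j < M -> P j st -> achieves body T st (P j.+1)) ->
  P 0 st -> achieves (While (Op Lt (Reg i) (Reg m)) body) (M * (T + U) + U) st (P M).
Proof.
move=> leM hreg hbody P0.
have [t [st' [ex le PM]]] := exec_loop leM hreg hbody P0.
exists t, st'; split=> //; apply: leq_trans le _.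
have : 4 * bits W ^ 2 <= U by rewrite leq_mul2r orbT.
by move=> le4; apply: leq_add => //; rewrite leq_mul2l leq_add2l le4 orbT.
Qed.

Definition incr r := Assign r (Op Add (Reg r) (Const 1)).

(** The end of an encoding is not marked, so its rows are skipped one by one: register 20 is the
    current address, 21 counts rows and 22 holds a length. Register r receives the number of
    vertices. *)
Definition scan r : cmd :=
  Seq (Assign r (Deref (Reg 20))) (Seq (incr 20) (Seq (Assign 21 (Const 0))
    (While (Op Lt (Reg 21) (Reg r))
      (Seq (Assign 22 (Deref (Reg 20)))
      (Seq (Assign 20 (Op Add (Reg 20) (Op Add (Reg 22) (Const 1)))) (incr 21)))))).

Lemma achieves_incr r st (Q : state -> Prop) : reg st r < W ->
  Q (State (upd (reg st) r (reg st r).+1) (mem st)) -> achieves (incr r) U st Q.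
Proof.
move=> ltW q; apply: achieves_assign => //=; rewrite ?addn1 //.
by rewrite (ltnW ltW) (leq_ltn_trans _ ltW).
Qed.

Lemma scanP m (K : sgraph m) pre post r st : r < 20 ->
  (forall i, mem st i = nth 0 (pre ++ encode K ++ post) i) -> reg st 20 = size pre ->
  size pre + size (encode K) < W -> m < W ->
  achieves (scan r) ((4 * m + 4) * U) st (fun st' =>
    [/\ mem st' = mem st, reg st' r = m, reg st' 20 = size pre + size (encode K)
      & forall x, x < 20 -> x != r -> reg st' x = reg st x]).
Proof.
move=> ltr memE r20 ltW ltm.
have rlt x : 20 <= x -> (x == r) = false /\ (r == x) = false by split; lia.
have [[e20 e20'] [e21 e21'] [e22 e22']] :
  [/\ (20 == r) = false /\ (r == 20) = false, (21 == r) = false /\ (r == 21) = false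
    & (22 == r) = false /\ (r == 22) = false] by split; apply: rlt.
have posW u : u <= m -> row_pos (size pre) (nb K) u < W.
  move=> leu; apply: leq_ltn_trans ltW; rewrite -row_pos_end; exact: row_pos_le.
have pos0 : row_pos (size pre) (nb K) 0 = (size pre).+1 by rewrite /row_pos big_ord0 addn0.
pose P j (st' : state) := [/\ mem st' = mem st, reg st' 21 = j, reg st' r = m,
  reg st' 20 = row_pos (size pre) (nb K) j
  & forall x, x < 20 -> x != r -> reg st' x = reg st x].
have mem0 : mem st (size pre) = m.
  by rewrite memE nth_cat ltnn subnn nth_cat.
pose Q (st' : state) := [/\ mem st' = mem st, reg st' r = m,
  reg st' 20 = size pre + size (encode K)
  & forall x, x < 20 -> x != r -> reg st' x = reg st x].
apply: (@achieves_weak _ (U + (U + (U + (m * (U + (U + U) + U) + U)))) _ _ Q Q) => //; first lia.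
apply: achieves_seq; apply: achieves_load; rewrite r20 ?mem0 ?(ltnW ltm) //.
  by have := posW 0 isT; rewrite pos0; lia.
apply: achieves_seq; apply: achieves_incr => /=; rewrite /upd /= e20 ?r20.
  by have := posW 0 isT; rewrite pos0; lia.
apply: achieves_seq; apply: achieves_assign => //=.
pose PQ st' := P m st'.
apply: (@achieves_weak _ (m * (U + (U + U) + U) + U) _ _ PQ Q) => //.
  by move=> st' [h1 h2 h3 h4 h5]; split=> //; rewrite h4 row_pos_end.
apply: (achieves_loop (P := P)) => //; first exact: ltnW.
- by move=> j st' _ [].
- move=> j st' ltj [h1 h2 h3 h4 h5].
  have sz : mem st (row_pos (size pre) (nb K) j) = size (nb K j).
    by rewrite memE inp_size_row.
  have posj := posW j (ltnW ltj); have := posW j.+1 ltj; rewrite row_posS => posj1.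
  apply: achieves_seq; apply: achieves_load; rewrite h4 ?h1 ?sz; try lia.
  apply: achieves_seq; apply: achieves_assign => //=; rewrite /upd /= ?h4; try lia.
  apply: achieves_incr => /=; rewrite /upd /= ?h2; first lia.
  split=> //=; rewrite ?h3 ?e21' ?e20' ?e22' //; first by rewrite row_posS addn1.
  by move=> x ltx xr; rewrite -(h5 _ ltx xr) !ifN //; lia.
- split=> //=; rewrite /upd /= ?e21' ?e20' ?eqxx ?pos0 //.
  by move=> x ltx xr; rewrite (negPf xr) !ifN //; lia.
Qed.

(* With x = n this modulus exceeds every number that the computation has to
   represent; with x the degeneracy it bounds the loops that do not run over
   vertices of G or over assignments. *)
Definition bigpow x k := (2 * (x + (k + 20))) ^ ((k + 20) * (k + 20)).

Lemma bigpow_ge x k e : e <= (k + 20) * (k + 20) -> (2 * (x + (k + 20))) ^ e <= bigpow x k.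
Proof. by move=> le; apply: leq_pexp2l => //; lia. Qed.

Definition power : cmd :=
  Seq (Assign 23 (Op Add (Reg 3) (Const 20)))
  (Seq (Assign 22 (Op Mul (Const 2) (Op Add (Reg 4) (Reg 23))))
  (Seq (Assign 23 (Op Mul (Reg 23) (Reg 23)))
  (Seq (Assign 1 (Const 1)) (Seq (Assign 21 (Const 0))
  (While (Op Lt (Reg 21) (Reg 23))
    (Seq (Assign 1 (Op Mul (Reg 1) (Reg 22))) (incr 21))))))).

Lemma powerP x k st : reg st 3 = k -> reg st 4 = x -> bigpow x k <= W ->
  achieves power ((3 * ((k + 20) * (k + 20)) + 6) * U) st (fun st' =>
    [/\ mem st' = mem st, reg st' 1 = bigpow x k
      & forall y, y < 20 -> y != 1 -> reg st' y = reg st y]).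
Proof.
move=> r3 r4 leW; set b := 2 * (x + (k + 20)); set e := (k + 20) * (k + 20).
have powW j : j <= e -> b ^ j <= W by move=> le; apply: leq_trans leW; apply: bigpow_ge.
have leb : b <= W by rewrite -[b]expn1; apply: powW; rewrite /e; lia.
have lee : e < W.
  apply: leq_trans (powW 2 _); last by rewrite /e; nia.
  by rewrite /e /b expnS expn1; nia.
pose P j (st' : state) := [/\ mem st' = mem st,
  [/\ reg st' 21 = j, reg st' 22 = b & reg st' 23 = e], reg st' 1 = b ^ j
  & forall y, y < 20 -> y != 1 -> reg st' y = reg st y].
pose Q (st' : state) := [/\ mem st' = mem st, reg st' 1 = bigpow x k
      & forall y, y < 20 -> y != 1 -> reg st' y = reg st y].
apply: (@achieves_weak _ (U + (U + (U + (U + (U + (e * (U + U + U) + U)))))) _ _ Q Q) => //; first lia.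
apply: achieves_seq; apply: achieves_assign; rewrite //= ?r3; try (rewrite /b in leb; lia).
apply: achieves_seq; apply: achieves_assign; rewrite //= /upd /= ?r3 ?r4; try (rewrite /b in leb; lia).
apply: achieves_seq; apply: achieves_assign; rewrite //= /upd /= ?r3 ?r4 -/e; try (rewrite /b in leb; lia).
apply: achieves_seq; apply: achieves_assign; rewrite //=; try lia.
apply: achieves_seq; apply: achieves_assign; rewrite //=.
apply: (@achieves_weak _ (e * (U + U + U) + U) _ _ (P e) Q) => //.
  by move=> st' [h1 h2 h3 h4].
apply: (achieves_loop (P := P)) => //; first exact: ltnW.
- by move=> j st' _ [_ [-> _ ->]].
- move=> j st' ltj [h1 [h2 h3 h4] h5 h6].
  have powj := powW j (ltnW ltj); have powj1 := powW _ ltj.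
  apply: achieves_seq; apply: achieves_assign; rewrite //= ?h5 ?h3 -?expnSr ?powj //.
  apply: achieves_incr; rewrite /= /upd /= h2; first lia.
  by split=> //= y lty y1; rewrite -(h6 _ lty y1) !ifN //; lia.
- by split=> //= y lty y1; rewrite /upd /= !ifN //; lia.
Qed.

End Prologue.

Definition read a i r : cmd :=
  Seq (comp_exp 17 (Arr a (Cst i) (Cst 0) (Cst 0))) (Assign r (Reg 17)).

Fixpoint loads i m : cmd :=
  if m is m'.+1 then Seq (read aPAR i i.+1) (loads i.+1 m') else Skip.

(** * Running compiled stages and loading parameters *)

Section Machine.

Variables (W base : nat) (inp : nat -> nat).
Hypothesis inpW : forall i, inp i < W.
Hypothesis inp_out : forall i, base <= i -> inp i = 0.
Hypotheses (W_ge : narr <= W) (base_le : base <= W).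

Local Notation U := (unit_cost W).

Definition par_good (l : seq nat) : Prop :=
  [/\ nth 0 l 0 = W, nth 0 l 1 = base & forall i, 1 < i -> nth 0 l i < W].

Definition config (l : seq nat) (s : arrays) (st : state) : Prop :=
  agree W base (nth 0 l) inp s st /\ bounded W s.

Lemma comp_config p l s st : wf [::] p p -> par_good l -> config l s st ->
  achieves (comp 17 p) (steps (nth 0 l) p * U) st (config l (run W (nth 0 l) inp p s)).
Proof.
move=> wfp [l0 l1 lW] [ag bd].
have lW' i : 1 < i < rparam -> nth 0 l i < W by case/andP=> /lW.
have ctx : ctx_ok W [::] 17 st by [].
have [t [st' [ex le _ ag' bd']]] :=
  compP l0 l1 lW' inpW inp_out W_ge base_le wfp (isT : rparam < 17) ctx ag bd.
by exists t, st'; split.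
Qed.

Lemma readP a i r l s st (Q : state -> Prop) : a < narr -> i < narr -> par_good l -> config l s st ->
  (forall st1, config l s st1 ->
     Q (State (upd (reg st1) r (s a i 0 0)) (mem st1))) ->
  achieves (read a i r) (5 * U) st Q.
Proof.
move=> lta lti [l0 l1 lW] [ag bd] hQ; rewrite [5 * U]mulSnr.
have lW' j : 1 < j < rparam -> nth 0 l j < W by case/andP=> /lW.
have ctx : ctx_ok W [::] 17 st by [].
have wfe_a : wfe [::] (Arr a (Cst i) (Cst 0) (Cst 0)) (Arr a (Cst i) (Cst 0) (Cst 0)).
  by do ?constructor.
have [t [st1 [ex le r17 ltW kp]]] :=
  comp_expP l0 l1 lW' inpW inp_out W_ge base_le wfe_a (isT : rparam < 17) ctx ag bd.
apply: achieves_seq; exists t, st1; split=> //; rewrite /= in r17 ltW.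
apply: achieves_assign; rewrite /= ?r17 ?(ltnW ltW) //; apply: hQ.
by split=> //; apply: agree_keeps kp ag.
Qed.

Lemma load_config l s st : 1 < size l -> size l < rparam -> par_good l -> config l s st ->
  achieves (read aPAR (size l) (size l).+1) (5 * U) st
    (fun st' => par_good (rcons l (s aPAR (size l) 0 0)) /\
       config (rcons l (s aPAR (size l) 0 0)) s st').
Proof.
move=> l1 l16 gl cf; apply: (readP _ _ gl cf) => //; first by rewrite /narr /rparam in l16 *; lia.
move=> st1 [[h1 h2 h3] bd]; split; last first.
  split=> //; split=> //= i lti; rewrite /upd eqSS nth_rcons.
  by case: (ltngtP i (size l)) => // lt; rewrite h1 // nth_default // ltnW.
have [g0 g1 gW] := gl; split=> [||i i1]; rewrite nth_rcons.
- by rewrite (ltnW l1).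
- by rewrite l1.
case: (ltngtP i (size l)) => _; [exact: gW | exact: leq_trans W_ge|].
apply: bd => //; apply: leq_trans W_ge => //.
by apply: leq_trans l16 _.
Qed.

Lemma loads_config m l s st : 1 < size l -> size l + m <= rparam -> par_good l -> config l s st ->
  let l' := l ++ [seq s aPAR i 0 0 | i <- iota (size l) m] in
  achieves (loads (size l) m) ((5 * m).+1 * U) st (fun st' => par_good l' /\ config l' s st').
Proof.
elim: m l st => [|m IH] l st l1 l16 gl cf /=.
  by rewrite cats0; exists 1, st; split=> //; apply: ExecSkip.
rewrite (_ : (5 * m.+1).+1 * U = 5 * U + (5 * m).+1 * U); last lia.
apply: achieves_seq; apply: (achieves_weak (leqnn _) _ (load_config l1 _ gl cf)); last lia.
move=> st1 [g1 c1]; have := IH _ st1 _ _ g1 c1.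
rewrite size_rcons -cats1 -catA; apply; [exact: ltnW | lia].
Qed.

End Machine.

(** * The parameters and their bounds *)

Section Params.

Variables (W base g k n D : nat).

(** The prefixes of length 6, 12 and 16 describe the registers during the three stages; a parameter
    that is not yet loaded reads as 0. *)
Definition params : seq nat :=
  [:: W; base; k; n; g; W.-1; n.+1; k.+1; k * k; 5 * k; D.+1; 2 * D.+1;
      (2 * D.+1) ^ (k * k); k.+1 ^ (5 * k); maxn 1 n ^ (k %/ 4); k ^ k].

Lemma nth_take_le (s : seq nat) m i : nth 0 (take m s) i <= nth 0 s i.
Proof.
case: (ltnP i m) => [lt|le]; first by rewrite nth_take.
by rewrite nth_default // size_take; case: ltnP => // h; apply: leq_trans h le.
Qed.

Lemma leq_bigpow x y e : y <= (2 * (x + (k + 20))) ^ e -> e <= (k + 20) * (k + 20) ->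
  y <= bigpow x k.
Proof. by move=> le le_e; apply: leq_trans le (bigpow_ge _ le_e). Qed.

Lemma ltn_bigpow x y e : y <= (2 * (x + (k + 20))) ^ e -> e < (k + 20) * (k + 20) ->
  y < bigpow x k.
Proof.
move=> le lt_e; apply: leq_ltn_trans le _; rewrite ltn_exp2l //; lia.
Qed.

Lemma bigpow_gt0 x : 0 < bigpow x k.
Proof. by rewrite expn_gt0 muln_gt0 !addnS. Qed.

Lemma sq_le_bigpow x : (k + 20) * (k + 20) <= bigpow x k.
Proof.
apply: (@leq_bigpow _ _ 2); last nia.
by rewrite expnS expn1; apply: leq_mul; lia.
Qed.

Lemma leq_exp_mono a b e e' : a <= b -> 0 < b -> e <= e' -> a ^ e <= b ^ e'.
Proof.
move=> leab b0 lee; apply: (@leq_trans (b ^ e)); last exact: leq_pexp2l.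
by case: e {lee} => // e; rewrite leq_exp2r.
Qed.

(** The bounds of class [SizeK] involve only k and D, which is at most d. This is where [bigpow] is
    taken at d: the factor that pays for these loops must not depend on n. *)
Lemma params_class d : D <= d -> forall m i, i \notin [:: 0; 1; pG; pM] ->
  nth 0 (take m params) i <= match par_class i with
    | SizeK => bigpow d k | SizeN => n.+1 | SizeP => maxn 1 n ^ (k %/ 4) end.
Proof.
move=> leD m i ni; apply: leq_trans (nth_take_le _ _ _) _.
set b := 2 * (d + (k + 20)).
have bE : b = 2 * (d + (k + 20)) by [].
have hK y e : y <= b ^ e -> e <= (k + 20) * (k + 20) -> y <= bigpow d k := @leq_bigpow d y e.
case: (ltnP i 16) => [|le]; last by rewrite nth_default //.
move: ni; do 16?[case: i => [|i]] => // _ _; rewrite /= -?[par_class _]/SizeN -?[par_class _]/SizeP -?[par_class _]/SizeK.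
- by apply: (hK _ 1); rewrite ?expn1; lia.
- by apply: (hK _ 1); rewrite ?expn1; lia.
- by apply: (hK _ 2); rewrite ?(expnS b) ?expn1; nia.
- by apply: (hK _ 2); rewrite ?(expnS b) ?expn1; nia.
- by apply: (hK _ 1); rewrite ?expn1; lia.
- by apply: (hK _ 1); rewrite ?expn1; lia.
- by apply: (hK _ (k * k)); [apply: leq_exp_mono; lia | nia].
- by apply: (hK _ (5 * k)); [apply: leq_exp_mono; lia | nia].
- by apply: (hK _ k); [apply: leq_exp_mono; lia | nia].
Qed.

Lemma params_lt : W = bigpow n k -> g <= k.+1 * k.+1 -> D <= n -> forall m i, 1 < i ->
  nth 0 (take m params) i < W.
Proof.
move=> WE leg leD m i i1; apply: leq_ltn_trans (nth_take_le _ _ _) _.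
set b := 2 * (n + (k + 20)).
have bE : b = 2 * (n + (k + 20)) by [].
have hK y e : y <= b ^ e -> e < (k + 20) * (k + 20) -> y < W.
  by rewrite WE; apply: ltn_bigpow.
have W0 : 0 < W by apply: (hK _ 0) => //; nia.
case: (ltnP i 16) => [|le]; last by rewrite nth_default.
move: i1; do 16?[case: i => [|i]] => // _ _; rewrite /=.
- by apply: (hK _ 1); rewrite ?expn1; lia.
- by apply: (hK _ 1); rewrite ?expn1; lia.
- by apply: (hK _ 2); rewrite ?(expnS b) ?expn1; nia.
- by rewrite ltn_predL.
- by apply: (hK _ 1); rewrite ?expn1; lia.
- by apply: (hK _ 1); rewrite ?expn1; lia.
- by apply: (hK _ 2); rewrite ?(expnS b) ?expn1; nia.
- by apply: (hK _ 2); rewrite ?(expnS b) ?expn1; nia.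
- by apply: (hK _ 1); rewrite ?expn1; lia.
- by apply: (hK _ 1); rewrite ?expn1; lia.
- by apply: (hK _ (k * k)); [apply: leq_exp_mono; lia | nia].
- by apply: (hK _ (5 * k)); [apply: leq_exp_mono; lia | nia].
- by apply: (hK _ k); [apply: leq_exp_mono; rewrite ?leq_div //; lia | nia].
- by apply: (hK _ k); [apply: leq_exp_mono; lia | nia].
Qed.

End Params.

Definition prologue : cmd :=
  Seq (scan 3) (Seq (Assign 5 (Reg 20)) (Seq (scan 4) (Seq (Assign 2 (Reg 20))
    (Seq power (Assign 6 (Op Sub (Reg 1) (Const 1))))))).

Definition program mode : cmd :=
  Seq prologue (Seq (comp 17 (phase1 nat)) (Seq (loads 6 6)
    (Seq (comp 17 (phase2 nat)) (Seq (loads 12 4)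
    (Seq (comp 17 (phase3 nat mode)) (read aANS 0 0)))))).

Section Program.

Variables (k n : nat) (H : sgraph k) (G : sgraph n).

Let input := encode H ++ encode G.
Let W := bigpow n k.
Let d := degeneracy G.
Let inp i := nth 0 input i.

Local Notation U := (unit_cost W).
Local Notation ps := (params W (size input) (size (encode H)) k n).

Lemma size_input_lt : size input < W.
Proof.
rewrite size_cat; apply: (@ltn_bigpow _ _ _ 2); last nia.
apply: (@leq_trans ((k.+1 + n.+1) * (k.+1 + n.+1))).
  by have := size_encode H; have := size_encode G; nia.
by rewrite expnS expn1; apply: leq_mul; lia.
Qed.

Lemma inp_lt i : inp i < W.
Proof.
have ltW y : y <= n + k -> y < W.
  by move=> le; apply: (@ltn_bigpow _ _ _ 1); rewrite ?expn1; lia.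
rewrite /inp; case: (ltnP i (size input)) => [|le]; last by rewrite nth_default // ltW.
move=> /(mem_nth 0); rewrite mem_cat => /orP[] /encode_le le; apply: ltW; apply: leq_trans le _.
  exact: leq_addl.
exact: leq_addr.
Qed.

Lemma narr_le : narr <= W.
Proof. by apply: (@leq_bigpow _ _ _ 1); rewrite ?expn1 /narr; lia. Qed.

Lemma prologueP D : achieves prologue
  ((4 * k + 4 * n + 3 * ((k + 20) * (k + 20)) + 17) * U) (init input)
  (config W (size input) inp (take 6 (ps D)) zeros).
Proof.
set e := (k + 20) * (k + 20); have ltS := size_input_lt.
have ltW y : y <= n + k -> y < W.
  by move=> le; apply: (@ltn_bigpow _ _ _ 1); rewrite ?expn1; lia.
pose T := (4 * k + 4) * U + (U + ((4 * n + 4) * U + (U + ((3 * e + 6) * U + U)))).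
apply: (@achieves_weak _ T) => [|st'|]; [rewrite /T; lia | exact: id |].
have szH : size (encode H) <= size input by rewrite size_cat leq_addr.
apply: achieves_seq; apply: (achieves_weak (leqnn _) _
  (@scanP W k H [::] (encode G) 3 _ isT _ _ _ _)) => //; first last.
- by apply: ltW; rewrite leq_addl.
- exact: leq_ltn_trans ltS.
move=> st1 [m1 k1 q1 r1].
apply: achieves_seq; apply: achieves_assign; rewrite /= ?q1 ?add0n //.
- by apply: ltnW; apply: leq_ltn_trans ltS.
- by apply: ltnW; apply: leq_ltn_trans ltS.
apply: achieves_seq; apply: (achieves_weak (leqnn _) _
  (@scanP W n G (encode H) [::] 4 _ isT _ _ _ _)) => //; first last.
- by apply: ltW; rewrite leq_addr.
- by rewrite -size_cat.
- by move=> i; rewrite m1 cats0.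
rewrite -size_cat -/input => st2 [m2 n2 q2 r2].
apply: achieves_seq; apply: achieves_assign; rewrite /= ?q2 ?(ltnW ltS) //.
apply: achieves_seq; apply: (achieves_weak (leqnn _) _ (@powerP W n k _ _ _ (leqnn _))) => //=; first last.
  by rewrite /upd /= r2 //= /upd /= k1.
move=> st3 [m3 w3 r3].
have W0 : 0 < W by apply: leq_ltn_trans ltS.
apply: achieves_assign; rewrite /= ?w3 //.
  by rewrite leqnn.
  exact: leq_subr.
have R2 : reg st3 2 = size input by rewrite r3.
have R y : y < 20 -> y != 1 -> y != 2 ->
    reg st3 y = if y == 4 then n else if y == 5 then size (encode H) else if y == 3 then k else 0.
  move=> lty y1 y2; rewrite r3 // /upd (negPf y2).
  case: eqVneq => [->|y4]; first exact: n2.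
  rewrite r2 //= /upd; case: eqVneq => // y5.
  by case: eqVneq => [->|y3]; [exact: k1 | rewrite r1].
split=> //; split=> [i lti|i lti|a i j l _ _ _ _].
- rewrite /rparam in lti; move: lti; rewrite -[reg _ _]/(upd (reg st3) 6 (bigpow n k - 1) i.+1) /upd eqSS.
  do 6?[case: i => [|i]] => // lti; rewrite ?w3 ?R2 ?R //= ?subn1 //.
    by rewrite nth_nil.
  by lia.
- by rewrite -[mem _ i]/(mem st3 i) m3 m2 [mem _]m1.
- rewrite -[mem _ _]/(mem st3 (addr (size input) W a i j l)) m3 m2 [mem _]m1.
  by rewrite [LHS]nth_default // leq_addr.
Qed.

Definition loop_par i := i \notin [:: 0; 1; pG; pM].

(** The exponents are maxima over the text, found by evaluating [mstm]: at most five nested loops of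
    class [SizeK], two over vertices or values, and one over assignments. *)
Lemma steps_phase p c D m : D <= d -> stm_loops loop_par p ->
  [&& (mstm par_class p).1 <= c, (mstm par_class p).2.1.1 <= 5,
      (mstm par_class p).2.1.2 <= 2 & (mstm par_class p).2.2 <= 1] ->
  steps (nth 0 (take m (ps D))) p <=
    c * (bigpow d k ^ 5 * n.+1 ^ 2 * (maxn 1 n ^ (k %/ 4)) ^ 1).
Proof.
move=> leD okp bounds.
have K0 := bigpow_gt0 k d.
have P0 : 0 < maxn 1 n ^ (k %/ 4) by rewrite expn_gt0 leq_max.
have class_ok := params_class W (size input) (size (encode H)) k n leD m.
have le := steps_mval K0 (ltn0Sn n) P0 class_ok okp; apply: leq_trans le _.
exact: mval_le.
Qed.

Lemma run_phases mode D s1 s2 s3 : mode < 3 -> D <= n ->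
  phase1_spec H G s1 D ->
  s2 = run W (nth 0 (take 12 (ps D))) inp (phase2 nat) s1 ->
  s3 = run W (nth 0 (ps D)) inp (phase3 nat mode) s2 ->
  [/\ s2 aPAR pCL 0 0 = (2 * D.+1) ^ (k * k), s2 aPAR pCS 0 0 = k.+1 ^ (5 * k),
      s2 aPAR pP 0 0 = maxn 1 n ^ (k %/ 4), s2 aPAR pKPK 0 0 = k ^ k
    & s3 aANS 0 0 0 = answer H G mode].
Proof.
move=> mode3 leDn [_ _ [oarc [adjE FE]] [F_id F_le] [HA acc0]] s2E s3E.
set b := 2 * (n + (k + 20)).
have bE : b = 2 * (n + (k + 20)) by [].
have hK y e : y <= b ^ e -> e < (k + 20) * (k + 20) -> y < W by apply: ltn_bigpow.
have lin y : y <= b -> y < W by move=> le; apply: (hK _ 1); rewrite ?expn1; lia.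
have quad y z : y <= b -> z <= b -> y * z < W.
  by move=> ley lez; apply: (hK _ 2); rewrite ?expnS ?expn1 ?muln1 ?leq_mul //; lia.
have CL : (2 * D.+1) ^ (k * k) < W by apply: (hK _ (k * k)); [apply: leq_exp_mono; lia | nia].
have CS : k.+1 ^ (5 * k) < W by apply: (hK _ (5 * k)); [apply: leq_exp_mono; lia | nia].
have PW : (maxn 1 n ^ (k %/ 4)).+1 < W.
  apply: (hK _ k.+1); last nia.
  have : maxn 1 n ^ (k %/ 4) <= b ^ k by apply: leq_exp_mono; rewrite ?leq_div //; lia.
  have : 0 < b ^ k by rewrite expn_gt0; lia.
  by rewrite expnS; nia.
have KK : k ^ k < W by apply: (hK _ k); [apply: leq_exp_mono; lia | nia].
have NK : n ^ k < W by apply: (hK _ k); [apply: leq_exp_mono; lia | nia].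
have VK : maxn 1 n ^ k < W by apply: (hK _ k); [apply: leq_exp_mono; lia | nia].
have n2 : n.+2 < W by apply: lin; lia.
have k5 : 5 * k < W by apply: quad; lia.
have k4 : 4 * k.+1 < W by apply: quad; lia.
have := @phase2P W (nth 0 (take 12 (ps D))) inp narr_le k n (2 * D.+1) s1
  erefl erefl erefl erefl erefl erefl CL CS (ltnW PW) KK k4.
rewrite -s2E; cbv zeta => -[c1 c2 c3 c4 eqs].
split=> //; rewrite s3E.
have const : const_arrays s1 s2 by rewrite /const_arrays !eqs.
have acc2 : s2 aACC 0 0 0 = 0 by rewrite eqs.
exact: (@phase3P W (nth 0 (ps D)) inp narr_le k n D H G (fun l x => s1 aOUT l x 0)
  erefl erefl erefl erefl erefl erefl erefl erefl erefl erefl erefl erefl erefl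
  n2 k5 CL CS VK PW KK NK oarc adjE FE F_id F_le s1 HA (fun _ _ _ => erefl) mode s2
  mode3 const acc2).
Qed.

Lemma par_good_take D m : D <= n -> par_good W (size input) (take m.+2 (ps D)).
Proof.
move=> leD; split=> //; apply: params_lt => //; exact: size_encode.
Qed.

Lemma programP mode : mode < 3 ->
  outputs_in_time (program mode) input (answer H G mode)
    (2018 * (bigpow d k ^ 5 * n.+1 ^ 2 * maxn 1 n ^ (k %/ 4)) * U).
Proof.
move=> mode3; have W_ge := narr_le; have base_le := ltnW size_input_lt.
have inp_out i : size input <= i -> inp i = 0 by move=> le; rewrite /inp nth_default.
have lin y : y <= 2 * (n + (k + 20)) -> y < W.
  by move=> le; apply: (@ltn_bigpow _ _ _ 1); rewrite ?expn1; lia.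
have quad y z : y <= 2 * (n + (k + 20)) -> z <= 2 * (n + (k + 20)) -> y * z < W.
  by move=> ley lez; apply: (@ltn_bigpow _ _ _ 2); rewrite ?expnS ?expn1 ?muln1 ?leq_mul //; nia.
have kk : k * k < W by apply: quad; lia.
have k5 : 5 * k < W by apply: quad; lia.
have n2 : 2 * n.+1 < W by apply: lin; lia.
have k1 : k.+1 < W by apply: lin; lia.
(* D is only determined by the first stage. The six parameters of that stage do not involve it, so
   their list can be taken with 0. *)
have [D [spec1 cells1]] := @phase1P W (nth 0 (take 6 (ps 0))) inp W_ge k n H G
  (fun=> erefl) erefl erefl erefl size_input_lt kk k5 n2 k1.
set s1 := run W _ inp (phase1 nat) zeros in spec1 cells1.
pose s2 := run W (nth 0 (take 12 (ps D))) inp (phase2 nat) s1.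
pose s3 := run W (nth 0 (ps D)) inp (phase3 nat mode) s2.
have [leDd leDn _ _ _] := spec1.
have [c1 c2 c3 c4 ans] := run_phases mode3 leDn spec1 (erefl s2) (erefl s3).
pose X := bigpow d k ^ 5 * n.+1 ^ 2 * (maxn 1 n ^ (k %/ 4)) ^ 1.
have t1 : steps (nth 0 (take 6 (ps D))) (phase1 nat) <= 415 * X by apply: steps_phase.
have t2 : steps (nth 0 (take 12 (ps D))) (phase2 nat) <= 70 * X by apply: steps_phase.
have t3 : steps (nth 0 (take 16 (ps D))) (phase3 nat mode) <= 1448 * X.
  by apply: steps_phase => //; case: (mode) mode3 => [|[|[|//]]].
pose T0 := 4 * k + 4 * n + 3 * ((k + 20) * (k + 20)) + 17.
have K0 := bigpow_gt0 k d.
have P0 : 0 < maxn 1 n ^ (k %/ 4) by rewrite expn_gt0 leq_max.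
have KN : bigpow d k * n.+1 <= X.
  rewrite /X expn1 -[leqLHS]muln1; apply: leq_mul => //; apply: leq_mul.
    by rewrite -[leqLHS]expn1 leq_pexp2l.
  by rewrite -[leqLHS]expn1 leq_pexp2l.
have X0 : 0 < X by apply: leq_trans KN; rewrite muln_gt0 K0.
have T0X : T0 <= 28 * X.
  move: (sq_le_bigpow k d) KN; rewrite /T0; clearbody X; clear.
  by move: (bigpow d k) => K; nia.
(* The constants add up to 2018: 28 for the prologue, 415, 70 and 1448 for the stages, 31 and 21 for
   loading six and four parameters, and 5 for the answer. *)
pose T := T0 * U + (415 * X * U + (31 * U + (70 * X * U + (21 * U + (1448 * X * U + 5 * U))))).
have TX : T <= 2018 * (bigpow d k ^ 5 * n.+1 ^ 2 * maxn 1 n ^ (k %/ 4)) * U.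
  rewrite -[maxn 1 n ^ _]expn1 -/X /T -!mulnDl leq_mul2r; apply/orP; right.
  by move: T0X X0; clear; lia.
suff [t [st [ex le out]]] : achieves (program mode) T (init input)
    (fun st => reg st 0 = answer H G mode).
  by exists t, st; split=> //; apply: leq_trans TX.
have wf3 := wf_phase3 mode3.
apply: achieves_seq; apply: (achieves_weak (leqnn _) _ (prologueP D)) => st0 cf0.
apply: achieves_seq.
have le1 : steps (nth 0 (take 6 (ps D))) (phase1 nat) * U <= 415 * X * U by rewrite leq_mul2r t1 orbT.
apply: (achieves_weak le1 _
  (comp_config inp_lt inp_out W_ge base_le wf_phase1 (par_good_take 4 leDn) cf0)) => st1 cf1.
apply: achieves_seq.
have e1 : [seq s1 aPAR i 0 0 | i <- iota 6 6] =
    [:: n.+1; k.+1; k * k; 5 * k; D.+1; 2 * D.+1].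
  by case: cells1 => x1 x2 x3 x4 [x5 x6]; rewrite -x6 -x5 -x4 -x3 -x2 -x1.
have e2 : [seq s2 aPAR i 0 0 | i <- iota 12 4] =
    [:: (2 * D.+1) ^ (k * k); k.+1 ^ (5 * k); maxn 1 n ^ (k %/ 4); k ^ k].
  by rewrite -c1 -c2 -c3 -c4.
have := loads_config (m := 6) inp_lt inp_out W_ge base_le
  (isT : 1 < size (take 6 (ps D))) isT (par_good_take 4 leDn) cf1.
rewrite e1; cbv zeta => ld; apply: (achieves_weak (leqnn _) _ ld) => st2 [_ cf2].
apply: achieves_seq.
have le2 : steps (nth 0 (take 12 (ps D))) (phase2 nat) * U <= 70 * X * U by rewrite leq_mul2r t2 orbT.
apply: (achieves_weak le2 _
  (comp_config inp_lt inp_out W_ge base_le wf_phase2 (par_good_take 10 leDn) cf2)) => st3 cf3.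
apply: achieves_seq.
have := loads_config (m := 4) inp_lt inp_out W_ge base_le
  (isT : 1 < size (take 12 (ps D))) isT (par_good_take 10 leDn) cf3.
rewrite -/s2 e2; cbv zeta => ld2; apply: (achieves_weak (leqnn _) _ ld2) => st4 [_ cf4].
apply: achieves_seq.
have le3 : steps (nth 0 (take 16 (ps D))) (phase3 nat mode) * U <= 1448 * X * U.
  by rewrite leq_mul2r t3 orbT.
apply: (achieves_weak le3 _
  (comp_config inp_lt inp_out W_ge base_le wf3 (par_good_take 14 leDn) cf4)) => st5 cf5.
by apply: (readP inp_lt inp_out W_ge base_le _ _ (par_good_take 14 leDn) cf5).
Qed.

End Program.

(** * The computable factor and the final bound *)

Definition size_factor d k := bigpow d k ^ 5.

(** The routine that computes the modulus from n and k serves again, with d in place of n. *)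
Lemma computable_size_factor : computable2 size_factor.
Proof.
pose x2 := Op Mul (Reg 1) (Reg 1); pose x4 := Op Mul x2 x2.
exists (Seq (Assign 4 (Deref (Const 0))) (Seq (Assign 3 (Deref (Const 1)))
  (Seq power (Assign 0 (Op Mul (Reg 1) x4))))) => d k.
have assign r e st (Q : state -> Prop) :
    Q (State (upd (reg st) r (eval st e)) (mem st)) ->
    achieves (Assign r e) (cost st e + bits (eval st e)) st Q.
  by move=> q; do 2!eexists; split; [exact: ExecAssign | |exact: q].
pose st2 := State (upd (upd (fun=> 0) 4 d) 3 k) (mem (init [:: d; k])).
have [t3 [st3 [ex3 _ [_ w3 _]]]] :=
  @powerP (bigpow d k) d k st2 erefl erefl (leqnn _).
do 3!eexists; split; [| |exact: leqnn].
  apply: ExecSeq; first exact: ExecAssign.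
  apply: ExecSeq; first exact: ExecAssign.
  apply: ExecSeq; [exact: ex3 | exact: ExecAssign].
by rewrite /= /upd /= w3 /size_factor !expnS expn0 muln1 !mulnA.
Qed.

(** The exponent in [bigpow] depends on k alone, so the bit length is a polynomial in k times a
    logarithm. *)
Lemma bits_bigpow n d k :
  bits (bigpow n k) <= 8 * ((k + 20) * (k + 20)) * trunc_log 2 (2 * n.+1 * d.+1 * k.+1).
Proof.
set e := (k + 20) * (k + 20); set x := 2 * n.+1 * d.+1 * k.+1.
have l1 : 0 < trunc_log 2 x by rewrite trunc_log_gt0 /=; rewrite /x; nia.
have ltx : x < 2 ^ (trunc_log 2 x).+1 by apply: trunc_log_ltn.
have e0 : 0 < e by rewrite /e; lia.
have le_b : 2 * (n + (k + 20)) < 2 ^ (8 * trunc_log 2 x).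
  apply: (@leq_trans (2 ^ 6 * x)); first by rewrite /x; nia.
  apply: (@leq_trans (2 ^ (6 + (trunc_log 2 x).+1))).
    by rewrite expnD leq_pmul2l // ltnW.
  by apply: leq_pexp2l => //; lia.
apply: bits_leq; first by rewrite muln_gt0 l1 muln_gt0 e0.
rewrite /bigpow -/e (_ : 8 * e * _ = 8 * trunc_log 2 x * e); last by ring.
by rewrite expnM ltn_exp2r.
Qed.

Lemma unit_cost_bigpow : exists a, forall n d k,
  unit_cost (bigpow n k) <= a * k.+1 ^ 4 * trunc_log 2 (2 * n.+1 * d.+1 * k.+1) ^ 2.
Proof.
exists (100 * 8 ^ 2 * 20 ^ 4) => n d k; set l := trunc_log 2 _.
have le_b : bits (bigpow n k) <= 8 * (20 * k.+1) ^ 2 * l.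
  apply: leq_trans (bits_bigpow n d k) _; rewrite leq_mul2r; apply/orP; right.
  by rewrite leq_mul2l /= expnS expn1; apply: leq_mul; lia.
have : bits (bigpow n k) ^ 2 <= (8 * (20 * k.+1) ^ 2 * l) ^ 2 by rewrite leq_exp2r.
rewrite /unit_cost => le2; apply: (@leq_trans (100 * (8 * (20 * k.+1) ^ 2 * l) ^ 2)).
  by rewrite leq_mul2l le2 orbT.
by apply: eq_leq; generalize 20 => y; ring.
Qed.

(* [maxn 1 n] is n, except that the empty graph is allowed constant time. *)
Theorem theorem1p1 :
  exists (f : nat -> nat -> nat) (c : nat) (p_hom p_sub p_ind : cmd),
    computable2 f /\
    forall (k n : nat) (H : sgraph k) (G : sgraph n),
      let d := degeneracy G in
      let input := encode H ++ encode G in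
      let T := f d k * tildeO c n d k (maxn 1 n ^ (k %/ 4 + 2)) in
      [/\ outputs_in_time p_hom input (hom H G) T,
          outputs_in_time p_sub input (sub H G) T
        & outputs_in_time p_ind input (ind H G) T].
Proof.
have [a leU] := unit_cost_bigpow.
(* One constant serves as coefficient and as all exponents: 2018 comes from the program, 4 from (n +
   1)^2 <= 4 max(1, n)^2 and a from the unit cost. The last summand 4 covers the exponents 4 of k +
   1 and 2 of the logarithm. *)
pose c := 2018 * 4 * a + 4.
exists size_factor, c, (program 0), (program 1), (program 2).
split=> [|k n H G d input T]; first exact: computable_size_factor.
suff leT mode : mode < 3 -> outputs_in_time (program mode) input (answer H G mode) T.
  by split; apply: (leT).
move=> /(programP H G) [t [s [ex out le]]]; exists t, s; split=> //.
apply: leq_trans le _; rewrite -/d /T /size_factor /tildeO.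
set l := trunc_log 2 _; set K := bigpow d k ^ 5; set M := maxn 1 n.
have M0 : 0 < M by rewrite leq_max.
have l0 : 0 < l by rewrite trunc_log_gt0 /=; nia.
have leN : n.+1 ^ 2 <= 4 * M ^ 2.
  by rewrite -[4]/(2 ^ 2) -expnMn leq_exp2r // /M; lia.
have leU' : unit_cost (bigpow n k) <= a * k.+1 ^ 4 * l ^ 2 by apply: leU.
apply: (@leq_trans (2018 * (K * (4 * M ^ 2) * M ^ (k %/ 4)) * (a * k.+1 ^ 4 * l ^ 2))).
  apply: leq_mul leU'; rewrite leq_mul2l; apply/orP; right.
  by rewrite leq_mul2r leq_mul2l leN !orbT.
rewrite expnD; move: (M ^ (k %/ 4)) (M ^ 2) => p m.
apply: (@leq_trans (K * (2018 * 4 * a * k.+1 ^ 4 * l ^ 2 * (p * m)))).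
  by apply: eq_leq; generalize 2018 => b; ring.
rewrite leq_mul2l leq_mul2r; apply/orP; right; apply/orP; right.
have le4 : 4 <= c by rewrite leq_addl.
apply: leq_mul; last by apply: leq_pexp2l => //; apply: leq_trans le4.
by apply: leq_mul; [exact: leq_addr | exact: leq_pexp2l].
Qed.
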